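(* Let $\mathbf{X}(t)$, $t\in\mathbb R$, be a stationary separable centered Gaussian random process whose covariance function $R(t,s)=R(t-s)$ is continuous. Let $\phi$ be an $f$-wavelet and let $\psi$ be the corresponding $m$-wavelet; suppose that $\phi$ and $\psi$ are continuous functions and that Assumption S holds for both $\phi$ and $\psi$. Suppose further that the following conditions hold: 1. the derivatives $\widehat{\phi}'(u)$ and $\widehat{\psi}''(u)$ exist (for $u\in\mathbb R$), and $\widehat{\psi}(0)=0$, $\widehat{\psi}'(0)=0$; 2. $\sup_{u\in\mathbb R}|\widehat{\phi}(u)|<\infty$, $\sup_{u\in\mathbb R}|\widehat{\phi}'(u)|<\infty$, $\sup_{u\in\mathbb R}|\widehat{\psi}''(u)|<\infty$; 3. $\widehat{\phi}(u)\to 0$ and $\widehat{\psi}(u)\to 0$ as $u\to\pm\infty$; 4. there exist $0<\gamma<\tfrac12$ and $\alpha>\tfrac12$ such that $$\int_{\mathbb R}\left(\ln(1+|u|)\right)^{\alpha}|\widehat{\psi}(u)|^{\gamma}\,du<\infty\quad\text{and}\quad \int_{\mathbb R}\left(\ln(1+|u|)\right)^{\alpha}|\widehat{\phi}(u)|^{\gamma}\,du<\infty;$$ 5. the Fourier transform $\widehat R(z)$ of $R$ exists and $\sup_{z\in\mathbb R}|\widehat R(z)|<\infty$; 6. $\int_{\mathbb R}|\widehat R'(z)|\,dz<\infty$ and $\int_{\mathbb R}|\widehat R^{(p)}(z)|\,|z|^4\,dz<\infty$ for $p=0,1$. For $n\in\mathbb N$ and $\mathbf{k}_n=(k_0,\dots,k_{n-1})\in\mathbb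 N_0^n$ put $$\mathbf{X}_{n,\mathbf{k}_n}(t):=\sum_{|k|\le k_0}\xi_{0k}\phi_{0k}(t)+\sum_{j=0}^{n-1}\sum_{|k|\le k_j}\eta_{jk}\psi_{jk}(t),$$ where $\xi_{0k}=\int_{\mathbb R}\mathbf{X}(t)\overline{\phi_{0k}(t)}\,dt$ and $\eta_{jk}=\int_{\mathbb R}\mathbf{X}(t)\overline{\psi_{jk}(t)}\,dt$ are mean-square integrals. Then $\mathbf{X}_{n,\mathbf{k}_n}(t)\to\mathbf{X}(t)$ uniformly in probability on each interval $[0,T]$ when $n\to\infty$ and $k_j\to\infty$ for all $j\in\mathbb N_0$; that is, for every $T>0$ and every $\varepsilon>0$, $$P\left\{\sup_{0\le t\le T}|\mathbf{X}(t)-\mathbf{X}_{n,\mathbf{k}_n}(t)|>\varepsilon\right\}\to 0$$ when $n\to\infty$ and $k_j\to\infty$ for all $j\in\mathbb N_0$.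
   Context: Notation: $\mathbb N_0=\{0,1,2,\dots\}$. The process $\mathbf X$ is defined on a standard probability space $\{\Omega,\mathcal B,P\}$; centered means $\mathbf E\mathbf X(t)=0$ for all $t\in\mathbb R$; the covariance function is $R(t,s)=\mathbf E\,\mathbf X(t)\overline{\mathbf X(s)}$, which by stationarity is a function $R(t-s)$ of the difference. The Fourier transform is $\widehat f(y)=\int_{\mathbb R}e^{-iyx}f(x)\,dx$, so the inverse transform is $f(x)=\frac1{2\pi}\int_{\mathbb R}e^{iyx}\widehat f(y)\,dy$. The function $\widehat R$ is the Fourier transform of the one-variable function $R$ (the spectral density of $\mathbf X$ in this normalization), and $\widehat R^{(p)}$ is its $p$-th derivative. $f$-wavelet: a function $\phi\in L_2(\mathbb R)$ such that $\widehat\phi(0)\neq 0$, $\widehat\phi$ is continuous at $0$, $\sum_{k\in\mathbb Z}|\widehat\phi(y+2\pi k)|^2=1$ for a.e. $y$, and there exists a $2\pi$-periodic function $m_0\in L_2([0,2\pi])$ with $\widehat\phi(y)=m_0(y/2)\,\widehat\phi(y/2)$ for a.e. $y$. $m$-wavelet corresponding to $\phi$: the function $\psi$ that is the inverse Fourier transform of $$\widehat\psi(y)=\overline{m_0\left(\tfrac y2+\pi\right)}\,e^{-iy/2}\,\widehat\phi\left(\tfrac y2\right).$$ Dilations and translations: $\phi_{jk}(x)=2^{j/2}\phi(2^jx-k)$ and $\psi_{jk}(x)=2^{j/2}\psi(2^jx-k)$ for $j,k\in\mathbb Z$. Assumption S holds for a function $g$ (here $g=\phi$ or $g=\psi$)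 if there exists a decreasing function $\Phi(x)$, $x\ge 0$, such that $\Phi(0)<\infty$, $|g(x)|\le\Phi(|x|)$ for a.e. $x\in\mathbb R$, and $\int_{\mathbb R}\Phi(|x|)\,dx<\infty$. Mode of limit: $n$ and the components of $\mathbf k_n$ may tend to infinity in an arbitrary way. That is, the convergence holds along any sequence of pairs $(n^{(m)},\mathbf k^{(m)})$, $m\ge1$, with $n^{(m)}\in\mathbb N$ and $\mathbf k^{(m)}=(k^{(m)}_0,\dots,k^{(m)}_{n^{(m)}-1})\in\mathbb N_0^{n^{(m)}}$, such that $n^{(m)}\to\infty$ and, for each fixed $j\in\mathbb N_0$, $k^{(m)}_j\to\infty$ as $m\to\infty$ (where $k^{(m)}_j$ is defined for all large $m$). *)

(* Defs.v *)
(* MathComp / MathComp-Analysis, over an arbitrary realType R; complex numbers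
   are the type R[i] of mathcomp-real-closed. *)
From HB Require Import structures.
From mathcomp Require Export all_boot all_order all_algebra.
From mathcomp Require Export complex.
From mathcomp Require Export all_classical all_reals all_analysis.

Set Implicit Arguments.
Unset Strict Implicit.
Unset Printing Implicit Defensive.

Export Order.TTheory GRing.Theory Num.Theory.
Export numFieldNormedType.Exports.

Local Open Scope classical_set_scope.
Local Open Scope ring_scope.
Local Open Scope complex_scope.

Notation normc := Normc.normc.

(* Measurability, integrals, continuity and derivatives of complex-valued
   functions are taken on real and imaginary parts. *)
Section complex_valued.
Context {R : realType}.

Definition cis (x : R) : R[i] := cos x +i* sin x.

Definition cmeasurable d (T : measurableType d) (f : T -> R[i]) : Prop :=
  measurable_fun setT (fun x => complex.Re (f x)) /\
  measurable_fun setT (fun x => complex.Im (f x)).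

Definition cintegrable d (T : measurableType d)
    (mu : {measure set T -> \bar R}) (f : T -> R[i]) : Prop :=
  mu.-integrable setT (fun x => (complex.Re (f x))%:E) /\
  mu.-integrable setT (fun x => (complex.Im (f x))%:E).

Definition cintegral d (T : measurableType d)
    (mu : {measure set T -> \bar R}) (f : T -> R[i]) : R[i] :=
  Rintegral mu setT (fun x => complex.Re (f x)) +i*
  Rintegral mu setT (fun x => complex.Im (f x)).

Definition ccontinuous_at (f : R -> R[i]) (x : R) : Prop :=
  {for x, continuous (fun u => complex.Re (f u))} /\
  {for x, continuous (fun u => complex.Im (f u))}.

Definition ccontinuous (f : R -> R[i]) : Prop := forall x, ccontinuous_at f x.

Definition cderivable (f : R -> R[i]) : Prop :=
  forall x, derivable (fun u => complex.Re (f u)) x 1 /\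
            derivable (fun u => complex.Im (f u)) x 1.

(* Only meaningful when [cderivable f]. *)
Definition cderive (f : R -> R[i]) (x : R) : R[i] :=
  derive1 (fun u => complex.Re (f u)) x +i* derive1 (fun u => complex.Im (f u)) x.

End complex_valued.

Section wavelets.
Context {R : realType}.
Local Notation mu := (@lebesgue_measure R).

Definition L2on (D : set R) (f : R -> R[i]) : Prop :=
  cmeasurable f /\
  (\int[mu]_(x in D) ((normc (f x)) ^+ 2)%:E < +oo)%E.

(* \hat f(y) = \int e^{-iyx} f(x) dx and its inverse, as Lebesgue integrals:
   they are the usual transforms for integrable arguments.  In the theorem
   phi and psi are integrable by Assumption S, so that their L2 Fourier
   transforms are given by this formula. *)
Definition fourier (f : R -> R[i]) (y : R) : R[i] :=
  cintegral mu (fun x => cis (- (y * x)) * f x).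

Definition inv_fourier (g : R -> R[i]) (x : R) : R[i] :=
  ((2 * pi)^-1)%:C * cintegral mu (fun y => cis (y * x) * g y).

(* m0 is a filter of phi; by the condition \sum_k |\hat phi(y + 2 pi k)|^2 = 1
   it is determined almost everywhere by phi. *)
Definition is_filter (phi m0 : R -> R[i]) : Prop :=
  [/\ forall y, m0 (y + 2 * pi) = m0 y,
      L2on `[0, 2 * pi] m0 &
      {ae mu, forall y, fourier phi y = m0 (y / 2) * fourier phi (y / 2)}].

Definition f_wavelet (phi : R -> R[i]) : Prop :=
  [/\ L2on setT phi,
      fourier phi 0 != 0,
      ccontinuous_at (fourier phi) 0,
      {ae mu, forall y, (\esum_(k in [set: int])
          ((normc (fourier phi (y + 2 * pi * k%:~R))) ^+ 2)%:E = 1)%E} &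
      exists m0, is_filter phi m0].

(* Equality with the inverse transform is an equality of L2 functions,
   that is, almost everywhere. *)
Definition m_wavelet (phi psi : R -> R[i]) : Prop :=
  exists2 m0, is_filter phi m0 &
    {ae mu, forall x, psi x = inv_fourier (fun y =>
       conjc (m0 (y / 2 + pi)) * cis (- (y / 2)) * fourier phi (y / 2)) x}.

Definition dilate (g : R -> R[i]) (j k : int) (x : R) : R[i] :=
  (2 `^ (j%:~R / 2))%:C * g (2 ^ j * x - k%:~R).

(* "Decreasing" is non-increasing; Phi(0) < oo since Phi is real-valued. *)
Definition assumption_S (g : R -> R[i]) : Prop :=
  exists Phi : R -> R,
    [/\ forall x y, 0 <= x -> x <= y -> Phi y <= Phi x,
        {ae mu, forall x, normc (g x) <= Phi `|x|} &
        mu.-integrable setT (fun x => (Phi `|x|)%:E)].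

End wavelets.

Section processes.
Context {R : realType} {d : measure_display} {Omega : measurableType d}.
Variable P : probability Omega R.

(* Normal law of mean m and standard deviation s, the law of variance 0 being
   the point mass; normal_prob m 0 is not the point mass in the library. *)
Definition gaussian_rv (Y : Omega -> R) : Prop :=
  measurable_fun setT Y /\
  exists m s : R, forall A : set R, measurable A ->
    P (Y @^-1` A) = if s == 0 then \d_m A else normal_prob m s A.

(* All finite real-linear combinations of real and imaginary parts are
   Gaussian; real Gaussian processes are the case Im X = 0. *)
Definition gaussian_process (X : R -> Omega -> R[i]) : Prop :=
  forall (n : nat) (t a b : 'I_n -> R),
    gaussian_rv (fun w => \sum_(i < n)
      (a i * complex.Re (X (t i) w) + b i * complex.Im (X (t i) w))).

Definition centered_process (X : R -> Omega -> R[i]) : Prop :=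
  forall t, cintegral P (X t) = 0.

Definition covariance_fun (X : R -> Omega -> R[i]) (t s : R) : R[i] :=
  cintegral P (fun w => X t w * conjc (X s w)).

(* Doob separability: off a single negligible set, X(t) in F for all t in a
   countable dense part of an open interval forces it on the whole interval.
   Closed sets of C are closed sets of R x R. *)
Definition separable_process (X : R -> Omega -> R[i]) : Prop :=
  exists (S : set R) (N : set Omega),
    [/\ countable S, dense S, P.-negligible N &
      forall (a b : R) (F : set (R * R)), closed F ->
        [set w | forall t, t \in `]a, b[ -> S t ->
                   F (complex.Re (X t w), complex.Im (X t w))] `\`
        [set w | forall t, t \in `]a, b[ ->
                   F (complex.Re (X t w), complex.Im (X t w))]
        `<=` N].

Definition mean_square (Z : Omega -> R[i]) : \bar R :=
  (\int[P]_w ((normc (Z w)) ^+ 2)%:E)%E.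

(* xi is (a version of) the mean-square integral of Y over [a, b]: the limit
   in mean square of the Riemann sums over the tagged partitions
   a = s 0 <= u 0 <= s 1 <= ... <= s n = b as the mesh tends to 0. *)
Definition is_ms_integral_on (Y : R -> Omega -> R[i]) (a b : R)
    (xi : Omega -> R[i]) : Prop :=
  cmeasurable xi /\
  forall eps : R, 0 < eps -> exists2 delta : R, 0 < delta &
    forall (n : nat) (s u : nat -> R),
      s 0%N = a -> s n = b ->
      (forall i, (i < n)%N -> s i <= u i <= s i.+1) ->
      (forall i, (i < n)%N -> s i.+1 - s i < delta) ->
      (mean_square (fun w =>
         (\sum_(i < n) (s i.+1 - s i)%:C * Y (u i) w) - xi w)%R < eps%:E)%E.

(* Over the line: the limit in mean square of the integrals over [a, b] as
   a --> -oo and b --> +oo. *)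
Definition is_ms_integral (Y : R -> Omega -> R[i]) (xi : Omega -> R[i]) : Prop :=
  cmeasurable xi /\
  exists2 J : R -> R -> Omega -> R[i],
    forall a b, a <= b -> is_ms_integral_on Y a b (J a b) &
    forall eps : R, 0 < eps -> exists2 A : R, 0 < A &
      forall a b, a <= - A -> A <= b ->
        (mean_square (fun w => J a b w - xi w)%R < eps%:E)%E.

End processes.

Section partial_sums.
Context {R : realType} {Omega : Type}.

(* \sum_{|l| <= K} F l *)
Definition sym_sum (K : nat) (F : int -> R[i]) : R[i] :=
  \sum_(i < K.*2.+1) F (i%:Z - K%:Z).

Definition wavelet_sum (phi psi : R -> R[i]) (xi : int -> Omega -> R[i])
    (eta : nat -> int -> Omega -> R[i]) (n : nat) (k : n.-tuple nat)
    (t : R) (w : Omega) : R[i] :=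
  sym_sum (nth 0%N k 0) (fun l => xi l w * dilate phi 0 l t) +
  \sum_(j < n) sym_sum (tnth k j) (fun l => eta j l w * dilate psi j l t).

End partial_sums.

(* Main.v *)
From HB Require Import structures.
Require Import Defs.
From mathcomp Require Import ring lra zify measurable_realfun.

(** The wavelet series is controlled by first moments, level by level.
    The coefficient [2^(j/2) eta_jl] is represented by the spectral function
    [e^(i u l / 2^j) conj (psi^ (u / 2^j))]; since [psi^ (u) = O(u^2)] and
    [|R^| u^4] is integrable, its second moment is [O(16^-j)] and its first
    moment [O(4^-j)].  For bounded [t] the sum over [l] of
    [sup_t |psi (2^j t - l)|] is [O(2^j)] by Assumption S.  So
    [\sum_(j, l) E|2^(j/2) eta_jl| sup_t |psi (2^j t - l)|] is finite, and off
    an event of small probability all partial sums that contain a large finite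
    block are uniformly close to each other.  Mean-square convergence at each
    fixed [t] identifies their limit with [X t] on a countable set of times,
    and separability extends the estimate to all times.

    Mean-square convergence is a statement about spectral functions: Fourier
    inversion of the covariance bounds [E|\sum_i a_i X (t_i)|^2] by
    [\int |\sum_i a_i e^(i t_i u)|^2 |R^ (u)| du].  With
    [p_y (x) = \sum_k phi (x - k) e^(-i y (x - k))], the expansion up to level
    [n] of [e^(i t u)] telescopes to
    [e^(i t u) conj (phi^ (u / 2^n)) p_(u / 2^n) (2^n t)]: the two sides of one
    step are continuous 1-periodic functions of [t] whose Fourier coefficients
    agree by the quadrature mirror identity
    [|m0 (u)|^2 + |m0 (u + pi)|^2 = 1].  The limit is [e^(i t u)] because
    [|phi^ (0)| = 1] and [phi^ (2 pi l) = 0] for [l <> 0], which makes [p_0]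
    the constant [phi^ (0)]. *)

Set Implicit Arguments.
Unset Strict Implicit.
Unset Printing Implicit Defensive.

Local Open Scope classical_set_scope.
Local Open Scope ring_scope.
Local Open Scope complex_scope.

(** * Complex-valued functions *)

(** The mean-square analysis yields only an iterated limit: for every large level count [n], all
    truncations [K] beyond a bound depending on [n]. The theorem lets [n] and the [k_j] grow in any
    manner. The first-moment bound bridges this gap, since it compares an arbitrary partial sum with
    the rectangular one [(n, K)] of the mean-square limit. The filter [m0] is merely measurable, so
    its identities hold only almost everywhere. Where a value at a single point is needed, the
    identity is first brought into a form with continuous sides: refinement equations are
    cross-multiplied, translates are periodized, and inversion is carried out at points where a
    quotient of continuous functions represents the transform. Condition 4 enters through the
    integrability of [phi^], which together with its Lipschitz bound yields a summable majorant of
    [|phi^ (y + 2 pi k)|^2]. The Gaussian assumption supplies finite second moments. The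
    coefficients are known only as mean-square limits of Riemann sums, so each is handled through
    trigonometric polynomials that approximate its spectral function. *)

Section normc_theory.
Context {R : realType}.
Implicit Types (x y : R) (z w : R[i]).

Lemma normc_ge0 z : 0 <= normc z.
Proof. by case: z => a b; rewrite /normc sqrtr_ge0. Qed.

Lemma sqr_normcE z : normc z ^+ 2 = complex.Re z ^+ 2 + complex.Im z ^+ 2.
Proof. by case: z => a b; rewrite /normc sqr_sqrtr ?addr_ge0 ?sqr_ge0. Qed.

Lemma normcN z : normc (- z) = normc z.
Proof. by case: z => a b; rewrite /normc /= !sqrrN. Qed.

Lemma normc_conj z : normc (conjc z) = normc z.
Proof. by case: z => a b; rewrite /normc /= sqrrN. Qed.

Lemma le_Re_normc z : `|complex.Re z| <= normc z.
Proof.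
rewrite -(@ler_pXn2r _ 2) ?nnegrE ?normc_ge0 ?normr_ge0 //.
by rewrite sqr_normcE real_normK ?num_real //; have := sqr_ge0 (complex.Im z); lra.
Qed.

Lemma le_Im_normc z : `|complex.Im z| <= normc z.
Proof.
rewrite -(@ler_pXn2r _ 2) ?nnegrE ?normc_ge0 ?normr_ge0 //.
by rewrite sqr_normcE real_normK ?num_real //; have := sqr_ge0 (complex.Re z); lra.
Qed.

Lemma normc_le_ReIm z : normc z <= `|complex.Re z| + `|complex.Im z|.
Proof.
rewrite -(@ler_pXn2r _ 2) ?nnegrE ?normc_ge0 ?addr_ge0 //.
rewrite sqr_normcE sqrrD !real_normK ?num_real //.
have : 0 <= `|complex.Re z| * `|complex.Im z| by exact: mulr_ge0.
by move: (_ * _) => a; lra.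
Qed.

Lemma normc_real x : normc x%:C = `|x|.
Proof. by rewrite /normc /= expr0n /= addr0 sqrtr_sqr. Qed.

Lemma normcD z w : normc (z + w) <= normc z + normc w.
Proof. exact: le_normcD. Qed.

Lemma normcB z w : normc (z - w) <= normc z + normc w.
Proof. by rewrite (le_trans (normcD _ _)) // normcN. Qed.

Lemma normc_distC z w : normc (z - w) = normc (w - z).
Proof. by rewrite -opprB normcN. Qed.

Lemma normc_sum (I : Type) (s : seq I) (P : pred I) (F : I -> R[i]) :
  normc (\sum_(i <- s | P i) F i) <= \sum_(i <- s | P i) normc (F i).
Proof.
elim/big_ind2: _ => [|z x w y zx wy|//]; first by rewrite Normc.normc0.
by rewrite (le_trans (normcD _ _)) // lerD.
Qed.

Lemma sqr_normcD z w : normc (z + w) ^+ 2 <= 2 * normc z ^+ 2 + 2 * normc w ^+ 2.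
Proof.
have := normcD z w; have := normc_ge0 (z + w).
have := normc_ge0 z; have := normc_ge0 w.
move: (normc z) (normc w) (normc (z + w)) => a b c b0 a0 c0 cab.
have := ler_pM c0 c0 cab cab; have := sqr_ge0 (a - b); rewrite !expr2; nra.
Qed.

Lemma mul_conjc z : z * conjc z = (normc z ^+ 2)%:C.
Proof. by rewrite sqr_normcE; case: z => a b; simpc; congr (_ +i* _); ring. Qed.

Lemma ReM z w : complex.Re (z * w) =
  complex.Re z * complex.Re w - complex.Im z * complex.Im w.
Proof. by case: z w => a b [c d]. Qed.

Lemma ImM z w : complex.Im (z * w) =
  complex.Re z * complex.Im w + complex.Im z * complex.Re w.
Proof. by case: z w => a b [c d]. Qed.

Lemma ReD z w : complex.Re (z + w) = complex.Re z + complex.Re w.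
Proof. by case: z w => a b [c d]. Qed.

Lemma ImD z w : complex.Im (z + w) = complex.Im z + complex.Im w.
Proof. by case: z w => a b [c d]. Qed.

Lemma ReN z : complex.Re (- z) = - complex.Re z.
Proof. by case: z. Qed.

Lemma ImN z : complex.Im (- z) = - complex.Im z.
Proof. by case: z. Qed.

Lemma Re_conj z : complex.Re (conjc z) = complex.Re z.
Proof. by case: z. Qed.

Lemma Im_conj z : complex.Im (conjc z) = - complex.Im z.
Proof. by case: z. Qed.

Lemma complex_ext z w :
  complex.Re z = complex.Re w -> complex.Im z = complex.Im w -> z = w.
Proof. by case: z w => a b [c d] /= -> ->. Qed.

Lemma conjcM z w : conjc (z * w) = conjc z * conjc w.
Proof. exact: (rmorphM (@conjc R)). Qed.

Lemma conjc_sum (I : Type) (s : seq I) (P : pred I) (F : I -> R[i]) :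
  conjc (\sum_(i <- s | P i) F i) = \sum_(i <- s | P i) conjc (F i).
Proof. exact: (rmorph_sum (@conjc R)). Qed.

Lemma cisD x y : cis (x + y) = cis x * cis y.
Proof. by rewrite /cis cosD sinD; simpc; congr (_ +i* _); ring. Qed.

Lemma cis0 : cis 0 = 1 :> R[i].
Proof. by rewrite /cis cos0 sin0. Qed.

Lemma conj_cis x : conjc (cis x) = cis (- x).
Proof. by rewrite /cis cosN sinN. Qed.

Lemma normc_cis x : normc (cis x) = 1.
Proof. by rewrite /normc /= cos2Dsin2 sqrtr1. Qed.

Lemma cisN x : cis x * cis (- x) = 1.
Proof. by rewrite -cisD subrr cis0. Qed.

Lemma cis_pi : cis pi = -1 :> R[i].
Proof. by apply: complex_ext; rewrite /cis /= ?cospi ?sinpi ?oppr0. Qed.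

Lemma cis_2pi : cis (2 * pi) = 1 :> R[i].
Proof. by rewrite mulr_natl mulr2n cisD cis_pi mulrNN mulr1. Qed.

Lemma cis_int_2pi (l : int) : cis (2 * pi * l%:~R) = 1 :> R[i].
Proof.
have natP (m : nat) : cis (2 * pi * m%:R) = 1 :> R[i].
  elim: m => [|m IH]; first by rewrite mulr0 cis0.
  by rewrite -[m.+1]addn1 natrD mulrDr mulr1 cisD IH mul1r cis_2pi.
case: l => m; first exact: natP.
by rewrite NegzE mulrNz mulrN -conj_cis natP conjc1.
Qed.

End normc_theory.

Section ccvg.
Context {R : realType}.

(** Stated through real distances, so that limits of complex sequences reduce to limits in [R]. *)
Definition ccvg (u : nat -> R[i]) (l : R[i]) : Prop :=
  normc (u n - l) @[n --> \oo] --> (0 : R).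

Lemma ccvgP u l : ccvg u l <->
  (forall e : R, 0 < e -> exists N, forall n, (N <= n)%N -> normc (u n - l) < e).
Proof.
split=> [/cvgrPdist_lt h e e0|h].
  have [N _ hN] := h e e0; exists N => n Nn.
  by have := hN n Nn; rewrite /= sub0r normrN ger0_norm ?normc_ge0.
apply/cvgrPdist_lt => e e0; have [N hN] := h e e0.
exists N => // n Nn /=; rewrite sub0r normrN ger0_norm ?normc_ge0 //.
exact: hN.
Qed.

Lemma ccvg_le (u : nat -> R[i]) l (v : nat -> R) :
  v n @[n --> \oo] --> (0 : R) -> (forall n, normc (u n - l) <= v n) -> ccvg u l.
Proof.
move=> v0 uv; apply: (@squeeze_cvgr _ _ _ _ (cst 0) v) => //; last exact: cvg_cst.
by apply: nearW => n; rewrite normc_ge0 uv.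
Qed.

Lemma ccvg_cst l : ccvg (fun=> l) l.
Proof. by apply/ccvgP => e e0; exists 0%N => n _; rewrite subrr Normc.normc0. Qed.

Lemma ccvgD u v l m : ccvg u l -> ccvg v m -> ccvg (fun n => u n + v n) (l + m).
Proof.
move=> ul vm; apply: (@ccvg_le _ _ (fun n => normc (u n - l) + normc (v n - m))).
  by rewrite -[X in _ --> X]addr0; apply: cvgD.
by move=> n; rewrite opprD addrACA normcD.
Qed.

Lemma ccvgMl c u l : ccvg u l -> ccvg (fun n => c * u n) (c * l).
Proof.
move=> ul; apply: (@ccvg_le _ _ (fun n => normc c * normc (u n - l))).
  by rewrite -[X in _ --> X](mulr0 (normc c)); apply: cvgMr.
by move=> n; rewrite -mulrBr Normc.normcM.
Qed.

Lemma ccvgMr c u l : ccvg u l -> ccvg (fun n => u n * c) (l * c).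
Proof.
move=> /(ccvgMl c) ul; rewrite mulrC.
by under [X in ccvg X]funext do rewrite mulrC.
Qed.

Lemma ccvgN u l : ccvg u l -> ccvg (fun n => - u n) (- l).
Proof.
by move=> ul; apply: (ccvg_le ul) => n; rewrite -opprD normcN.
Qed.

Lemma ccvg_bounded u l : ccvg u l -> exists M : R, forall n, normc (u n) <= M.
Proof.
move=> /ccvgP /(_ 1 ltr01)[N hN].
exists (normc l + 1 + \sum_(i < N) normc (u i)) => n; have [Nn|nN] := leqP N n.
  rewrite -(subrK l (u n)) (le_trans (normcD _ _)) //.
  have := hN n Nn; have : 0 <= \sum_(i < N) normc (u i) by apply: sumr_ge0 => i _; exact: normc_ge0.
  lra.
rewrite (bigD1 (Ordinal nN)) //= ; have := normc_ge0 l.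
have : 0 <= \sum_(i < N | i != Ordinal nN) normc (u i) by apply: sumr_ge0 => i _; exact: normc_ge0.
lra.
Qed.

Lemma ccvgM u v l m : ccvg u l -> ccvg v m -> ccvg (fun n => u n * v n) (l * m).
Proof.
move=> ul vm; have [M hM] := ccvg_bounded ul.
apply: (@ccvg_le _ _ (fun n => M * normc (v n - m) + normc (u n - l) * normc m)).
  rewrite -[X in _ --> X]addr0; apply: cvgD.
    by rewrite -[X in _ --> X](mulr0 M); apply: cvgMr.
  by rewrite -[X in _ --> X](mul0r (normc m)); apply: cvgMl.
move=> n; rewrite (_ : _ - _ = u n * (v n - m) + (u n - l) * m); last ring.
by rewrite (le_trans (normcD _ _)) // !Normc.normcM lerD // ler_wpM2r ?normc_ge0.
Qed.

Lemma ccvg_conj u l : ccvg u l -> ccvg (fun n => conjc (u n)) (conjc l).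
Proof.
move=> ul; apply: (ccvg_le ul) => n.
by rewrite -(rmorphB (@conjc R)) normc_conj.
Qed.

Lemma ccvg_unique u l m : ccvg u l -> ccvg u m -> l = m.
Proof.
move=> ul um; apply/eqP; rewrite -subr_eq0; apply/eqP/Normc.eq0_normc.
apply/eqP; rewrite eq_le normc_ge0 andbT; apply/ler_addgt0Pr => e e0.
move/ccvgP: ul => /(_ (e / 2) ltac:(lra)) [N1 h1].
move/ccvgP: um => /(_ (e / 2) ltac:(lra)) [N2 h2].
have := h1 (maxn N1 N2) (leq_maxl _ _); have := h2 (maxn N1 N2) (leq_maxr _ _).
move: (u _) => z h3 h4; rewrite add0r.
rewrite (_ : l - m = (z - m) - (z - l)); last ring.
by have := normcB (z - m) (z - l); lra.
Qed.

Lemma ccvg_Re u l : ccvg u l -> complex.Re (u n) @[n --> \oo] --> complex.Re l.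
Proof.
move=> /ccvgP ul; apply/cvgrPdist_lt => e /ul[N hN]; exists N => // n /= Nn.
by rewrite -ReN -ReD (le_lt_trans (le_Re_normc _)) // normc_distC hN.
Qed.

Lemma ccvg_Im u l : ccvg u l -> complex.Im (u n) @[n --> \oo] --> complex.Im l.
Proof.
move=> /ccvgP ul; apply/cvgrPdist_lt => e /ul[N hN]; exists N => // n /= Nn.
by rewrite -ImN -ImD (le_lt_trans (le_Im_normc _)) // normc_distC hN.
Qed.

Lemma ccvg_ReIm u l : complex.Re (u n) @[n --> \oo] --> complex.Re l ->
  complex.Im (u n) @[n --> \oo] --> complex.Im l -> ccvg u l.
Proof.
move=> hr hi.
apply: (@ccvg_le _ _ (fun n => `|complex.Re (u n) - complex.Re l| + `|complex.Im (u n) - complex.Im l|)).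
  rewrite -[X in _ --> X]addr0; apply: cvgD; rewrite -(@normr0 R R); apply: cvg_norm.
    by rewrite -(subrr (complex.Re l)); apply: cvgB => //; exact: cvg_cst.
  by rewrite -(subrr (complex.Im l)); apply: cvgB => //; exact: cvg_cst.
by move=> n; rewrite (le_trans (normc_le_ReIm _)) // ReD ImD ReN ImN.
Qed.

Lemma ccvg_normc u l : ccvg u l -> normc (u n) @[n --> \oo] --> normc l.
Proof.
move=> /ccvgP ul; apply/cvgrPdist_lt => e /ul[N hN]; exists N => // n /= Nn.
have h1 := normcD (u n - l) l; have h2 := normcD (l - u n) (u n).
rewrite !subrK in h1 h2; have h3 := hN n Nn; rewrite normc_distC in h2.
rewrite ltr_norml; apply/andP; split; lra.
Qed.

Lemma eq_ccvg u v l : u =1 v -> ccvg u l -> ccvg v l.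
Proof. by move=> /funext ->. Qed.

Lemma ccvg_sum (I : Type) (s : seq I) (u : I -> nat -> R[i]) (l : I -> R[i]) :
  (forall i, ccvg (u i) (l i)) ->
  ccvg (fun n => \sum_(i <- s) u i n) (\sum_(i <- s) l i).
Proof.
move=> ul; elim: s => [|i s IH].
  by rewrite big_nil; under [X in ccvg X]funext do rewrite big_nil; exact: ccvg_cst.
by rewrite big_cons; under [X in ccvg X]funext do rewrite big_cons; apply: ccvgD.
Qed.

End ccvg.

Section cmeasurable_theory.
Context {R : realType} d (T : measurableType d).
Implicit Types f g : T -> R[i].

Lemma cmeasurable_cst (c : R[i]) : cmeasurable (fun _ : T => c).
Proof. by split; exact: measurable_cst. Qed.

Lemma cmeasurableD f g : cmeasurable f -> cmeasurable g ->
  cmeasurable (fun x => f x + g x).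
Proof.
move=> [f1 f2] [g1 g2]; split.
  by under eq_fun do rewrite ReD; apply: measurable_funD.
by under eq_fun do rewrite ImD; apply: measurable_funD.
Qed.

Lemma cmeasurableM f g : cmeasurable f -> cmeasurable g ->
  cmeasurable (fun x => f x * g x).
Proof.
move=> [f1 f2] [g1 g2]; split.
  by under eq_fun do rewrite ReM; apply: measurable_funB; apply: measurable_funM.
by under eq_fun do rewrite ImM; apply: measurable_funD; apply: measurable_funM.
Qed.

Lemma cmeasurableN f : cmeasurable f -> cmeasurable (fun x => - f x).
Proof.
move=> mf; under eq_fun do rewrite -mulN1r.
by apply: cmeasurableM => //; exact: cmeasurable_cst.
Qed.

Lemma cmeasurable_conj f : cmeasurable f -> cmeasurable (fun x => conjc (f x)).
Proof.
move=> [f1 f2]; split; first by under eq_fun do rewrite Re_conj.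
by under eq_fun do rewrite Im_conj; exact: measurableT_comp.
Qed.

Lemma cmeasurable_sum I (s : seq I) (F : I -> T -> R[i]) :
  (forall i, cmeasurable (F i)) -> cmeasurable (fun x => \sum_(i <- s) F i x).
Proof.
move=> mF; elim: s => [|i s IH].
  by under eq_fun do rewrite big_nil; exact: cmeasurable_cst.
by under eq_fun do rewrite big_cons; exact: cmeasurableD.
Qed.

Lemma cmeasurable_real (h : T -> R) : measurable_fun setT h ->
  cmeasurable (fun x => (h x)%:C).
Proof. by move=> mh; split => //=; exact: measurable_cst. Qed.

Lemma cmeasurable_cis (h : T -> R) : measurable_fun setT h ->
  cmeasurable (fun x => cis (h x)).
Proof.
move=> mh; split => /=; apply: measurableT_comp => //; apply: continuous_measurable_fun.
  exact: continuous_cos.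
exact: continuous_sin.
Qed.

Lemma measurable_normc f : cmeasurable f -> measurable_fun setT (fun x => normc (f x)).
Proof.
move=> [f1 f2].
rewrite (_ : (fun _ => _) =
    (fun x => Num.sqrt (complex.Re (f x) ^+ 2 + complex.Im (f x) ^+ 2))); last first.
  by apply/funext => x; case: (f x).
apply: measurableT_comp; first by apply: continuous_measurable_fun; exact: sqrt_continuous.
by apply: measurable_funD; exact: measurable_funX.
Qed.

End cmeasurable_theory.

Lemma cmeasurable_continuous {R : realType} (f : R -> R[i]) :
  ccontinuous f -> cmeasurable f.
Proof. by move=> cf; split; apply: continuous_measurable_fun => x; have [] := cf x. Qed.

Lemma cmeasurable_comp {R : realType} d1 d2 (T1 : measurableType d1) (T2 : measurableType d2)
    (f : T2 -> R[i]) (h : T1 -> T2) :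
  cmeasurable f -> measurable_fun setT h -> cmeasurable (fun x => f (h x)).
Proof.
move=> [f1 f2] mh; split.
  exact: (measurableT_comp f1 mh).
exact: (measurableT_comp f2 mh).
Qed.

(** * Integrals of real and complex functions *)

Section real_integral.
Context {R : realType} d (T : measurableType d) (mu : {measure set T -> \bar R}).
Implicit Types f g : T -> R.
Local Notation rintegrable f := (mu.-integrable setT (EFin \o f)).

Lemma le_rintegrable f g : measurable_fun setT f ->
  (forall x, `|f x| <= g x) -> rintegrable g -> rintegrable f.
Proof.
move=> mf fg; apply: le_integrable => //; first exact/measurable_EFinP.
by move=> x _ /=; rewrite lee_fin (le_trans (fg x)) // ler_norm.
Qed.

Lemma ae_le_rintegrable f g : measurable_fun setT f ->
  {ae mu, forall x, `|f x| <= g x} -> rintegrable g -> rintegrable f.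
Proof.
move=> mf fg /integrableP[mg ig]; apply/integrableP; split; first exact/measurable_EFinP.
apply: le_lt_trans ig; apply: ae_ge0_le_integral => //.
- by apply: measurableT_comp => //; exact/measurable_EFinP.
- exact: measurableT_comp.
- by apply: filterS fg => x fg _ /=; rewrite lee_fin (le_trans fg) // ler_norm.
Qed.

Lemma ge0_rintegrable f : measurable_fun setT f -> (forall x, 0 <= f x) ->
  (\int[mu]_x (f x)%:E < +oo)%E -> rintegrable f.
Proof.
move=> mf f0 foo; apply/integrableP; split; first exact/measurable_EFinP.
by under eq_integral do rewrite /= ger0_norm //.
Qed.

Lemma rintegrable_lty f : rintegrable f -> (forall x, 0 <= f x) ->
  (\int[mu]_x (f x)%:E < +oo)%E.
Proof.
move=> /integrableP[_ fi] f0; rewrite (le_lt_trans _ fi)//.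
by under [leRHS]eq_integral do rewrite /= ger0_norm //.
Qed.

Lemma EFin_Rintegral f : rintegrable f ->
  (Rintegral mu setT f)%:E = (\int[mu]_x (f x)%:E)%E.
Proof. by move=> fi; rewrite /Rintegral fineK // integrable_fin_num. Qed.

Lemma Rdct (f_ : nat -> T -> R) f g :
  (forall n, measurable_fun setT (f_ n)) -> measurable_fun setT f ->
  {ae mu, forall x, f_ n x @[n --> \oo] --> f x} ->
  rintegrable g -> (forall n x, `|f_ n x| <= g x) ->
  Rintegral mu setT (f_ n) @[n --> \oo] --> Rintegral mu setT f.
Proof.
move=> mf_ mf ff ig fg.
have [|||||fi _ h] := @dominated_convergence _ _ _ mu setT measurableT
  (fun n => EFin \o f_ n) (EFin \o f) (EFin \o g).
- by move=> n; exact/measurable_EFinP.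
- exact/measurable_EFinP.
- by apply: filterS ff => x ff _; apply: cvg_EFin => //; exact: nearW.
- exact: ig.
- by apply: aeW => x n _; rewrite /= lee_fin.
apply: fine_cvg; rewrite fineK; first exact: h.
exact: integrable_fin_num.
Qed.

Lemma Rintegral_cst0 : Rintegral mu setT (fun=> 0) = 0.
Proof. by rewrite /Rintegral integral0. Qed.

Lemma Rintegral_sum I (s : seq I) (F : I -> T -> R) :
  (forall i, rintegrable (F i)) ->
  Rintegral mu setT (fun x => \sum_(i <- s) F i x) = \sum_(i <- s) Rintegral mu setT (F i).
Proof.
move=> iF; elim: s => [|i s IH].
  by rewrite big_nil -[RHS]Rintegral_cst0; apply: eq_Rintegral => x _; rewrite big_nil.
rewrite big_cons -IH -RintegralD //; first by apply: eq_Rintegral => x _; rewrite big_cons.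
rewrite (_ : _ \o _ = (fun x => \sum_(j <- s) (F j x)%:E)%E); last first.
  by apply/funext => x /=; rewrite sumEFin.
by apply: integrable_sum => // i0 _; exact: iF.
Qed.

Lemma rintegrableD f g : rintegrable f -> rintegrable g -> rintegrable (fun x => f x + g x).
Proof. exact: integrableD. Qed.

Lemma rintegrableZ c f : rintegrable f -> rintegrable (fun x => c * f x).
Proof. exact: integrableZl. Qed.

Lemma rintegrableB f g : rintegrable f -> rintegrable g -> rintegrable (fun x => f x - g x).
Proof. exact: integrableB. Qed.

Lemma rintegrableN f : rintegrable f -> rintegrable (fun x => - f x).
Proof. exact: integrableN. Qed.

End real_integral.

Section cintegral_theory.
Context {R : realType} d (T : measurableType d) (mu : {measure set T -> \bar R}).
Implicit Types f g : T -> R[i].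
Local Notation rintegrable f := (mu.-integrable setT (EFin \o f)).

Lemma cintegrable_meas f : cintegrable mu f -> cmeasurable f.
Proof. by move=> [/measurable_int f1 /measurable_int f2]; split; exact/measurable_EFinP. Qed.

Lemma le_cintegrable f (g : T -> R) : cmeasurable f ->
  {ae mu, forall x, normc (f x) <= g x} -> rintegrable g -> cintegrable mu f.
Proof.
move=> [f1 f2] fg ig; split; apply: (ae_le_rintegrable _ _ ig) => //.
  by apply: filterS fg => x; apply: le_trans; exact: le_Re_normc.
by apply: filterS fg => x; apply: le_trans; exact: le_Im_normc.
Qed.

Lemma cintegrable_normc f : cintegrable mu f -> rintegrable (fun x => normc (f x)).
Proof.
move=> fi; have mf := cintegrable_meas fi; case: fi => f1 f2.
apply: (@le_rintegrable _ _ _ _ _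
  (fun x => `|complex.Re (f x)| + `|complex.Im (f x)|)).
- exact: measurable_normc.
- by move=> x; rewrite ger0_norm ?normc_ge0 // normc_le_ReIm.
- by apply: rintegrableD; exact: integrable_norm.
Qed.

Lemma cintegrableD f g : cintegrable mu f -> cintegrable mu g ->
  cintegrable mu (fun x => f x + g x).
Proof.
move=> [f1 f2] [g1 g2]; split.
  by under eq_fun do rewrite ReD; exact: rintegrableD.
by under eq_fun do rewrite ImD; exact: rintegrableD.
Qed.

Lemma cintegrableM_bounded (h f : T -> R[i]) (M : R) : cmeasurable h ->
  (forall x, normc (h x) <= M) -> cintegrable mu f ->
  cintegrable mu (fun x => h x * f x).
Proof.
move=> mh hM fi; have mf := cintegrable_meas fi.
apply: (@le_cintegrable _ (fun x => M * normc (f x))).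
- exact: cmeasurableM.
- by apply: aeW => x; rewrite Normc.normcM ler_wpM2r ?normc_ge0.
- by apply: rintegrableZ; exact: cintegrable_normc.
Qed.

Lemma cintegrableZ c f : cintegrable mu f -> cintegrable mu (fun x => c * f x).
Proof.
by apply: (@cintegrableM_bounded (fun=> c) _ (normc c)) => //; exact: cmeasurable_cst.
Qed.

Lemma cintegrable_conj f : cintegrable mu f -> cintegrable mu (fun x => conjc (f x)).
Proof.
move=> [f1 f2]; split; first by under eq_fun do rewrite Re_conj.
by under eq_fun do rewrite Im_conj; exact: rintegrableN.
Qed.

Lemma cintegrable0 : cintegrable mu (fun=> 0).
Proof. by split; exact: integrable0. Qed.

Lemma cintegrable_sum I (s : seq I) (F : I -> T -> R[i]) :
  (forall i, cintegrable mu (F i)) -> cintegrable mu (fun x => \sum_(i <- s) F i x).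
Proof.
move=> mF; elim: s => [|i s IH].
  by under eq_fun do rewrite big_nil; exact: cintegrable0.
by under eq_fun do rewrite big_cons; exact: cintegrableD.
Qed.

Lemma cintegrable_real (h : T -> R) : rintegrable h -> cintegrable mu (fun x => (h x)%:C).
Proof. by move=> ih; split => //=; exact: integrable0. Qed.

Lemma eq_cintegral f g : f =1 g -> cintegral mu f = cintegral mu g.
Proof. by move=> /funext ->. Qed.

Lemma cintegralD f g : cintegrable mu f -> cintegrable mu g ->
  cintegral mu (fun x => f x + g x) = cintegral mu f + cintegral mu g.
Proof.
move=> [f1 f2] [g1 g2]; apply: complex_ext; rewrite ?ReD ?ImD /= -RintegralD //;
  by apply: eq_Rintegral => x _; rewrite ?ReD ?ImD.
Qed.

Lemma cintegralZ c f : cintegrable mu f ->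
  cintegral mu (fun x => c * f x) = c * cintegral mu f.
Proof.
move=> [f1 f2]; apply: complex_ext; rewrite ?ReM ?ImM /=.
  rewrite -!RintegralZl // -RintegralB //; try exact: rintegrableZ.
  by apply: eq_Rintegral => x _; rewrite ReM.
rewrite -!RintegralZl // -RintegralD //; try exact: rintegrableZ.
by apply: eq_Rintegral => x _; rewrite ImM.
Qed.

Lemma cintegral0 : cintegral mu (fun=> 0) = 0.
Proof. by apply: complex_ext; rewrite /= Rintegral_cst0. Qed.

Lemma cintegralN f : cintegrable mu f -> cintegral mu (fun x => - f x) = - cintegral mu f.
Proof.
move=> fi; rewrite -mulN1r -cintegralZ //.
by apply: eq_cintegral => x; rewrite mulN1r.
Qed.

Lemma cintegrableB f g : cintegrable mu f -> cintegrable mu g ->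
  cintegrable mu (fun x => f x - g x).
Proof.
move=> fi gi; under eq_fun do rewrite -mulN1r.
by apply: cintegrableD => //; exact: cintegrableZ.
Qed.

Lemma cintegralB f g : cintegrable mu f -> cintegrable mu g ->
  cintegral mu (fun x => f x - g x) = cintegral mu f - cintegral mu g.
Proof.
move=> fi gi; rewrite -cintegralN // -cintegralD //.
by under eq_fun do rewrite -mulN1r; exact: cintegrableZ.
Qed.

Lemma cintegral_conj f : cintegrable mu f ->
  cintegral mu (fun x => conjc (f x)) = conjc (cintegral mu f).
Proof.
move=> [f1 f2]; apply: complex_ext; rewrite ?Re_conj ?Im_conj /=.
  by apply: eq_Rintegral => x _; rewrite Re_conj.
rewrite -mulN1r -RintegralZl //.
by apply: eq_Rintegral => x _; rewrite Im_conj mulN1r.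
Qed.

Lemma cintegral_sum I (s : seq I) (F : I -> T -> R[i]) :
  (forall i, cintegrable mu (F i)) ->
  cintegral mu (fun x => \sum_(i <- s) F i x) = \sum_(i <- s) cintegral mu (F i).
Proof.
move=> iF; elim: s => [|i s IH].
  by rewrite big_nil -[RHS]cintegral0; apply: eq_cintegral => x; rewrite big_nil.
rewrite big_cons -IH -cintegralD //; last exact: cintegrable_sum.
by apply: eq_cintegral => x; rewrite big_cons.
Qed.

Lemma cintegral_real (h : T -> R) :
  cintegral mu (fun x => (h x)%:C) = (Rintegral mu setT h)%:C.
Proof. by apply: complex_ext => //=; rewrite Rintegral_cst0. Qed.

(** Real and imaginary parts are bounded separately, hence the factor 2. It is harmless: $1/(2\pi)$
    absorbs it in the covariance bound, unspecified constants absorb it elsewhere. *)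
Lemma normc_cintegral f (g : T -> R) : cintegrable mu f -> rintegrable g ->
  (forall x, normc (f x) <= g x) -> normc (cintegral mu f) <= 2 * Rintegral mu setT g.
Proof.
move=> [f1 f2] ig fg; rewrite (le_trans (normc_le_ReIm _)) //= mulrDl mul1r lerD //.
  rewrite (le_trans (le_normr_Rintegral _ f1)) //.
  apply: le_Rintegral => //; first exact: integrable_norm.
  by move=> x _; exact: le_trans (le_Re_normc _) (fg x).
rewrite (le_trans (le_normr_Rintegral _ f2)) //.
apply: le_Rintegral => //; first exact: integrable_norm.
by move=> x _; exact: le_trans (le_Im_normc _) (fg x).
Qed.

Lemma cdct (f_ : nat -> T -> R[i]) f (g : T -> R) :
  (forall n, cmeasurable (f_ n)) -> cmeasurable f ->
  (forall x, ccvg (f_^~ x) (f x)) ->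
  rintegrable g -> (forall n x, normc (f_ n x) <= g x) ->
  ccvg (fun n => cintegral mu (f_ n)) (cintegral mu f).
Proof.
move=> mf_ mf ff ig fg; apply: ccvg_ReIm => /=.
- apply: (Rdct (g := g)) => //.
  + by move=> n; have [] := mf_ n.
  + by have [] := mf.
  + by apply: aeW => x; exact: ccvg_Re.
  + by move=> n x; exact: le_trans (le_Re_normc _) (fg n x).
- apply: (Rdct (g := g)) => //.
  + by move=> n; have [] := mf_ n.
  + by have [] := mf.
  + by apply: aeW => x; exact: ccvg_Im.
  + by move=> n x; exact: le_trans (le_Im_normc _) (fg n x).
Qed.

End cintegral_theory.

(** * Fourier analysis *)

Section affine_change.
Context {R : realType}.
Local Notation mu := (@lebesgue_measure R).
Local Notation rintegrable f := (mu.-integrable setT (EFin \o f)).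

Definition affine (a b : R) (x : R) : R := a * x + b.

Lemma measurable_affine a b : measurable_fun setT (affine a b : measurableTypeR R -> measurableTypeR R).
Proof. by apply: measurable_funD => //; apply: measurable_funM. Qed.

Lemma affine_preimage (a b : R) (u v : R) : 0 < a ->
  affine a b @^-1` `]u, v]%classic = `](u - b) / a, (v - b) / a]%classic.
Proof.
move=> a0; apply/seteqP; split => x /=; rewrite !in_itv /= /affine.
  by move=> /andP[h1 h2]; rewrite ltr_pdivrMr // ler_pdivlMr //; apply/andP; split; nra.
by rewrite ltr_pdivrMr // ler_pdivlMr // => /andP[h1 h2]; apply/andP; split; nra.
Qed.

(** The pushforward of Lebesgue measure, multiplied by [a], agrees with Lebesgue measure on
    half-open intervals, and these determine the measure. *)
Lemma lebesgue_affine (a b : R) (A : set R) : 0 < a -> measurable A ->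
  mu (affine a b @^-1` A) = (a^-1%:E * mu A)%E.
Proof.
move=> a0 mA; have a1 : 0 < a^-1 by rewrite invr_gt0.
have ma := measurable_affine a b.
pose a' : {nonneg R} := NngNum (ltW a0).
pose phi : {mfun measurableTypeR R >-> measurableTypeR R} :=
  HB.pack (affine a b : measurableTypeR R -> measurableTypeR R) (isMeasurableFun.Build _ _ _ _ _ ma).
pose nu : {measure set (measurableTypeR R) -> \bar R} := mscale a' (pushforward mu phi).
suff -> : mu A = nu ma A.
  rewrite /nu /mscale /= /pushforward muleA -EFinM mulVf ?gt_eqF // mul1e //.
apply: lebesgue_measure_unique => // _ [[u v] _ <-].
rewrite [RHS](_ : _ = (a%:E * mu (affine a b @^-1` `]u, v]%classic))%E) //.
rewrite affine_preimage // !lebesgue_measure_itv /=.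
rewrite !lte_fin ltr_pM2r // ltrD2r; case: ifPn => _; last by rewrite mule0.
rewrite -!EFinD -EFinM; congr EFin; field; lra.
Qed.

Lemma ae_mono (P Q : R -> Prop) : (forall x, P x -> Q x) ->
  {ae mu, forall x, P x} -> {ae mu, forall x, Q x}.
Proof. by move=> PQ [N [mN N0 PN]]; exists N; split => // x nQ; apply: PN => /PQ. Qed.

Lemma ae_and (P Q : R -> Prop) : {ae mu, forall x, P x} -> {ae mu, forall x, Q x} ->
  {ae mu, forall x, P x /\ Q x}.
Proof.
move=> [N [mN N0 PN]] [M [mM M0 QM]]; exists (N `|` M); split.
- exact: measurableU.
- by rewrite measureU0.
- move=> x /= nPQ; have [nx|/contrapT nx] := pselect (~ P x); first by left; exact: PN.
  by right; apply: QM => qx; apply: nPQ.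
Qed.

Lemma ae_int (P : int -> R -> Prop) : (forall l, {ae mu, forall x, P l x}) ->
  {ae mu, forall x, forall l, P l x}.
Proof.
move=> h.
have h1 : {ae mu, forall x, forall i, P (Posz i) x} by apply: ae_foralln => i; exact: h.
have h2 : {ae mu, forall x, forall i, P (Negz i) x} by apply: ae_foralln => i; exact: h.
by apply: ae_mono (ae_and h1 h2) => x [p1 p2] [i|i].
Qed.

Lemma ae_affine (a b : R) (P : R -> Prop) : 0 < a ->
  {ae mu, forall x, P x} -> {ae mu, forall x, P (a * x + b)}.
Proof.
move=> a0 [N [mN N0 PN]]; exists (affine a b @^-1` N); split.
- by rewrite -[X in measurable X]setTI; exact: measurable_affine.
- by rewrite lebesgue_affine // N0 mule0.
- by move=> x /= nP; apply: PN.
Qed.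

Lemma ae_shift (b : R) (P : R -> Prop) :
  {ae mu, forall x, P x} -> {ae mu, forall x, P (x + b)}.
Proof. by move=> /(ae_affine b ltr01); under [X in X -> _]eq_near do rewrite mul1r. Qed.

Lemma ge0_integral_affine (a b : R) (f : R -> R) : 0 < a -> measurable_fun setT f ->
  (forall x, 0 <= f x) ->
  (\int[mu]_x (f (a * x + b))%:E = a^-1%:E * \int[mu]_x (f x)%:E)%E.
Proof.
move=> a0 mf f0; have a1 : 0 < a^-1 by rewrite invr_gt0.
have ma := measurable_affine a b.
pose phi : {mfun measurableTypeR R >-> measurableTypeR R} :=
  HB.pack (affine a b : measurableTypeR R -> measurableTypeR R) (isMeasurableFun.Build _ _ _ _ _ ma).
pose a' : {nonneg R} := NngNum (ltW a1).
transitivity (\int[pushforward mu phi]_x (f x)%:E)%E.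
  rewrite ge0_integral_pushforward //.
  - exact/measurable_EFinP.
  - by move=> x _; rewrite lee_fin.
rewrite -(@ge0_integral_mscale _ _ _ mu setT measurableT a') //.
- by apply: eq_measure_integral => A mA _; rewrite /pushforward /mscale; exact: lebesgue_affine.
- exact/measurable_EFinP.
- by move=> x _; rewrite lee_fin.
Qed.

Lemma rintegrable_affine (a b : R) (f : R -> R) : 0 < a -> rintegrable f ->
  rintegrable (fun x => f (a * x + b)).
Proof.
move=> a0 fi; have mf : measurable_fun setT f by move/measurable_int : fi => /measurable_EFinP.
apply/integrableP; split.
  apply/measurable_EFinP; apply: (measurableT_comp mf); exact: (measurable_affine a b).
rewrite /= (ge0_integral_affine _ a0 (f := fun x => `|f x|)) //; last exact: measurableT_comp.
rewrite lte_mul_pinfty //; first by rewrite lee_fin invr_ge0 ltW.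
by have /integrableP[] := fi.
Qed.

Lemma rintegrable_shift (b : R) (f : R -> R) : rintegrable f -> rintegrable (fun x => f (x + b)).
Proof.
move=> /(rintegrable_affine b ltr01); apply: eq_integrable => // x _ /=.
by rewrite mul1r.
Qed.

Lemma Rintegral_affine (a b : R) (f : R -> R) : 0 < a -> rintegrable f ->
  Rintegral mu setT (fun x => f (a * x + b)) = a^-1 * Rintegral mu setT f.
Proof.
move=> a0 fi.
have pos (h : R -> R) : rintegrable h -> (forall x, 0 <= h x) ->
    Rintegral mu setT (fun x => h (a * x + b)) = a^-1 * Rintegral mu setT h.
  move=> hi h0; apply: EFin_inj.
  have ha := rintegrable_affine b a0 hi; rewrite EFinM (EFin_Rintegral ha) (EFin_Rintegral hi).
  by rewrite ge0_integral_affine //; move/measurable_int : hi => /measurable_EFinP.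
have ni : rintegrable (fun x => `|f x|) by exact: integrable_norm.
(* The change of variables is available for nonnegative functions; [f] is the difference of
   [|f| + f] and [|f|], both nonnegative and integrable. *)
have pi' : rintegrable (fun x => `|f x| + f x) by exact: rintegrableD.
have p0 x : 0 <= `|f x| + f x by have := ler_norm (- f x); rewrite normrN; lra.
have fE (x : R) : f x = (`|f x| + f x) - `|f x| by ring.
transitivity (Rintegral mu setT (fun x => (`|f (a * x + b)| + f (a * x + b)) - `|f (a * x + b)|)).
  by congr (Rintegral mu setT _); apply/funext => x; ring.
rewrite RintegralB //; last 2 first.
- exact: (rintegrable_affine b a0 pi').
- exact: (rintegrable_affine b a0 ni).
rewrite (pos (fun x => `|f x| + f x)) // (pos (fun x => `|f x|)) //.
rewrite -mulrBr -RintegralB //; congr (_ * Rintegral mu setT _).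
by apply/funext => x; ring.
Qed.

Lemma Rintegral_shift (b : R) (f : R -> R) : rintegrable f ->
  Rintegral mu setT (fun x => f (x + b)) = Rintegral mu setT f.
Proof.
move=> /(Rintegral_affine b ltr01); rewrite invr1 mul1r => <-.
by congr (Rintegral mu setT _); apply/funext => x; rewrite mul1r.
Qed.

Lemma cintegrable_affine (a b : R) (f : R -> R[i]) : 0 < a -> cintegrable mu f ->
  cintegrable mu (fun x => f (a * x + b)).
Proof.
move=> a0 [f1 f2]; split.
  exact: (rintegrable_affine b a0 f1).
exact: (rintegrable_affine b a0 f2).
Qed.

Lemma cintegrable_shift (b : R) (f : R -> R[i]) : cintegrable mu f ->
  cintegrable mu (fun x => f (x + b)).
Proof.
move=> [f1 f2]; split.
  exact: (rintegrable_shift b f1).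
exact: (rintegrable_shift b f2).
Qed.

Lemma cintegral_affine (a b : R) (f : R -> R[i]) : 0 < a -> cintegrable mu f ->
  cintegral mu (fun x => f (a * x + b)) = (a^-1)%:C * cintegral mu f.
Proof.
move=> a0 [f1 f2]; apply: complex_ext; rewrite /= mul0r ?subr0 ?addr0.
  exact: (Rintegral_affine b a0 f1).
exact: (Rintegral_affine b a0 f2).
Qed.

Lemma cintegral_shift (b : R) (f : R -> R[i]) : cintegrable mu f ->
  cintegral mu (fun x => f (x + b)) = cintegral mu f.
Proof.
move=> [f1 f2]; apply: complex_ext => /=.
  exact: (Rintegral_shift b f1).
exact: (Rintegral_shift b f2).
Qed.

(* The complement of an a.e. set is null, hence contains no interval. *)
Lemma ae_dense (P : R -> Prop) (x e : R) : {ae mu, forall x, P x} -> 0 < e ->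
  exists y, P y /\ x < y < x + e.
Proof.
move=> [N [mN N0 PN]] e0; apply: contrapT => /forallNP h.
pose I : set R := `]x, x + e[%classic.
have : (mu I <= mu N)%E.
  apply: le_measure; rewrite ?inE //=; first exact: measurable_itv.
  move=> y; rewrite /I /= in_itv /= => xy; apply: PN => /= Py.
  by apply: (h y); split.
by rewrite N0 /I lebesgue_measure_itv /= lte_fin ltrDl e0 -EFinD lee_fin addrAC subrr add0r leNgt e0.
Qed.

End affine_change.

Section ccontinuity.
Context {R : realType}.
Implicit Types (f g : R -> R[i]) (x : R).

Lemma ccontinuous_atP f x : ccontinuous_at f x <->
  (forall e : R, 0 < e -> exists2 delta : R, 0 < delta &
    forall y, `|y - x| < delta -> normc (f y - f x) < e).
Proof.
split=> [[/cvgrPdist_lt fr /cvgrPdist_lt fi] e e0|h].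
  have e2 : 0 < e / 2 by lra.
  have [d1 /= d10 h1] := fr _ e2; have [d2 /= d20 h2] := fi _ e2.
  exists (Num.min d1 d2); first by rewrite lt_min d10.
  move=> y; rewrite lt_min distrC => /andP[y1 y2].
  have := h1 y y1; have := h2 y y2 => /= h3 h4.
  have := normc_le_ReIm (f y - f x); rewrite ReD ImD ReN ImN.
  by rewrite (distrC (complex.Re _)) (distrC (complex.Im _)); lra.
split; apply/cvgrPdist_lt => e /h[delta d0 hd]; exists delta => //= y /=;
  rewrite distrC => /hd {}hd; apply: le_lt_trans hd; rewrite distrC.
  by rewrite -ReN -ReD le_Re_normc.
by rewrite -ImN -ImD le_Im_normc.
Qed.

Lemma ccontinuous_cst (c : R[i]) : ccontinuous (fun=> c).
Proof. by move=> x; split; exact: cst_continuous. Qed.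

Lemma ccontinuousD f g : ccontinuous f -> ccontinuous g -> ccontinuous (fun x => f x + g x).
Proof.
move=> cf cg x; have [f1 f2] := cf x; have [g1 g2] := cg x; split.
  rewrite (_ : (fun _ => _) = (fun u => complex.Re (f u)) \+ (fun u => complex.Re (g u))); first exact: continuousD.
  by apply/funext => u; rewrite ReD.
rewrite (_ : (fun _ => _) = (fun u => complex.Im (f u)) \+ (fun u => complex.Im (g u))); first exact: continuousD.
by apply/funext => u; rewrite ImD.
Qed.

Lemma ccontinuousM f g : ccontinuous f -> ccontinuous g -> ccontinuous (fun x => f x * g x).
Proof.
move=> cf cg x; have [f1 f2] := cf x; have [g1 g2] := cg x; split.
  rewrite (_ : (fun _ => _) = (fun u => complex.Re (f u) * complex.Re (g u) - complex.Im (f u) * complex.Im (g u))).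
    by apply: continuousB; apply: continuousM.
  by apply/funext => u; rewrite ReM.
rewrite (_ : (fun _ => _) = (fun u => complex.Re (f u) * complex.Im (g u) + complex.Im (f u) * complex.Re (g u))).
  by apply: continuousD; apply: continuousM.
by apply/funext => u; rewrite ImM.
Qed.

Lemma ccontinuous_conj f : ccontinuous f -> ccontinuous (fun x => conjc (f x)).
Proof.
move=> cf x; have [f1 f2] := cf x; split.
  by rewrite (_ : (fun _ => _) = (fun u => complex.Re (f u))) //; apply/funext => u; rewrite Re_conj.
rewrite (_ : (fun _ => _) = (fun u => - complex.Im (f u))); first exact: continuousN.
by apply/funext => u; rewrite Im_conj.
Qed.

Lemma ccontinuous_comp f (h : R -> R) : continuous h -> ccontinuous f ->
  ccontinuous (fun x => f (h x)).
Proof.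
move=> ch cf x; have [f1 f2] := cf (h x).
by split; [apply: (continuous_comp (ch x) f1)|apply: (continuous_comp (ch x) f2)].
Qed.

Lemma ccontinuous_cis : ccontinuous (@cis R).
Proof. by move=> x; split; [exact: continuous_cos|exact: continuous_sin]. Qed.

Lemma ccontinuous_cisZ (a : R) : ccontinuous (fun x => cis (a * x)).
Proof.
apply: ccontinuous_comp ccontinuous_cis => x.
by apply: continuousM; [exact: cst_continuous|exact: cvg_id].
Qed.

Lemma continuous_affine (a b : R) : continuous (fun x => a * x + b).
Proof.
move=> x; apply: continuousD; last exact: cst_continuous.
by apply: continuousM; [exact: cst_continuous|exact: cvg_id].
Qed.

Lemma ccontinuous_sum I (s : seq I) (F : I -> R -> R[i]) :
  (forall i, ccontinuous (F i)) -> ccontinuous (fun x => \sum_(i <- s) F i x).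
Proof.
move=> cF; elim: s => [|i s IH].
  by under eq_fun do rewrite big_nil; exact: ccontinuous_cst.
by under eq_fun do rewrite big_cons; exact: ccontinuousD.
Qed.

Lemma ae_eq_ccontinuous f g : ccontinuous f -> ccontinuous g ->
  {ae @lebesgue_measure R, forall x, f x = g x} -> f =1 g.
Proof.
move=> cf cg fg x; apply/eqP; rewrite -subr_eq0; apply/eqP/Normc.eq0_normc.
apply/eqP; rewrite eq_le normc_ge0 andbT; apply/ler_addgt0Pr => e e0; rewrite add0r.
have e2 : 0 < e / 2 by lra.
have [d1 d10 h1] := (ccontinuous_atP _ _).1 (cf x) _ e2.
have [d2 d20 h2] := (ccontinuous_atP _ _).1 (cg x) _ e2.
have d0 : 0 < Num.min d1 d2 by rewrite lt_min d10.
have [y [fgy xy]] := ae_dense x fg d0.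
have yx : `|y - x| < Num.min d1 d2 by case/andP: xy => ? ?; rewrite ger0_norm; lra.
move: yx; rewrite lt_min => /andP[/h1 {}h1 /h2 {}h2].
rewrite (_ : f x - g x = (g y - g x) - (f y - f x)); last by rewrite fgy; ring.
by have := normcB (g y - g x) (f y - f x); lra.
Qed.

End ccontinuity.

(** * Uniqueness of Fourier coefficients of continuous periodic functions *)

Section fourier_uniqueness.
Context {R : realType}.
Local Notation mu := (@lebesgue_measure R).
Local Notation rintegrable f := (mu.-integrable setT (EFin \o f)).

Definition unit_indic : R -> R := \1_(`[0, 1[%classic).

Lemma unit_indicE x : unit_indic x = if 0 <= x < 1 then 1 else 0.
Proof. by rewrite /unit_indic indicE mem_setE in_itv /=; case: ifP. Qed.

Lemma rintegrable_unit : rintegrable unit_indic.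
Proof. exact: integrable_indic_itv. Qed.

Lemma measurable_unit : measurable_fun setT unit_indic.
Proof. by have /measurable_int/measurable_EFinP := rintegrable_unit. Qed.

Lemma cintegrable_unit (f : R -> R[i]) (M : R) : cmeasurable f ->
  (forall x, normc (f x) <= M) -> cintegrable mu (fun x => (unit_indic x)%:C * f x).
Proof.
move=> mf fM; under eq_fun do rewrite mulrC.
apply: (@cintegrableM_bounded _ _ _ mu f (fun x => (unit_indic x)%:C) M) => //.
by apply: cintegrable_real; exact: rintegrable_unit.
Qed.

(** Fourier coefficient with respect to period 1. It is an integral over the whole line with an
    indicator, so that translations and dilations of the line act on it directly. *)
Definition fcoef (f : R -> R[i]) (l : int) : R[i] :=
  cintegral mu (fun x => (unit_indic x)%:C * (f x * cis (- (2 * pi * l%:~R * x)))).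

Lemma cmeasurable_cisZ (a : R) : cmeasurable (fun x : R => cis (a * x)).
Proof. exact/cmeasurable_continuous/ccontinuous_cisZ. Qed.

Lemma cintegrable_fcoef (f : R -> R[i]) (M : R) l : cmeasurable f ->
  (forall x, normc (f x) <= M) ->
  cintegrable mu (fun x => (unit_indic x)%:C * (f x * cis (- (2 * pi * l%:~R * x)))).
Proof.
move=> mf fM; apply: (@cintegrable_unit _ M).
  apply: cmeasurableM => //; under eq_fun do rewrite -mulNr; exact: cmeasurable_cisZ.
by move=> x; rewrite Normc.normcM normc_cis mulr1.
Qed.

Lemma fcoefD f g M l : cmeasurable f -> cmeasurable g ->
  (forall x, normc (f x) <= M) -> (forall x, normc (g x) <= M) ->
  fcoef (fun x => f x + g x) l = fcoef f l + fcoef g l.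
Proof.
move=> mf mg fM gM; rewrite -cintegralD; try exact: cintegrable_fcoef.
by apply: eq_cintegral => x; ring.
Qed.

Lemma fcoefZ c f M l : cmeasurable f -> (forall x, normc (f x) <= M) ->
  fcoef (fun x => c * f x) l = c * fcoef f l.
Proof.
move=> mf fM; rewrite -cintegralZ; last exact: cintegrable_fcoef fM.
by apply: eq_cintegral => x; ring.
Qed.

Lemma fcoef_cis f (m l : int) :
  fcoef (fun x => cis (2 * pi * m%:~R * x) * f x) l = fcoef f (l - m).
Proof.
apply: eq_cintegral => x; congr (_ * _); rewrite mulrAC -cisD mulrC; congr (_ * cis _).
by rewrite intrD intrN; ring.
Qed.

(* The powers of [peak x0 delta] concentrate on [|x - x0| < delta] modulo 1,
   and multiplication by the trigonometric polynomial [peak] preserves the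
   vanishing of all Fourier coefficients. *)
Let peak (x0 delta x : R) : R := 1 + cos (2 * pi * (x - x0)) - cos (2 * pi * delta).

Let peak_cis x0 delta x : (peak x0 delta x)%:C = (1 - cos (2 * pi * delta))%:C +
  ((cis (- (2 * pi * x0)) / 2) * cis (2 * pi * 1%:~R * x) +
   (cis (2 * pi * x0) / 2) * cis (2 * pi * (-1)%:~R * x)).
Proof.
rewrite !(mulrAC _ 2^-1) -!cisD -mulrDl.
set a := - _ + _; rewrite (_ : 2 * pi * x0 + _ = - a); last by rewrite /a; ring.
have -> : cis a + cis (- a) = (2 * cos a)%:C.
  by apply: complex_ext; rewrite /cis /= ?cosN ?sinN; ring.
rewrite (_ : a = 2 * pi * (x - x0)); last by rewrite /a; ring.
rewrite -[2 : R[i]](rmorph_nat (real_complex R) 2) -fmorphV -rmorphM -rmorphD /=.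
by congr (_%:C); rewrite /peak; field.
Qed.

Let peak_bound x0 delta x : `|peak x0 delta x| <= 3.
Proof.
rewrite ler_norml /peak; have := cos_geN1 (2 * pi * (x - x0)).
have := cos_le1 (2 * pi * (x - x0)); have := cos_geN1 (2 * pi * delta).
have := cos_le1 (2 * pi * delta) => *; apply/andP; split; lra.
Qed.

Let fcoef0_peak f M x0 delta : cmeasurable f -> (forall x, normc (f x) <= M) ->
  (forall l, fcoef f l = 0) -> forall l, fcoef (fun x => (peak x0 delta x)%:C * f x) l = 0.
Proof.
move=> mf fM f0 l.
have cb a b x : normc (a * (cis (b * x) * f x)) <= normc a * M.
  by rewrite !Normc.normcM normc_cis mul1r ler_wpM2l ?normc_ge0.
have cm a (b : R) : cmeasurable (fun x => a * (cis (b * x) * f x)).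
  apply: cmeasurableM; first exact: cmeasurable_cst.
  by apply: cmeasurableM => //; exact: cmeasurable_cisZ.
set a1 := (1 - cos (2 * pi * delta))%:C; set a2 := cis (- (2 * pi * x0)) / 2.
set a3 := cis (2 * pi * x0) / 2.
have -> : (fun x => (peak x0 delta x)%:C * f x) = (fun x =>
    a1 * f x + (a2 * (cis (2 * pi * 1%:~R * x) * f x) +
     a3 * (cis (2 * pi * (-1)%:~R * x) * f x))).
  by apply/funext => x; rewrite peak_cis -/a1 -/a2 -/a3; ring.
pose B := (normc a1 + normc a2 + normc a3) * M.
have M0 : 0 <= M := le_trans (normc_ge0 _) (fM 0).
have aM a : 0 <= normc a * M by rewrite mulr_ge0 ?normc_ge0.
rewrite (@fcoefD _ _ B).
- rewrite (fcoefZ _ _ mf fM) f0 mulr0 add0r.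
  rewrite (@fcoefD _ _ B) //.
  + rewrite (@fcoefZ _ _ M); last 2 first.
    * by apply: cmeasurableM => //; exact: cmeasurable_cisZ.
    * by move=> x; rewrite Normc.normcM normc_cis mul1r.
    rewrite (@fcoefZ _ _ M); last 2 first.
    * by apply: cmeasurableM => //; exact: cmeasurable_cisZ.
    * by move=> x; rewrite Normc.normcM normc_cis mul1r.
    by rewrite !fcoef_cis !f0 !mulr0 addr0.
  + move=> x; have := cb a2 (2 * pi * 1%:~R) x; have := aM a1; have := aM a3; rewrite /B; lra.
  + move=> x; have := cb a3 (2 * pi * (-1)%:~R) x; have := aM a1; have := aM a2; rewrite /B; lra.
- by apply: cmeasurableM => //; exact: cmeasurable_cst.
- exact: cmeasurableD.
- move=> x; rewrite Normc.normcM; have := ler_wpM2l (normc_ge0 a1) (fM x).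
  have := aM a2; have := aM a3; rewrite /B; lra.
- move=> x; rewrite (le_trans (normcD _ _)) //.
  have := cb a2 (2 * pi * 1%:~R) x; have := cb a3 (2 * pi * (-1)%:~R) x.
  have := aM a1; rewrite /B; lra.
Qed.

Let measurable_peak x0 delta : measurable_fun setT (peak x0 delta).
Proof.
apply: measurable_funB; last exact: measurable_cst.
apply: measurable_funD; first exact: measurable_cst.
apply: measurableT_comp; first by apply: continuous_measurable_fun; exact: continuous_cos.
by apply: measurable_funM => //; exact: measurable_funB.
Qed.

Let fcoef0_peakX f M x0 delta n : cmeasurable f -> (forall x, normc (f x) <= M) ->
  (forall l, fcoef f l = 0) -> forall l, fcoef (fun x => (peak x0 delta x ^+ n)%:C * f x) l = 0.
Proof.
move=> mf fM f0; elim: n => [|n IH] l.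
  by under eq_fun do rewrite expr0 mul1r.
under eq_fun do rewrite exprS rmorphM -mulrA.
apply: (@fcoef0_peak _ (3 ^+ n * M)) => //.
  by apply: cmeasurableM => //; apply: cmeasurable_real; exact: measurable_funX.
move=> x; rewrite Normc.normcM normc_real normrX ler_pM ?normc_ge0 ?exprn_ge0 //.
by rewrite lerXn2r ?nnegrE // peak_bound.
Qed.

Let cos2pi_le (delta s : R) : 0 < delta < 1 / 2 -> delta <= s <= 1 - delta ->
  cos (2 * pi * s) <= cos (2 * pi * delta).
Proof.
move=> d0 ds; have pi0 := @pi_gt0 R.
have h t : delta <= t <= 1 / 2 -> cos (2 * pi * t) <= cos (2 * pi * delta).
  move=> dt; rewrite leNgt ltr_cos ?in_itv /= -?leNgt.
  - by nra.
  - by apply/andP; split; nra.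
  - by apply/andP; split; nra.
have [s2|s2] := leP s (1 / 2); first by apply: h; lra.
rewrite -cosN -cosD2pi (_ : _ + _ = 2 * pi * (1 - s)); last by rewrite -mulr_natl; ring.
by apply: h; lra.
Qed.

(** Lebesgue's argument: if [f x0] were nonzero, the integrals of [f] against powers of a
    trigonometric polynomial peaked at [x0] would be unbounded, while they all vanish. *)
Lemma fourier_unique (f : R -> R[i]) (M : R) : ccontinuous f ->
  (forall x, f (x + 1) = f x) -> (forall x, normc (f x) <= M) ->
  (forall l, fcoef f l = 0) -> forall x, f x = 0.
Proof.
move=> cf pf fM f0.
(* Interior points suffice: the value at 0 follows by continuity from the right, all others by
   periodicity. *)
suff h x0 : 0 < x0 < 1 -> f x0 = 0.
  have f00 : f 0 = 0.
    apply: contrapT => f00.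
    have n0 : 0 < normc (f 0).
      by rewrite lt_neqAle normc_ge0 andbT eq_sym; apply/eqP => /Normc.eq0_normc.
    have [delta d0 hd] := (ccontinuous_atP _ _).1 (cf 0) _ n0.
    pose y := Num.min (delta / 2) (1 / 2).
    have y0 : 0 < y by rewrite lt_min; apply/andP; split; lra.
    have yd : y <= delta / 2 by rewrite ge_min lexx.
    have y1 : y <= 1 / 2 by rewrite ge_min lexx orbT.
    have := hd y; rewrite subr0 gtr0_norm // h; last lra.
    by rewrite sub0r normcN ltxx => /(_ ltac:(lra)).
  move=> x.
  have fper (k : nat) t : f (t + k%:R) = f t.
    by elim: k => [|k IH]; rewrite ?addr0 // -natr1 addrA pf IH.
  have fperz (k : int) t : f (t + k%:~R) = f t.
    by case: k => k; [exact: fper|rewrite NegzE -(fper k.+1 (t + _)) mulrNz subrK].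
  rewrite -(subrK (Num.floor x)%:~R x) fperz.
  have /andP[] := floor_itv x; rewrite intrD; set z := x - _ => zx xz.
  have {zx xz}[h0 h1] : 0 <= z /\ z < 1 by rewrite /z; split; lra.
  move: h0; rewrite le_eqVlt => /predU1P[<-//|h0]; apply: h; lra.
move=> x01; apply: contrapT => fx0.
pose c := conjc (f x0); pose g x := c * f x; pose a := normc (f x0) ^+ 2.
have a0 : 0 < a.
  by rewrite exprn_gt0 // lt_neqAle normc_ge0 andbT eq_sym; apply/eqP => /Normc.eq0_normc.
have gx0 : complex.Re (g x0) = a by rewrite /g /c mulrC mul_conjc.
pose M' := normc c * M.
have M0 : 0 <= M := le_trans (normc_ge0 _) (fM 0).
have gM x : normc (g x) <= M' by rewrite Normc.normcM ler_wpM2l ?normc_ge0.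
have mf := cmeasurable_continuous cf.
have cg : ccontinuous g by apply: ccontinuousM => //; exact: ccontinuous_cst.
have mg := cmeasurable_continuous cg.
have g0 l : fcoef g l = 0 by rewrite (fcoefZ _ _ mf fM) f0 mulr0.
have [d0 d00 hd0] : exists2 d : R, 0 < d & forall y, `|y - x0| < d -> a / 2 <= complex.Re (g y).
  have a2 : 0 < a / 2 by lra.
  have [d d0 hd] := (ccontinuous_atP _ _).1 (cg x0) _ a2.
  exists d => // y /hd; have := le_Re_normc (g y - g x0); rewrite ReD ReN gx0.
  by rewrite ler_norml => /andP[h1 h2] h3; lra.
(* The constraints keep [Re g] above [a / 2] on the window, keep the window inside the unit interval
   on both sides, and make [d] small enough for the monotonicity of the cosine. *)
pose d := Num.min (d0 / 2) (Num.min (x0 / 2) (Num.min ((1 - x0) / 2) (1 / 4))).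
have dp : 0 < d by rewrite !lt_min; do 3 (apply/andP; split; first lra); lra.
have dd0 : d <= d0 / 2 by rewrite ge_min lexx.
have dx0 : d <= x0 / 2 by rewrite ge_min; apply/orP; right; rewrite ge_min lexx.
have d1x0 : d <= (1 - x0) / 2.
  by rewrite ge_min; apply/orP; right; rewrite ge_min; apply/orP; right; rewrite ge_min lexx.
have d4 : d <= 1 / 4.
  by rewrite ge_min; apply/orP; right; rewrite ge_min; apply/orP; right; rewrite ge_min lexx orbT.
clearbody d.
have pi0 := @pi_gt0 R.
pose eta := cos (2 * pi * (d / 2)) - cos (2 * pi * d).
have eta0 : 0 < eta.
  rewrite subr_gt0 ltr_cos ?in_itv /=; first nra.
  - by apply/andP; split; nra.
  - by apply/andP; split; nra.
have cosd (x y : R) : `|x| <= y -> y <= 1 / 2 -> cos (2 * pi * y) <= cos (2 * pi * x).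
  move=> xy y2; have x00 := normr_ge0 x.
  rewrite -(cos_norm (2 * pi * x)) normrM (ger0_norm (x := 2 * pi)); last nra.
  rewrite leNgt ltr_cos ?in_itv /= -?leNgt.
  - by nra.
  - by apply/andP; split; nra.
  - by apply/andP; split; nra.
pose J : R -> R := \1_(`[x0 - d / 2, x0 + d / 2]%classic).
have iJ : rintegrable J by exact: integrable_indic_itv.
have intJ : Rintegral mu setT J = d.
  rewrite /Rintegral integral_indic //= setIT lebesgue_measure_itv /= lte_fin.
  by rewrite ifT; [rewrite -EFinD /=; field|lra].
have intU : Rintegral mu setT unit_indic = 1.
  rewrite /Rintegral integral_indic //= setIT lebesgue_measure_itv /= lte_fin.
  by rewrite ltr01 -EFinD /= subr0.
(* The integral of [peak ^+ n * Re g] over a period is 0. Within [d / 2] of [x0] the integrand is at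
   least [(a / 2) * (1 + n * eta)], by Bernoulli's inequality; up to distance [d] it is nonnegative;
   beyond, [|peak| <= 1] and it is at least [- M']. *)
have key n : (a / 2) * (1 + n%:R * eta) * d <= M'.
  pose h x := unit_indic x * (peak x0 d x ^+ n * complex.Re (g x)).
  have gh x : `|complex.Re (g x)| <= M' := le_trans (le_Re_normc _) (gM x).
  have mgn : cmeasurable (fun x => (peak x0 d x ^+ n)%:C * g x).
    by apply: cmeasurableM => //; apply: cmeasurable_real; exact: measurable_funX.
  have bgn x : normc ((peak x0 d x ^+ n)%:C * g x) <= 3 ^+ n * M'.
    rewrite Normc.normcM normc_real normrX ler_pM ?normc_ge0 ?exprn_ge0 //.
    by rewrite lerXn2r ?nnegrE // peak_bound.
  have := congr1 (@complex.Re R) (fcoef0_peakX x0 d n mg gM g0 0).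
  have [ih _] := cintegrable_fcoef 0 mgn bgn.
  have hE : (fun x => complex.Re ((unit_indic x)%:C * ((peak x0 d x ^+ n)%:C * g x * cis (- (2 * pi * 0%:~R * x))))) = h.
    by apply/funext => x; rewrite mulr0z mulr0 mul0r oppr0 cis0 mulr1 /h; case: (g x) => u v /=; ring.
  have {}ih : rintegrable h by rewrite -hE.
  rewrite /fcoef /cintegral /= hE => h0.
  have : Rintegral mu setT (fun x => (a / 2 * (1 + n%:R * eta)) * J x - M' * unit_indic x) <= Rintegral mu setT h.
    apply: le_Rintegral => //.
      apply: rintegrableB => //; first exact: rintegrableZ.
      by apply: rintegrableZ; exact: rintegrable_unit.
    move=> x _; rewrite /h /J indicE mem_setE in_itv /= unit_indicE.
    have M'0 : 0 <= M' := le_trans (normc_ge0 _) (gM 0).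
    have [xJ|xJ] := boolP (x0 - d / 2 <= x <= x0 + d / 2).
      have xd : `|x - x0| <= d / 2 by rewrite ler_norml; lra.
      rewrite ifT; last lra; rewrite mulr1 mul1r mulr1.
      have gx := hd0 x ltac:(lra).
      have px : 1 + eta <= peak x0 d x by have := cosd _ _ xd ltac:(lra); rewrite /peak /eta; lra.
      have pn : 1 + n%:R * eta <= peak x0 d x ^+ n.
        have e1 : 0 <= 1 + eta by lra.
        apply: (@le_trans _ _ ((1 + eta) ^+ n)); last by rewrite lerXn2r ?nnegrE //; lra.
        elim: n {h mgn bgn ih hE h0} => [|n IH]; first by rewrite mul0r addr0 expr0.
        rewrite exprS (le_trans _ (ler_wpM2l e1 IH)) // -natr1.
        by have : 0 <= n%:R * eta * eta; [rewrite !mulr_ge0 // ltW | nra].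
      have n0 : 0 <= 1 + n%:R * eta by rewrite addr_ge0 // mulr_ge0 // ltW.
      have a2 : 0 <= a / 2 by lra.
      have := ler_pM n0 a2 pn gx; lra.
    rewrite mulr0 sub0r; case: ifPn => x1; last by rewrite mulr0 oppr0 mul0r.
    rewrite mulr1 mul1r; have := gh x; rewrite ler_norml => /andP[g1 g2].
    have [xd|xd] := leP `|x - x0| d.
      have gx := hd0 x ltac:(lra).
      have px : 0 <= peak x0 d x by have := cosd _ _ xd ltac:(lra); rewrite /peak; lra.
      by have : 0 <= peak x0 d x ^+ n * complex.Re (g x); [rewrite mulr_ge0 ?exprn_ge0 //; lra|lra].
    have px : `|peak x0 d x| <= 1.
      have := cos_geN1 (2 * pi * (x - x0)); have := cos_le1 (2 * pi * d).
      have : cos (2 * pi * (x - x0)) <= cos (2 * pi * d).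
        rewrite -(cos_norm (2 * pi * (x - x0))) normrM (ger0_norm (x := 2 * pi)); last nra.
        apply: cos2pi_le; first lra.
        apply/andP; split; first exact: ltW.
        by rewrite ler_norml; lra.
      by rewrite ler_norml /peak; lra.
    have pnx : `|peak x0 d x ^+ n * complex.Re (g x)| <= M'.
      rewrite normrM normrX -[leRHS]mul1r ler_pM //.
      by rewrite exprn_ile1.
    by move: pnx; rewrite ler_norml => /andP[].
  rewrite h0 RintegralB //; last 2 first.
  - exact: rintegrableZ.
  - by apply: rintegrableZ; exact: rintegrable_unit.
  rewrite !RintegralZl //; last exact: rintegrable_unit.
  by rewrite intJ intU mulr1 subr_le0.
have a2 : 0 < a / 2 by lra.
have ad : 0 < a / 2 * eta * d by rewrite mulr_gt0 // mulr_gt0.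
have M'0 : 0 <= M' := le_trans (normc_ge0 _) (gM 0).
have := archi_boundP (divr_ge0 M'0 (ltW ad)).
rewrite ltr_pdivrMr //; set n := Num.Def.archi_bound _ => nM.
have := key n; have : 0 < a / 2 * d by rewrite mulr_gt0.
nra.
Qed.

End fourier_uniqueness.

(** * Limits and symmetric partial sums *)

Section clim.
Context {R : realType}.

Definition clim (u : nat -> R[i]) : R[i] :=
  limn (fun n => complex.Re (u n)) +i* limn (fun n => complex.Im (u n)).

Lemma real_cauchy (u : nat -> R) :
  (forall e : R, 0 < e -> exists N, forall n, (N <= n)%N -> `|u n - u N| < e) -> cvgn u.
Proof.
move=> uv; apply: cauchy_cvg; apply: cauchy_exP => e /uv[N hN].
by exists (u N); exists N => // n /= Nn; rewrite /ball /= distrC hN.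
Qed.

Lemma ccvg_clim (u : nat -> R[i]) :
  (forall e : R, 0 < e -> exists N, forall n, (N <= n)%N -> normc (u n - u N) < e) ->
  ccvg u (clim u).
Proof.
move=> uv; apply: ccvg_ReIm; apply: real_cauchy => e /uv[N hN]; exists N => n /hN;
  apply: le_lt_trans.
  by rewrite -ReN -ReD le_Re_normc.
by rewrite -ImN -ImD le_Im_normc.
Qed.

Lemma ccvg_le_dist (u : nat -> R[i]) l z (b : R) N : ccvg u l ->
  (forall n, (N <= n)%N -> normc (u n - z) <= b) -> normc (l - z) <= b.
Proof.
move=> /ccvgP ul ub; apply/ler_addgt0Pr => e /ul[N' hN'].
have := hN' _ (leq_maxr N N'); have := ub _ (leq_maxl N N').
move: (u _) => w h1; rewrite normc_distC => h2.
rewrite (_ : l - z = (w - z) + (l - w)); last ring.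
by rewrite (le_trans (normcD _ _)) //; lra.
Qed.

Lemma sym_sumS K (F : int -> R[i]) :
  sym_sum K.+1 F = sym_sum K F + (F (K.+1%:Z) + F (- K.+1%:Z)).
Proof.
rewrite /sym_sum doubleS big_ord_recr big_ord_recl /=.
rewrite [X in _ + X + _](_ : _ = \sum_(i < K.*2.+1) F (i%:Z - K%:Z)); last first.
  by apply: eq_bigr => i _; congr F; rewrite /bump /=; lia.
rewrite (_ : 0%Z - K.+1%:Z = - K.+1%:Z); last lia.
rewrite (_ : (K.*2.+2)%:Z - K.+1%:Z = K.+1%:Z); last lia.
ring.
Qed.

Lemma sym_sum0 (F : int -> R[i]) : sym_sum 0 F = F 0.
Proof. by rewrite /sym_sum big_ord_recl big_ord0 addr0. Qed.

Lemma eq_sym_sum K (F G : int -> R[i]) : F =1 G -> sym_sum K F = sym_sum K G.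
Proof. by move=> FG; apply: eq_bigr => i _; rewrite FG. Qed.

Lemma sym_sum_pair K (F : int -> R[i]) :
  sym_sum K F = F 0 + \sum_(1 <= i < K.+1) (F i%:Z + F (- i%:Z)).
Proof.
elim: K => [|K IH]; first by rewrite sym_sum0 big_geq // addr0.
by rewrite sym_sumS IH [in RHS]big_nat_recr //= -addrA.
Qed.

Lemma sym_sum_diff K K' (F : int -> R[i]) : (K <= K')%N ->
  sym_sum K' F - sym_sum K F = \sum_(K.+1 <= i < K'.+1) (F i%:Z + F (- i%:Z)).
Proof.
by move=> KK; rewrite !sym_sum_pair (big_cat_nat (n := K.+1)) //=; ring.
Qed.

Lemma sym_sumM c K (F : int -> R[i]) : c * sym_sum K F = sym_sum K (fun l => c * F l).
Proof. by rewrite /sym_sum mulr_sumr. Qed.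

Lemma sym_sum_indic K (l0 : int) (c : R[i]) :
  sym_sum K (fun l => if l == l0 then c else 0) = if (`|l0|%N <= K)%N then c else 0.
Proof.
elim: K => [|K IH].
  by rewrite sym_sum0 leqn0 absz_eq0 eq_sym.
rewrite sym_sumS IH.
have [h1|h1] := leqP `|l0|%N K.
  rewrite ifF; last by apply/negbTE; lia.
  by rewrite ifF ?addr0 ?ifT //; [lia|apply/negbTE; lia].
have [h2|h2] := leqP `|l0|%N K.+1; last first.
  rewrite ifF; last by apply/negbTE; lia.
  by rewrite ifF ?addr0 //; apply/negbTE; lia.
have [->|->] : l0 = K.+1%:Z \/ l0 = - K.+1%:Z by lia.
  have e : (- K.+1%:Z == K.+1%:Z) = false by lia.
  by rewrite eqxx e addr0 add0r.
have e : (K.+1%:Z == - K.+1%:Z) = false by lia.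
by rewrite eqxx e !add0r.
Qed.

End clim.

(** * Periodization *)

Section envelope.
Context {R : realType}.
Local Notation mu := (@lebesgue_measure R).
Local Notation rintegrable f := (mu.-integrable setT (EFin \o f)).

(* [s i] bounds [|g|] off [(-i, i)], and [tau N] bounds the tails of the
   series of the [s i]. *)
Definition envelope (g : R -> R[i]) (s tau : nat -> R) : Prop :=
  [/\ forall i, 0 <= s i, forall i j, (i <= j)%N -> s j <= s i,
      tau n @[n --> \oo] --> (0 : R),
      forall N M, \sum_(N <= i < M) s i <= tau N &
      forall x (i : nat), i%:R <= `|x| -> normc (g x) <= s i].

(** The bound of Assumption S holds only a.e. Continuity of [g] transfers it to [x] from nearby
    points [y]; since [Phi] may jump, this costs a shift of its argument, for which 1 is ample. *)
Lemma assumption_S_pointwise (g : R -> R[i]) (Phi : R -> R) : ccontinuous g ->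
  (forall x y, 0 <= x -> x <= y -> Phi y <= Phi x) ->
  {ae mu, forall x, normc (g x) <= Phi `|x|} ->
  (forall x, 0 <= x -> 0 <= Phi x) /\
  (forall x r, 0 <= r -> r <= `|x| - 1 -> normc (g x) <= Phi r) /\
  (forall x, normc (g x) <= Phi 0).
Proof.
move=> cg dPhi ae; have Phi0 x : 0 <= x -> 0 <= Phi x.
  move=> x0; have [y [hy xy]] := ae_dense x ae ltr01.
  apply: le_trans (normc_ge0 (g y)) (le_trans hy _); apply: dPhi => //.
  by rewrite ger0_norm; lra.
split=> //.
have near x e : 0 < e -> exists y, [/\ normc (g x) <= Phi `|y| + e & x < y < x + 1].
  move=> e0; have [d d0 hd] := (ccontinuous_atP _ _).1 (cg x) _ e0.
  have m0 : 0 < Num.min d 1 by rewrite lt_min d0 ltr01.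
  have [y [hy xy]] := ae_dense x ae m0.
  have md : Num.min d 1 <= d by rewrite ge_min lexx.
  have m1 : Num.min d 1 <= 1 :> R by rewrite ge_min lexx orbT.
  exists y; split; last lra.
  have := hd y; rewrite ger0_norm; last lra.
  move=> /(_ ltac:(lra)); rewrite normc_distC => h.
  by have := normcD (g x - g y) (g y); rewrite subrK; lra.
split=> [x r r0 rx|x]; apply/ler_addgt0Pr => e /(near x)[y [h1 h2]];
  apply: (le_trans h1); rewrite lerD2r.
  apply: dPhi => //; have := ler_norm (- x); have := ler_norm x.
  have := ler_norm (- y); have := ler_norm y; rewrite !normrN.
  have [x0|x0] := leP 0 x.
    by rewrite (ger0_norm x0) in rx *; lra.
  by rewrite (ltr0_norm x0) in rx *; lra.
by apply: dPhi.
Qed.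

Lemma assumption_S_envelope (g : R -> R[i]) : ccontinuous g -> assumption_S g ->
  exists s tau, envelope g s tau.
Proof.
move=> cg [Phi [dPhi aePhi iPhi]].
have [Phi0 [gPhi gPhi0]] := assumption_S_pointwise cg dPhi aePhi.
(* The predecessor pays for the shift by 1 in the pointwise bound; at [i = 0] it gives [Phi 0],
   which bounds [g] everywhere. *)
pose s i := Phi (i.-1)%:R.
have s0 i : 0 <= s i by exact: Phi0.
have ds i j : (i <= j)%N -> s j <= s i.
  by move=> ij; apply: dPhi => //; rewrite ler_nat; lia.
(* Integral comparison: [Phi] at the right end of each unit interval lies below [Phi] on that
   interval. *)
have sumPhi N : \sum_(i < N) Phi (i.+1)%:R <= Rintegral mu setT (fun x => Phi `|x|).
  pose J (i : nat) : R -> R := \1_(`[i%:R, i.+1%:R[%classic).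
  have iJ i : rintegrable (J i) by exact: integrable_indic_itv.
  have intJ i : Rintegral mu setT (J i) = 1.
    rewrite /Rintegral integral_indic //= setIT lebesgue_measure_itv /= lte_fin.
    by rewrite ltr_nat ltnSn -EFinD /= -natr1; ring.
  have -> : \sum_(i < N) Phi (i.+1)%:R = Rintegral mu setT (fun x => \sum_(i < N) Phi (i.+1)%:R * J i x).
    rewrite Rintegral_sum; last by move=> i; exact: rintegrableZ.
    by apply: eq_bigr => i _; rewrite RintegralZl // intJ mulr1.
  apply: le_Rintegral => //.
    have -> : (EFin \o (fun x => \sum_(i < N) Phi (i.+1)%:R * J i x)) =
        (fun x => \sum_(i < N) (Phi (i.+1)%:R * J i x)%:E)%E.
      by apply/funext => x /=; rewrite sumEFin.
    by apply: integrable_sum => // i _; exact: rintegrableZ.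
  move=> x _.
  have JE (i : nat) : J i x = if i%:R <= x < i.+1%:R then 1 else 0.
    by rewrite /J indicE mem_setE in_itv /=; case: ifP.
  have [/existsP[i hi]|/existsPn h] := boolP [exists i : 'I_N, (i%:R <= x) && (x < i.+1%:R)].
    rewrite (bigD1 i) //= big1 ?addr0; last first.
      move=> k ki; rewrite JE; case: ifPn; rewrite ?mulr0 // => /andP[k1 k2].
      case/andP: hi => i1 i2.
      have : (k < i.+1)%N by rewrite -(ltr_nat R) (le_lt_trans k1).
      have : (i < k.+1)%N by rewrite -(ltr_nat R) (le_lt_trans i1).
      by move/eqP: ki => ki h1 h2; case: ki; apply: val_inj => /=; lia.
    rewrite JE hi mulr1; case/andP: hi => i1 i2; apply: dPhi => //.
    have x0 : 0 <= x by rewrite (le_trans _ i1).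
    by rewrite ger0_norm // ltW.
  rewrite big1 ?Phi0 // => i _; rewrite JE ifF ?mulr0 //.
  exact/negbTE/h.
pose S N := \sum_(0 <= i < N) s i.
have Sd : {homo S : n m / (n <= m)%N >-> n <= m}.
  move=> n m nm; rewrite /S (big_cat_nat (n := n) (p := m)) //= lerDl.
  by apply: sumr_ge0.
have Sb : has_ubound (range S).
  exists (2 * Phi 0 + Rintegral mu setT (fun x => Phi `|x|)) => _ [N _ <-].
  apply: (@le_trans _ _ (S N.+2)); first by apply: Sd; lia.
  rewrite /S big_nat_recl // big_nat_recl //= big_mkord /s /=.
  by have := sumPhi N; lra.
have cS := nondecreasing_is_cvgn Sd Sb.
exists s, (fun N => limn S - S N); split => //.
- rewrite -(subrr (limn S)); apply: cvgB => //; exact: cvg_cst.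
- move=> N M; have [NM|MN] := leqP N M.
    rewrite lerBrDr addrC -big_cat_nat //; exact: (nondecreasing_cvgn_le Sd cS M).
  rewrite big_geq; last exact: ltnW.
  by rewrite subr_ge0; exact: (nondecreasing_cvgn_le Sd cS N).
- move=> x [|i] xi; first exact: gPhi0.
  by apply: gPhi => //=; move: xi; rewrite -natr1; lra.
Qed.

(** The majorant at [x] covers all points within distance 1 of [x]. It therefore dominates step
    functions built from values of [g] at nearby nodes, which is what Riemann sums need. *)
Lemma assumption_S_local_bound (g : R -> R[i]) : ccontinuous g -> assumption_S g ->
  exists2 H : R -> R, rintegrable H &
    forall x y, `|x - y| <= 1 -> normc (g y) <= H x.
Proof.
move=> cg [Phi [dPhi aePhi iPhi]].
have [Phi0 [gPhi gPhi0]] := assumption_S_pointwise cg dPhi aePhi.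
(* For [|x| > 2] the argument [|x| - 2] is [|x - 2|] or [|x + 2|], so two translates of [Phi]
   suffice; on the remaining window the bound [Phi 0] is used. *)
pose J : R -> R := \1_(`[-2, 2]%classic).
exists (fun x => (Phi `|x - 2| + Phi `|x + 2|) + Phi 0 * J x).
  apply: rintegrableD; last by apply: rintegrableZ; exact: integrable_indic_itv.
  apply: rintegrableD; last exact: (rintegrable_shift 2 iPhi).
  exact: (rintegrable_shift (- 2) iPhi).
move=> x y; rewrite ler_norml => /andP[xy1 xy2].
have P1 := Phi0 _ (normr_ge0 (x - 2)); have P2 := Phi0 _ (normr_ge0 (x + 2)).
have P3 := Phi0 _ (lexx 0).
rewrite /J indicE mem_setE in_itv /=; have [x2|x2] := leP `|x| 2.
  move: x2; rewrite ler_norml => ->; rewrite mulr1.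
  by have := gPhi0 y; lra.
have J0 : (- 2 <= x <= 2) = false by rewrite -ler_norml; apply/negbTE; rewrite -ltNge.
rewrite J0 mulr0 addr0.
have [x0|x0] := leP 0 x.
  have : normc (g y) <= Phi `|x - 2|.
    rewrite ger0_norm in x2 => //; rewrite (ger0_norm (x := x - 2)); last lra.
    by apply: gPhi; [lra|rewrite ger0_norm; lra].
  lra.
have : normc (g y) <= Phi `|x + 2|.
  rewrite ltr0_norm in x2 => //; rewrite (ler0_norm (x := x + 2)); last lra.
  by apply: gPhi; [lra|rewrite ler0_norm; lra].
lra.
Qed.

Lemma assumption_S_cintegrable (g : R -> R[i]) : ccontinuous g -> assumption_S g ->
  cintegrable mu g.
Proof.
move=> cg /(assumption_S_local_bound cg)[H iH gH].
apply: (@le_cintegrable _ _ _ mu _ H) => //; first exact: cmeasurable_continuous.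
by apply: aeW => x; apply: gH; rewrite subrr normr0.
Qed.

End envelope.

Section periodization.
Context {R : realType}.
Local Notation mu := (@lebesgue_measure R).
Local Notation rintegrable f := (mu.-integrable setT (EFin \o f)).

Definition periodize (f : R -> R[i]) (x : R) : R[i] :=
  clim (fun K => sym_sum K (fun l => f (x - l%:~R))).

Variables (f : R -> R[i]) (s tau : nat -> R).
Hypotheses (cf : ccontinuous f) (ef : envelope f s tau).

Let s0 i : 0 <= s i. Proof. by have [] := ef. Qed.
Let sD i j : (i <= j)%N -> s j <= s i. Proof. by have [_ + _ _ _] := ef; exact. Qed.
Let tau0 : tau n @[n --> \oo] --> (0 : R). Proof. by have [] := ef. Qed.
Let stau N M : \sum_(N <= i < M) s i <= tau N. Proof. by have [_ _ _ + _] := ef; exact. Qed.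
Let fs x (i : nat) : i%:R <= `|x| -> normc (f x) <= s i. Proof. by have [_ _ _ _] := ef; exact. Qed.

(** Truncated subtraction covers the case [|l| <= B], where only the trivial bound [s 0] is
    available. *)
Lemma envelope_shift (B : nat) x (l : int) : `|x| <= B%:R ->
  normc (f (x - l%:~R)) <= s (`|l|%N - B).
Proof.
move=> xB; have [lB|Bl] := leqP `|l|%N B.
  rewrite (eqP lB); apply: fs; exact: normr_ge0.
apply: fs; rewrite natrB; last exact: ltnW.
rewrite natr_absz intr_norm; have := ler_normB l%:~R x.
have := lerB_dist l%:~R x.
by rewrite (distrC l%:~R x); lra.
Qed.

Lemma sym_sum_tail (B : nat) x K K' : `|x| <= B%:R -> (B <= K)%N -> (K <= K')%N ->
  normc (sym_sum K' (fun l => f (x - l%:~R)) - sym_sum K (fun l => f (x - l%:~R)))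
  <= 2 * tau (K.+1 - B).
Proof.
move=> xB BK KK; rewrite sym_sum_diff //.
apply: (@le_trans _ _ (\sum_(K.+1 <= i < K'.+1) 2 * s (i - B))).
  rewrite (le_trans (normc_sum _ _ _)) //; apply: ler_sum_nat => i _.
  rewrite (le_trans (normcD _ _)) //.
  have := envelope_shift i%:Z xB; have := envelope_shift (- i%:Z) xB.
  by rewrite abszN absz_nat; lra.
rewrite -mulr_sumr ler_wpM2l // (le_trans _ (stau _ (K'.+1 - B))) //.
rewrite le_eqVlt; apply/orP; left; apply/eqP.
transitivity (\sum_(K.+1 - B + B <= i < K'.+1) s (i - B)); first by rewrite subnK //; lia.
by rewrite big_addn; apply: eq_bigr => i _; rewrite addnK.
Qed.

Lemma normr_le_nat (x : R) : exists B : nat, `|x| <= B%:R.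
Proof. by exists (Num.truncn `|x|).+1; apply: ltW; exact: truncnS_gt. Qed.

Lemma tau_small (e : R) : 0 < e -> exists N, forall n, (N <= n)%N -> tau n < e.
Proof.
move=> e0; move/cvgrPdist_lt: tau0 => /(_ e e0)[N _ hN].
exists N => n /hN /=; rewrite sub0r normrN; apply: le_lt_trans; exact: ler_norm.
Qed.

Lemma periodize_cvg x : ccvg (fun K => sym_sum K (fun l => f (x - l%:~R))) (periodize f x).
Proof.
have [B xB] := normr_le_nat x.
apply: ccvg_clim => e e0; have [N hN] := tau_small (ltac:(lra) : 0 < e / 2).
exists (N + B)%N => n Nn; apply: (le_lt_trans (sym_sum_tail xB _ Nn)); first lia.
by have := hN ((N + B).+1 - B)%N ltac:(lia); lra.
Qed.

Lemma periodize_tail (B : nat) x K : `|x| <= B%:R -> (B <= K)%N ->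
  normc (periodize f x - sym_sum K (fun l => f (x - l%:~R))) <= 2 * tau (K.+1 - B).
Proof.
move=> xB BK; apply: (ccvg_le_dist (N := K) (periodize_cvg x)) => n Kn.
exact: sym_sum_tail.
Qed.

Lemma sym_sum_bound (B : nat) x K : `|x| <= B%:R ->
  normc (sym_sum K (fun l => f (x - l%:~R))) <= (2 * B%:R + 1) * s 0 + 2 * tau 0.
Proof.
move=> xB; rewrite sym_sum_pair (le_trans (normcD _ _)) //.
have h0 : normc (f (x - 0%:~R)) <= s 0%N.
  by apply: le_trans (envelope_shift 0 xB) _; exact: sD.
have hi i : normc (f (x - (i%:Z)%:~R) + f (x - (- i%:Z)%:~R)) <= 2 * s (i - B)%N.
  rewrite (le_trans (normcD _ _)) //.
  have := envelope_shift i%:Z xB; have := envelope_shift (- i%:Z) xB.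
  by rewrite abszN absz_nat; lra.
suff hs : \sum_(1 <= i < K.+1) s (i - B)%N <= B%:R * s 0%N + tau 0%N.
  have : normc (\sum_(1 <= i < K.+1) (f (x - (i%:Z)%:~R) + f (x - (- i%:Z)%:~R))) <=
      2 * \sum_(1 <= i < K.+1) s (i - B)%N.
    by rewrite mulr_sumr (le_trans (normc_sum _ _ _)) //; apply: ler_sum_nat.
  lra.
apply: (@le_trans _ _ (\sum_(0 <= i < K.+1 + B) s (i - B)%N)).
  rewrite [leRHS](big_cat_nat (n := 1)) //= [X in _ + X](big_cat_nat (n := K.+1)) //=; last lia.
  have p1 : 0 <= \sum_(0 <= i < 1) s (i - B)%N by exact: sumr_ge0.
  have p2 : 0 <= \sum_(K.+1 <= i < K.+1 + B) s (i - B)%N by exact: sumr_ge0.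
  lra.
rewrite (big_cat_nat (n := B)) //=; last lia.
rewrite lerD //.
  rewrite (eq_big_nat _ _ (F2 := fun=> s 0%N)).
    by rewrite big_const_nat iter_addr addr0 subn0 mulr_natl.
  by move=> i iB; rewrite (_ : i - B = 0)%N //; lia.
rewrite -{1}(add0n B) big_addn addnK.
rewrite (le_trans _ (stau 0 K.+1)) //.
by rewrite (eq_bigr s) // => i _; rewrite addnK.
Qed.

Lemma periodize_periodic x : periodize f (x + 1) = periodize f x.
Proof.
apply: (ccvg_unique (periodize_cvg (x + 1))).
have [B xB] := normr_le_nat x.
(* Moving the argument by 1 shifts the summation window by one place: one boundary term enters, one
   leaves, and both tend to 0. *)
have step K : sym_sum K (fun l => f (x + 1 - l%:~R)) = sym_sum K (fun l => f (x - l%:~R))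
    + (f (x + 1 + K%:R) - f (x - K%:R)).
  elim: K => [|K IH]; first by rewrite !sym_sum0 !subr0 addr0; ring.
  rewrite !sym_sumS IH /= !rmorphN /= !opprK.
  rewrite (_ : x + 1 - K.+1%:~R = x - K%:R); last by rewrite -pmulrn -natr1; ring.
  rewrite (_ : x + K.+1%:~R = x + 1 + K%:R); last by rewrite -pmulrn -natr1; ring.
  by rewrite -!pmulrn; ring.
apply/(eq_ccvg (fun K => esym (step K))); rewrite -[X in ccvg _ X]addr0.
apply: ccvgD (periodize_cvg x) _; apply/ccvgP => e e0.
have [N hN] := tau_small (ltac:(lra) : 0 < e / 2).
exists (N + B + 1)%N => K NK; rewrite subr0 (le_lt_trans (normcB _ _)) //.
have st i : s i <= tau i by have := stau i i.+1; rewrite big_nat1.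
have NK' : (N + B + 1)%:R <= K%:R :> R by rewrite ler_nat.
rewrite !natrD in NK'.
have K1 : (K - B - 1)%N%:R = K%:R - B%:R - 1 :> R by rewrite -subnDA natrB ?natrD; [ring|lia].
have h1 : normc (f (x + 1 + K%:R)) <= s (K - B - 1)%N.
  apply: fs; rewrite K1; have := ler_norm (x + 1 + K%:R).
  by move: xB; rewrite ler_norml => /andP[]; lra.
have h2 : normc (f (x - K%:R)) <= s (K - B - 1)%N.
  apply: fs; rewrite K1 -normrN; have := ler_norm (- (x - K%:R)).
  by move: xB; rewrite ler_norml => /andP[]; lra.
by have := st (K - B - 1)%N; have := hN (K - B - 1)%N ltac:(lia); lra.
Qed.

Lemma periodize_periodicz x (l : int) : periodize f (x + l%:~R) = periodize f x.
Proof.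
have per (k : nat) t : periodize f (t + k%:R) = periodize f t.
  by elim: k => [|k IH]; rewrite ?addr0 // -natr1 addrA periodize_periodic IH.
by case: l => l; [exact: per|rewrite NegzE -(per l.+1 (x + _)) mulrNz subrK].
Qed.

Lemma periodize_bound x : normc (periodize f x) <= 3 * s 0 + 2 * tau 0.
Proof.
have /andP[x1 x2] := floor_itv x; rewrite intrD in x2.
have -> : periodize f x = periodize f (x - (Num.floor x)%:~R).
  by rewrite -{1}(subrK (Num.floor x)%:~R x) periodize_periodicz.
set z := x - _; have z1 : `|z| <= 1%:R by rewrite ler_norml /z; lra.
rewrite -[X in normc X]subr0; apply: (ccvg_le_dist (N := 0) (periodize_cvg z)) => K _.
by rewrite subr0; have := sym_sum_bound K z1; rewrite mulr1; lra.
Qed.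

Lemma periodize_continuous : ccontinuous (periodize f).
Proof.
move=> x; apply/ccontinuous_atP => e e0.
have [B xB] := normr_le_nat x.
have [N hN] := tau_small (ltac:(lra) : 0 < e / 8).
pose K := (N + B.+1)%N.
have xB1 : `|x| <= B.+1%:R by rewrite -natr1; lra.
have cS : ccontinuous (fun x => sym_sum K (fun l => f (x - l%:~R))).
  by apply: ccontinuous_sum => i; apply: ccontinuous_comp cf => y; apply: continuousB => //; exact: cst_continuous.
have [d d0 hd] := (ccontinuous_atP _ _).1 (cS x) _ (ltac:(lra) : 0 < e / 4).
exists (Num.min d 1); first by rewrite lt_min d0 ltr01.
move=> y; rewrite lt_min => /andP[yd y1].
have yB1 : `|y| <= B.+1%:R.
  by have := ler_normD (y - x) x; rewrite subrK -natr1; lra.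
have BK : (B.+1 <= K)%N by rewrite /K; lia.
have h1 := periodize_tail xB1 BK; have h2 := periodize_tail yB1 BK.
have h3 := hd y yd; have h4 := hN (K.+1 - B.+1)%N ltac:(rewrite /K; lia).
move: h1 h2 h3; set A := sym_sum _ _; set A' := sym_sum _ _ => h1 h2 h3.
rewrite (_ : _ - _ = (periodize f y - A') + (A' - A) - (periodize f x - A)); last ring.
rewrite (le_lt_trans (normcB _ _)) //.
by have := normcD (periodize f y - A') (A' - A); lra.
Qed.

(** Exactly one integer translate of [x] lies in the unit interval, the one by [- Num.floor x]. *)
Lemma unit_indic_sum (x : R) : ccvg (fun K => sym_sum K (fun l => (unit_indic (x + l%:~R))%:C)) 1
  /\ forall K, normc (sym_sum K (fun l => (unit_indic (x + l%:~R))%:C)) <= 1.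
Proof.
have /andP[x1 x2] := floor_itv x; rewrite intrD in x2.
have UE l : (unit_indic (x + l%:~R))%:C = if l == - Num.floor x then 1 else 0 :> R[i].
  rewrite unit_indicE; case: eqVneq => [->|nl]; first by rewrite rmorphN /= ifT //; lra.
  rewrite ifF //; apply/negP => /andP[h1 h2].
  have a1 : - Num.floor x < l + 1 by rewrite -(ltr_int R) rmorphN rmorphD /=; lra.
  have a2 : l < - Num.floor x + 1 by rewrite -(ltr_int R) rmorphD rmorphN /=; lra.
  by move/eqP: nl; lia.
have SE K : sym_sum K (fun l => (unit_indic (x + l%:~R))%:C) =
    if (`|- Num.floor x|%N <= K)%N then 1 else 0.
  by rewrite (eq_sym_sum _ UE) sym_sum_indic.
split; last first.
  by move=> K; rewrite SE; case: ifP => _; rewrite ?Normc.normc1 ?Normc.normc0.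
apply/ccvgP => e e0; exists `|- Num.floor x|%N => n Kn.
by rewrite SE Kn subrr Normc.normc0.
Qed.

Lemma fcoef_periodize (l : int) : cintegrable mu f ->
  fcoef (periodize f) l = cintegral mu (fun x => f x * cis (- (2 * pi * l%:~R * x))).
Proof.
move=> fi; have mf := cmeasurable_continuous cf.
pose w x := cis (- (2 * pi * l%:~R * x)) : R[i].
have mw : cmeasurable w by rewrite /w; under eq_fun do rewrite -mulNr; exact: cmeasurable_cisZ.
have nw x : normc (w x) = 1 by exact: normc_cis.
have wper x (k : int) : w (x - k%:~R) = w x.
  rewrite /w (_ : - _ = - (2 * pi * l%:~R * x) + 2 * pi * (l * k)%:~R); last by rewrite intrM; ring.
  by rewrite cisD cis_int_2pi mulr1.
have msh k : cmeasurable (fun x : R => f (x - k)).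
  by apply: (cmeasurable_comp mf); exact: measurable_funB.
have ifw : cintegrable mu (fun x => f x * w x).
  under eq_fun do rewrite mulrC.
  by apply: (@cintegrableM_bounded _ _ _ mu w f 1) => // x; rewrite nw.
have mU : cmeasurable (fun x : R => (unit_indic x)%:C).
  by apply: cmeasurable_real; exact: measurable_unit.
have mUk k : cmeasurable (fun x : R => (unit_indic (x + k))%:C).
  by apply: (cmeasurable_comp mU); exact: measurable_funD.
pose S K x := sym_sum K (fun k => f (x - k%:~R)).
pose I K := cintegral mu (fun x => (unit_indic x)%:C * (S K x * w x)).
have I1 : ccvg I (fcoef (periodize f) l).
  have mS K : cmeasurable (S K) by exact: cmeasurable_sum.
  apply: (@cdct _ _ _ mu _ _ (fun x => (3 * s 0 + 2 * tau 0) * unit_indic x)).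
  - by move=> K; exact: (cmeasurableM mU (cmeasurableM (mS K) mw)).
  - exact: (cmeasurableM mU (cmeasurableM (cmeasurable_continuous periodize_continuous) mw)).
  - move=> x; apply: ccvgMl; apply: ccvgMr; exact: periodize_cvg.
  - by apply: rintegrableZ; exact: rintegrable_unit.
  - move=> K x; rewrite !Normc.normcM nw mulr1 normc_real unit_indicE; case: ifP => x1; last first.
      by rewrite normr0 mul0r mulr0.
    rewrite normr1 mul1r mulr1.
    have x1' : `|x| <= 1%:R by rewrite ler_norml; lra.
    by have := sym_sum_bound K x1'; rewrite mulr1 /S; lra.
apply: (ccvg_unique I1).
(* Unfolding: each summand is translated back, so that [f] stays fixed and the indicators are
   summed. Their symmetric sums are at most 1 and tend to 1, which makes the integral over the line
   appear. *)
have IE K : I K = cintegral mu (fun x => sym_sum K (fun k => (unit_indic (x + k%:~R))%:C) * (f x * w x)).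
  have iUf k : cintegrable mu (fun x => (unit_indic x)%:C * (f (x - k%:~R) * w (x - k%:~R))).
    apply: (@cintegrableM_bounded _ _ _ mu (fun x => (unit_indic x)%:C) (fun x => f (x - k%:~R) * w (x - k%:~R)) 1) => //.
      by move=> x; rewrite normc_real unit_indicE; case: ifP; rewrite ?normr0 ?normr1.
    exact: (cintegrable_shift (- k%:~R) ifw).
  transitivity (sym_sum K (fun k => cintegral mu (fun x => (unit_indic x)%:C * (f (x - k%:~R) * w (x - k%:~R))))).
    rewrite /sym_sum -cintegral_sum //; apply: eq_cintegral => x.
    rewrite /S /sym_sum mulr_suml mulr_sumr; apply: eq_bigr => i _.
    by rewrite wper.
  transitivity (sym_sum K (fun k => cintegral mu (fun x => (unit_indic (x + k%:~R))%:C * (f x * w x)))).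
    apply: eq_sym_sum => k; rewrite -(cintegral_shift k%:~R (iUf k)).
    by apply: eq_cintegral => x; rewrite addrK.
  rewrite /sym_sum -cintegral_sum; last first.
    move=> i; apply: (@cintegrableM_bounded _ _ _ mu (fun x => (unit_indic (x + _))%:C) _ 1).
    - exact: mUk.
    - by move=> x; rewrite normc_real unit_indicE; case: ifP; rewrite ?normr0 ?normr1.
    - exact: ifw.
  by apply: eq_cintegral => x; rewrite mulr_suml.
apply/(eq_ccvg (fun K => esym (IE K))).
apply: (@cdct _ _ _ mu _ _ (fun x => normc (f x))).
- move=> K; apply: cmeasurableM; last exact: (cmeasurableM mf mw).
  by apply: cmeasurable_sum => i; exact: mUk.
- exact: (cmeasurableM mf mw).
- move=> x; rewrite -[X in ccvg _ X]mul1r.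
  by apply: ccvgMr; have [] := unit_indic_sum x.
- exact: cintegrable_normc.
- move=> K x; rewrite !Normc.normcM nw mulr1 ler_piMl ?normc_ge0 //.
  by have [_] := unit_indic_sum x.
Qed.

End periodization.

(** * Fourier inversion by Abel summation *)

Section even_integrals.
Context {R : realType}.
Local Notation mu := (@lebesgue_measure R).
Local Notation rintegrable f := (mu.-integrable setT (EFin \o f)).

Lemma derivable_continuous (F : R -> R) : (forall x : R, derivable F x 1) -> continuous F.
Proof. by move=> dF x; apply: differentiable_continuous; exact/derivable1_diffP. Qed.

Lemma cvgMy (c : R) : 0 < c -> c * x @[x --> +oo] --> +oo.
Proof.
move=> c0; apply/cvgryPge => A; near=> x.
rewrite mulrC -ler_pdivrMr //; near: x; exact: nbhs_pinfty_ge.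
Unshelve. all: by end_near. Qed.

Lemma even_integral_FTC (f F : R -> R) (l : R) : (forall x, 0 <= f x) -> continuous f ->
  (forall x, f (- x) = f x) -> F x @[x --> +oo] --> l -> (forall x : R, derivable F x 1) ->
  (forall x : R, 0 < x -> is_derive x 1 F (f x)) ->
  rintegrable f /\ Rintegral mu setT f = 2 * (l - F 0).
Proof.
move=> f0 cf fN Fl /derivable_continuous cF dF.
have intE : (\int[mu]_x (f x)%:E = (2 * (l - F 0))%:E)%E.
  rewrite ge0_symfun_integralT //; last by move=> x /=; rewrite fN.
  rewrite (_ : [set x | _] = `[0, +oo[%classic); last first.
    by apply/seteqP; split => x/=; rewrite in_itv/= andbT.
  rewrite (ge0_continuous_FTC2y (F := F) (l := l)) //.
  - exact: continuous_subspaceT.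
  - by move=> x /dF[].
  - by apply: cvg_at_right_filter; exact: cF.
  - by move=> x; rewrite in_itv /= andbT => /dF xF; rewrite derive1E derive_val.
split; last by rewrite /Rintegral intE.
apply: ge0_rintegrable => //; first exact: continuous_measurable_fun.
by rewrite intE ltry.
Qed.

Lemma Rintegral_reflect (f : R -> R) : rintegrable f ->
  Rintegral mu setT (fun x => f (- x)) = Rintegral mu setT f.
Proof.
move=> fi; have mf : measurable_fun setT f by move/measurable_int : fi => /measurable_EFinP.
have mN : measurable_fun setT (-%R : measurableTypeR R -> measurableTypeR R).
  by apply: continuous_measurable_fun; exact: opp_continuous.
have mfN : measurable_fun setT (fun x : R => f (- x)) by exact: (measurableT_comp mf mN).
rewrite /Rintegral; congr (fine _).
transitivity (\int[pushforward mu (-%R : measurableTypeR R -> measurableTypeR R)]_x (f x)%:E)%E.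
  rewrite integral_pushforward //; first exact/measurable_EFinP.
  rewrite preimage_setT; apply/integrableP; split; first exact/measurable_EFinP.
  have /integrableP[_] := fi; apply: le_lt_trans.
  rewrite [leRHS](eq_measure_integral (pushforward mu (-%R : measurableTypeR R -> measurableTypeR R))); last first.
    by move=> A mA _; apply/esym; exact: (lebesgue_measureN mA).
  rewrite ge0_integral_pushforward //.
  by apply: measurableT_comp => //; exact/measurable_EFinP.
by apply: eq_measure_integral => A mA _; exact: lebesgue_measureN.
Qed.

Definition expabs (e x : R) : R := expR (- (e * `|x|)).
(** The Poisson kernel of total mass $2\pi$, which is the Fourier transform of [expabs e]. *)
Definition abel (e v : R) : R := 2 * e / (e ^+ 2 + v ^+ 2).

Lemma expabs_ge0 (e x : R) : 0 <= expabs e x. Proof. exact: expR_ge0. Qed.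

Lemma expabs_le1 (e x : R) : 0 <= e -> expabs e x <= 1.
Proof. by move=> e0; rewrite -expR0 ler_expR oppr_le0 mulr_ge0. Qed.

Lemma continuous_expabs (e : R) : continuous (expabs e).
Proof.
move=> x; apply: continuous_comp; last exact: continuous_expR.
apply: continuousN; apply: continuousM; first exact: cst_continuous.
exact: norm_continuous.
Qed.

Lemma expabs_cvgy (e : R) : 0 < e -> expR (- (e * x)) @[x --> +oo] --> (0 : R).
Proof.
move=> e0; apply: (cvg_comp (fun x => e * x) (fun x => expR (- x))); last exact: cvgr_expR.
exact: cvgMy.
Qed.

Lemma expabs_integral (e : R) : 0 < e ->
  rintegrable (expabs e) /\ Rintegral mu setT (expabs e) = 2 / e.
Proof.
move=> e0.
have [//||||||fi ->] := @even_integral_FTC (expabs e) (fun x => - (expR (- (e * x)) / e)) 0.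
- by move=> x; exact: expabs_ge0.
- exact: continuous_expabs.
- by move=> x; rewrite /expabs normrN.
- rewrite -oppr0; apply: cvgN; rewrite -[X in _ --> X](mul0r e^-1).
  by apply: cvgMl; exact: expabs_cvgy.
- by move=> x; exact: ex_derive.
- move=> x x0; rewrite /expabs gtr0_norm //.
  apply: is_derive_eq; rewrite /GRing.scale /=; field; lra.
by split => //; rewrite mulr0 oppr0 expR0; field; lra.
Qed.

Lemma expabs_cos (e v : R) : 0 < e ->
  Rintegral mu setT (fun x => expabs e x * cos (v * x)) = abel e v.
Proof.
move=> e0; have [iE intE] := expabs_integral e0.
have e1 : 0 < e ^+ 2 by rewrite exprn_gt0.
have e2 : 0 < e ^+ 2 + v ^+ 2 by have := sqr_ge0 v; lra.
pose F x := expR (- (e * x)) * (v * sin (v * x) - e * cos (v * x)) / (e ^+ 2 + v ^+ 2)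
  - expR (- (e * x)) / e.
(* Adding 1 to the cosine makes the integrand nonnegative, so that its integral can be read off a
   primitive; the integral of [expabs e] is subtracted afterwards. *)
pose f x := expabs e x * (1 + cos (v * x)).
have clin (a : R) : continuous (fun x => a * x).
  by move=> x; apply: continuousM; [exact: cst_continuous|exact: cvg_id].
have cvl : continuous (fun x => cos (v * x)).
  by move=> x; apply: continuous_comp; [exact: clin|exact: continuous_cos].
have [||||||fi intf] := @even_integral_FTC f F 0.
- by move=> x; rewrite mulr_ge0 ?expabs_ge0 //; have := cos_geN1 (v * x); lra.
- move=> x; apply: continuousM; first exact: continuous_expabs.
  by apply: continuousD; [exact: cst_continuous|exact: cvl].
- by move=> x; rewrite /f /expabs normrN mulrN cosN.
- rewrite -(subrr 0); apply: cvgB; last first.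
    by rewrite -[X in _ --> X](mul0r e^-1); apply: cvgMl; exact: expabs_cvgy.
  rewrite -[X in _ --> X](mul0r (e ^+ 2 + v ^+ 2)^-1); apply: cvgMl.
  have hB (x : R) : `|v * sin (v * x) - e * cos (v * x)| <= `|v| + `|e|.
    rewrite (le_trans (ler_normB _ _)) // !normrM lerD // ler_piMr //; [exact: sin_max|exact: cos_max].
  apply: norm_cvg0; apply: (@squeeze_cvgr _ _ _ _ (cst 0) (fun x => expR (- (e * x)) * (`|v| + `|e|))).
  + apply: nearW => x; rewrite normr_ge0 normrM ger0_norm ?expR_ge0 //.
    by rewrite ler_wpM2l ?expR_ge0.
  + exact: cvg_cst.
  + by rewrite -[X in _ --> X](mul0r (`|v| + `|e|)); apply: cvgMl; exact: expabs_cvgy.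
- by move=> x; exact: ex_derive.
- move=> x x0; rewrite /f /expabs gtr0_norm //.
  apply: is_derive_eq; rewrite /GRing.scale /=; field; apply/andP; split; lra.
have ic : rintegrable (fun x => expabs e x * cos (v * x)).
  have -> : (fun x => expabs e x * cos (v * x)) = (fun x => f x - expabs e x).
    by apply/funext => x; rewrite /f; ring.
  exact: rintegrableB.
have : Rintegral mu setT f = Rintegral mu setT (fun x => expabs e x + expabs e x * cos (v * x)).
  by apply: eq_Rintegral => x _; rewrite /f; ring.
rewrite RintegralD // intf intE /F !mulr0 oppr0 expR0 sin0 cos0 /abel => h.
rewrite (_ : \int[mu]_x _ = 2 * (0 - (1 * (v * 0 - e * 1) / (e ^+ 2 + v ^+ 2) - 1 / e)) - 2 / e); last lra.
by field; apply/andP; split; lra.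
Qed.

Lemma expabs_sin (e v : R) : 0 < e ->
  Rintegral mu setT (fun x => expabs e x * sin (v * x)) = 0.
Proof.
move=> e0; have [iE intE] := expabs_integral e0.
have mE : measurable_fun setT (expabs e).
  by apply: continuous_measurable_fun; exact: continuous_expabs.
have is_ : rintegrable (fun x => expabs e x * sin (v * x)).
  apply: (@le_rintegrable _ _ _ mu _ (expabs e)) => //.
    apply: measurable_funM => //; apply: measurableT_comp; last exact: measurable_funM.
    by apply: continuous_measurable_fun; exact: continuous_sin.
  by move=> x; rewrite normrM ger0_norm ?expabs_ge0 // ler_piMr ?expabs_ge0 // sin_max.
have := Rintegral_reflect is_.
have -> : Rintegral mu setT (fun x => expabs e (- x) * sin (v * - x)) =
    Rintegral mu setT (fun x => (-1) * (expabs e x * sin (v * x))).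
  by apply: eq_Rintegral => x _; rewrite /expabs normrN mulrN sinN; ring.
by rewrite RintegralZl //; lra.
Qed.

Lemma expabs_cis (e v : R) : 0 < e ->
  cintegral mu (fun x => (expabs e x)%:C * cis (v * x)) = (abel e v)%:C.
Proof.
move=> e0; apply: complex_ext => /=.
  by rewrite -expabs_cos //; apply: eq_Rintegral => x _; rewrite mul0r subr0.
transitivity (Rintegral mu setT (fun x => expabs e x * sin (v * x))); last exact: expabs_sin.
by apply: eq_Rintegral => x _; rewrite mul0r addr0.
Qed.

Lemma abel_ge0 (e v : R) : 0 < e -> 0 <= abel e v.
Proof.
move=> e0; rewrite /abel divr_ge0 //; last by rewrite addr_ge0 // sqr_ge0.
by lra.
Qed.

Lemma continuous_abel (e : R) : 0 < e -> continuous (abel e).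
Proof.
move=> e0 v; apply: cvgM; first exact: cvg_cst.
have e2 : 0 < e ^+ 2 by rewrite exprn_gt0.
apply: cvgV; first by rewrite gt_eqF //; have := sqr_ge0 v; lra.
by apply: cvgD; [exact: cvg_cst|exact: exprn_continuous].
Qed.

Lemma abel_integral (e : R) : 0 < e ->
  rintegrable (abel e) /\ Rintegral mu setT (abel e) = 2 * pi.
Proof.
move=> e0; have e2 : 0 < e ^+ 2 by rewrite exprn_gt0.
have [||||||fi intf] := @even_integral_FTC (abel e) (fun x => 2 * atan (x / e)) (2 * (pi / 2)).
- by move=> x; exact: abel_ge0.
- exact: continuous_abel.
- by move=> x; rewrite /abel sqrrN.
- apply: cvgMr; apply: (cvg_comp (fun x => x / e) atan); last exact: cvgy_atan.
  under eq_fun do rewrite mulrC.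
  by apply: cvgMy; rewrite invr_gt0.
- by move=> x; exact: ex_derive.
- move=> x x0; apply: is_derive_eq; rewrite /GRing.scale /= /abel.
  by have := sqr_ge0 x => x2; field; rewrite !gt_eqF //; nra.
by split => //; rewrite intf mul0r atan0; field.
Qed.

End even_integrals.

Section fourier_inversion.
Context {R : realType}.
Local Notation mu := (@lebesgue_measure R).
Local Notation rintegrable f := (mu.-integrable setT (EFin \o f)).
Local Notation RR := (measurableTypeR R * measurableTypeR R)%type.

Lemma cintegrable_cis (a : R) (g : R -> R[i]) : cintegrable mu g ->
  cintegrable mu (fun x => cis (a * x) * g x).
Proof.
move=> ig; apply: (@cintegrableM_bounded _ _ _ mu (fun x => cis (a * x)) g 1 _ _ ig).
  exact: cmeasurable_cisZ.
by move=> x; rewrite normc_cis.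
Qed.

Lemma cintegrable_fourier (y : R) (g : R -> R[i]) : cintegrable mu g ->
  cintegrable mu (fun x => cis (- (y * x)) * g x).
Proof. by move=> /(cintegrable_cis (- y)); under eq_fun do rewrite mulNr. Qed.

(** A product majorant makes every section integrable, not just almost every one, so the inner
    integrals are finite everywhere and real-valued integrals may be exchanged. *)
Lemma rFubini (G : RR -> R) (a b : R -> R) : measurable_fun setT G ->
  rintegrable a -> rintegrable b -> (forall x, 0 <= a x) -> (forall x, 0 <= b x) ->
  (forall x v, `|G (x, v)| <= a x * b v) ->
  [/\ forall x, rintegrable (fun v => G (x, v)),
      forall v, rintegrable (fun x => G (x, v)) &
  Rintegral mu setT (fun x => Rintegral mu setT (fun v => G (x, v))) =
  Rintegral mu setT (fun v => Rintegral mu setT (fun x => G (x, v)))].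
Proof.
move=> mG ia ib a0 b0 Gab.
have i1 x : rintegrable (fun v => G (x, v)).
  apply: (@le_rintegrable _ _ _ mu _ (fun v => a x * b v)) => //.
    exact: (measurableT_comp mG (pair1_measurable x)).
  exact: rintegrableZ.
have i2 v : rintegrable (fun x => G (x, v)).
  apply: (@le_rintegrable _ _ _ mu _ (fun x => b v * a x)) => //.
  - exact: (measurableT_comp mG (pair2_measurable v)).
  - by move=> x; rewrite mulrC.
  - exact: rintegrableZ.
split => //.
have iG : (mu \x mu)%E.-integrable setT (EFin \o G).
  apply/integrable12ltyP; first exact/measurable_EFinP.
  apply: (@le_lt_trans _ _ (\int[mu]_x ((Rintegral mu setT b) * a x)%:E)%E).
    apply: ge0_le_integral => //.
    - by move=> x _; exact: integral_ge0.
    - apply: (@measurable_fun_fubini_tonelli_F _ _ _ _ _ mu (abse \o (EFin \o G))) => //=.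
      by apply: measurableT_comp => //; exact/measurable_EFinP.
    - apply/measurable_EFinP; apply: measurable_funM => //.
      by have /measurable_int/measurable_EFinP := ia.
    - move=> x _; rewrite mulrC EFinM EFin_Rintegral // -ge0_integralZl_EFin //.
      + apply: ge0_le_integral => //.
        * by apply: measurableT_comp => //; have /measurable_int := i1 x.
        * by apply/measurable_EFinP/measurable_funM => //; have /measurable_int/measurable_EFinP := ib.
        * by move=> v _; rewrite -EFinM lee_fin.
      + by move=> v _; rewrite lee_fin.
      + by have /measurable_int := ib.
  apply: rintegrable_lty; first exact: rintegrableZ.
  by move=> x; rewrite mulr_ge0 // Rintegral_ge0.
rewrite /Rintegral; congr (fine _).
transitivity (\int[mu]_x \int[mu]_v (G (x, v))%:E)%E.
  apply: eq_integral => x _; rewrite fineK //.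
  exact: (integrable_fin_num measurableT (i1 x)).
rewrite (Fubini iG); apply: eq_integral => v _; rewrite fineK //.
exact: (integrable_fin_num measurableT (i2 v)).
Qed.

Lemma cFubini (F : RR -> R[i]) (a b : R -> R) : cmeasurable F ->
  rintegrable a -> rintegrable b -> (forall x, 0 <= a x) -> (forall x, 0 <= b x) ->
  (forall x v, normc (F (x, v)) <= a x * b v) ->
  cintegral mu (fun x => cintegral mu (fun v => F (x, v))) =
  cintegral mu (fun v => cintegral mu (fun x => F (x, v))).
Proof.
move=> [m1 m2] ia ib a0 b0 Fab; apply: complex_ext => /=.
  have [|_ _ ->//] := rFubini m1 ia ib a0 b0.
  by move=> x v; exact: le_trans (le_Re_normc _) (Fab x v).
have [|_ _ ->//] := rFubini m2 ia ib a0 b0.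
by move=> x v; exact: le_trans (le_Im_normc _) (Fab x v).
Qed.

(** By Fubini and the transform of [expabs], the Abel means of the inverse transform are Poisson
    means of [g]. *)
Lemma abel_fourier (e y : R) (g : R -> R[i]) : 0 < e -> cintegrable mu g ->
  cintegral mu (fun x => (expabs e x)%:C * (cis (y * x) * fourier g x)) =
  cintegral mu (fun v => (abel e (y - v))%:C * g v).
Proof.
move=> e0 ig; have mg := cintegrable_meas ig.
have [iE _] := expabs_integral e0.
pose F (p : RR) := (expabs e p.1)%:C * cis ((y - p.2) * p.1) * g p.2.
have mfst : measurable_fun setT (fst : RR -> measurableTypeR R) by exact: measurable_fst.
have msnd : measurable_fun setT (snd : RR -> measurableTypeR R) by exact: measurable_snd.
have mF : cmeasurable F.
  apply: cmeasurableM; last exact: (cmeasurable_comp mg msnd).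
  apply: cmeasurableM.
    apply: cmeasurable_real; apply: (measurableT_comp _ mfst).
    by apply: continuous_measurable_fun; exact: continuous_expabs.
  apply: cmeasurable_cis; apply: measurable_funM => //.
  by apply: measurable_funB => //; exact: measurable_cst.
have F_le x v : normc (F (x, v)) <= expabs e x * normc (g v).
  by rewrite /F /= !Normc.normcM normc_cis mulr1 normc_real ger0_norm ?expabs_ge0.
have := cFubini mF iE (cintegrable_normc ig) (fun x => expabs_ge0 e x) (fun v => normc_ge0 (g v)) F_le.
rewrite /F /= => h.
transitivity (cintegral mu (fun x => cintegral mu (fun v => F (x, v)))).
  apply: eq_cintegral => x; rewrite /fourier /F /= mulrA -cintegralZ; last exact: cintegrable_fourier.
  apply: eq_cintegral => v; rewrite mulrA -(mulrA _ (cis (y * x))) -cisD.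
  by congr (_ * cis _ * _); ring.
rewrite h; apply: eq_cintegral => v.
rewrite -(expabs_cis (y - v) e0).
rewrite mulrC -cintegralZ.
  by apply: eq_cintegral => x; rewrite mulrC.
have := cintegrable_cis (y - v) (cintegrable_real iE).
by congr (cintegrable mu _); apply/funext => x; rewrite mulrC.
Qed.

Lemma ae_cintegral_le (f : R -> R[i]) (h : R -> R) : cintegrable mu f -> rintegrable h ->
  {ae mu, forall x, normc (f x) <= h x} -> normc (cintegral mu f) <= 2 * Rintegral mu setT h.
Proof.
move=> fi ih fh; have ifn := cintegrable_normc fi.
apply: (le_trans (normc_cintegral fi ifn (fun x => lexx _))).
rewrite ler_wpM2l // -lee_fin !EFin_Rintegral //.
have mh := measurable_int mu ih; have mf := measurable_int mu ifn.
rewrite -[leRHS](_ : \int[mu]_x `|(h x)%:E| = _)%E; last first.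
  apply: ae_eq_integral => //; first exact: measurableT_comp.
  apply: ae_mono fh => x fh _; rewrite gee0_abs // lee_fin.
  exact: le_trans (normc_ge0 _) fh.
apply: ae_ge0_le_integral => //.
- by move=> x _; rewrite lee_fin normc_ge0.
- exact: measurableT_comp.
- by apply: ae_mono fh => x fh _ /=; rewrite lee_fin (le_trans fh) // ler_norm.
Qed.

Lemma abel_le (e v : R) : 0 < e -> abel e v <= 2 / e.
Proof.
move=> e0; have v2 := sqr_ge0 v; have e2 : 0 < e ^+ 2 by rewrite exprn_gt0.
rewrite /abel ler_pdivrMr; last lra.
rewrite (_ : 2 / e * (e ^+ 2 + v ^+ 2) = 2 * e + 2 / e * v ^+ 2); last by field; lra.
have : 0 <= 2 / e * v ^+ 2 by rewrite mulr_ge0 // divr_ge0 // ltW.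
lra.
Qed.

(** Two bounds away from the centre. The uniform one is paired with the integrable function [g]; the
    constant [c] is not integrable, so for it the kernel is compared with the integrable kernel of
    parameter 1. *)
Lemma abel_le_far (e q v : R) : 0 < e -> e <= 1 -> 0 < q -> q <= v ^+ 2 ->
  abel e v <= 2 * e / q /\ abel e v <= e * (1 + 1 / q) * abel 1 v.
Proof.
move=> e0 e1 q0; rewrite /abel expr1n mulr1.
have e2 : 0 < e ^+ 2 by rewrite exprn_gt0.
have e21 : e ^+ 2 <= 1 by rewrite exprn_ile1 // ltW.
move: (e ^+ 2) (v ^+ 2) e2 e21 => s t s0 s1 qt.
split; first by rewrite ler_pM2l ?mulr_gt0 // lef_pV2 ?posrE //; lra.
have -> : e * (1 + 1 / q) * (2 / (1 + t)) = 2 * e * ((1 + 1 / q) / (1 + t)).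
  by field; apply/andP; split; lra.
rewrite ler_pM2l ?mulr_gt0 // -div1r ler_pdivrMr; last lra.
rewrite mulrAC ler_pdivlMr; last lra.
rewrite (_ : (1 + 1 / q) * (s + t) = s + t + (s + t) / q); last by field; lra.
have : 1 <= (s + t) / q by rewrite ler_pdivlMr // mul1r; lra.
lra.
Qed.

(** The Poisson kernels form an approximate identity. Closeness of [g] to [c] is required only a.e.
    near [y], because the lemma must serve functions known only up to null sets. *)
Lemma abel_concentrates (g : R -> R[i]) (y : R) (c : R[i]) : cintegrable mu g ->
  (forall eta : R, 0 < eta -> exists2 delta : R, 0 < delta &
     {ae mu, forall v, `|v - y| < delta -> normc (g v - c) <= eta}) ->
  ccvg (fun n => cintegral mu (fun v => (abel n.+1%:R^-1 (y - v))%:C * g v)) ((2 * pi)%:C * c).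
Proof.
move=> ig gc; apply/ccvgP => e0 e00.
have pi0 := @pi_gt0 R.
(* The final estimate reads [e0 / 4 + C * e]: [eta] yields the first term through the mass $2\pi$ of
   the kernel, and [n] is taken so large that [8 * C * e < e0]. *)
pose eta := e0 / (16 * pi).
have eta0 : 0 < eta by rewrite divr_gt0 //; lra.
have [delta d0 hd] := gc _ eta0.
pose A := Rintegral mu setT (fun v => normc (g v)).
have A0 : 0 <= A by apply: Rintegral_ge0 => x _; exact: normc_ge0.
have ign := cintegrable_normc ig.
pose C := 4 * A / delta ^+ 2 + 4 * normc c * (1 + 1 / delta ^+ 2) * pi.
have d2 : 0 < delta ^+ 2 by rewrite exprn_gt0.
have c0 := normc_ge0 c.
have C0 : 0 <= C.
  have x1 : 0 <= 4 * A / delta ^+ 2 by apply: divr_ge0; [lra|exact: ltW].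
  have x2 : 0 <= 1 / delta ^+ 2 by rewrite divr_ge0 // ltW.
  have x3 : 0 <= normc c * (1 + 1 / delta ^+ 2) * pi.
    by apply: mulr_ge0; [apply: mulr_ge0 => //; lra|exact: ltW].
  rewrite /C; lra.
exists (Num.truncn (8 * C / e0)).+1 => n nN.
set e := n.+1%:R^-1.
have e_0 : 0 < e by rewrite invr_gt0.
have eC : 8 * C * e < e0.
  have nb : 8 * C / e0 < n.+1%:R.
    by apply: lt_le_trans (truncnS_gt _) _; rewrite ler_nat; exact: leqW.
  by rewrite ltr_pdivrMr // in nb; rewrite /e ltr_pdivrMr // (mulrC e0).
have e1 : e <= 1 by rewrite invf_le1 // ler1n.
have [iK intK] := abel_integral e_0.
have [iK1 intK1] := abel_integral (@ltr01 R).
pose K v := abel e (y - v); pose K1 v := abel 1 (y - v).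
have refl (f : R -> R) : rintegrable f -> (forall x, f (- x) = f x) ->
    rintegrable (fun v => f (y - v)) /\
    Rintegral mu setT (fun v => f (y - v)) = Rintegral mu setT f.
  move=> fi fN; have -> : (fun v => f (y - v)) = (fun v => f (v + - y)).
    by apply/funext => v; rewrite -fN opprB.
  by split; [exact: rintegrable_shift|exact: Rintegral_shift].
have [iKy intKy] := refl _ iK (fun x => ltac:(by rewrite /abel sqrrN)).
have [iK1y intK1y] := refl _ iK1 (fun x => ltac:(by rewrite /abel sqrrN)).
have K0 v : 0 <= K v by exact: abel_ge0.
have mK : measurable_fun setT K by have /measurable_int/measurable_EFinP := iKy.
have mg := cintegrable_meas ig.
have Kbound v : K v <= 2 / e by exact: abel_le.
have iKg : cintegrable mu (fun v => (K v)%:C * g v).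
  apply: (@cintegrableM_bounded _ _ _ mu (fun v => (K v)%:C) g (2 / e)) => //.
  by move=> v; rewrite normc_real ger0_norm.
have iKc : cintegrable mu (fun v => c * (K v)%:C) by apply: cintegrableZ; exact: cintegrable_real.
have intKc : cintegral mu (fun v => c * (K v)%:C) = (2 * pi)%:C * c.
  by rewrite cintegralZ ?cintegral_real ?intKy ?intK; [rewrite mulrC|exact: cintegrable_real].
rewrite -intKc -cintegralB //.
pose h v := eta * K v + (2 * e / delta ^+ 2) * normc (g v) + (normc c * e * (1 + 1 / delta ^+ 2)) * K1 v.
have ih : rintegrable h.
  apply: rintegrableD; last exact: rintegrableZ.
  by apply: rintegrableD; exact: rintegrableZ.
have h1 : {ae mu, forall v, normc ((K v)%:C * g v - c * (K v)%:C) <= h v}.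
  apply: ae_mono hd => v hv.
  rewrite (mulrC c) -mulrBr Normc.normcM normc_real ger0_norm //.
  have K1v : 0 <= K1 v by exact: abel_ge0.
  have hh : 0 <= (2 * e / delta ^+ 2) * normc (g v).
    by rewrite mulr_ge0 ?normc_ge0 // divr_ge0 // ltW // mulr_gt0.
  have hh2 : 0 <= (normc c * e * (1 + 1 / delta ^+ 2)) * K1 v.
    rewrite mulr_ge0 // mulr_ge0 //; first by rewrite mulr_ge0 // ltW.
    by rewrite addr_ge0 // divr_ge0 // ltW.
  have [vd|vd] := ltP `|v - y| delta.
    have := ler_wpM2l (K0 v) (hv vd); rewrite /h mulrC; lra.
  have yv : delta ^+ 2 <= (y - v) ^+ 2.
    rewrite -(real_normK (num_real (y - v))) (distrC y); apply: lerXn2r => //.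
    by rewrite nnegrE ltW.
  have [Kd KK] := abel_le_far e_0 e1 d2 yv; rewrite -/(K v) -/(K1 v) in Kd KK.
  have g1 := normcB (g v) c; have gv := normc_ge0 (g v).
  have hK : 0 <= eta * K v by rewrite mulr_ge0 // ltW.
  have b1 := ler_wpM2l (K0 v) g1; have b2 := ler_wpM2r gv Kd.
  have b3 := ler_wpM2r c0 KK.
  apply: (le_trans b1); rewrite mulrDr /h; lra.
have := ae_cintegral_le (cintegrableB iKg iKc) ih h1.
rewrite /h RintegralD //; last 2 first.
- by apply: rintegrableD; exact: rintegrableZ.
- exact: rintegrableZ.
rewrite RintegralD //; try exact: rintegrableZ.
have intK' : Rintegral mu setT K = 2 * pi by rewrite -intK -intKy.
have intK1' : Rintegral mu setT K1 = 2 * pi by rewrite -intK1 -intK1y.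
have zE (a b : R) (f : R -> R) : rintegrable f -> Rintegral mu setT f = b ->
    Rintegral mu setT (fun v => a * f v) = a * b by move=> fi <-; exact: RintegralZl.
rewrite (zE _ _ _ iKy intK') (zE _ _ _ iK1y intK1') (zE _ A _ ign) //.
have -> : 2 * (eta * (2 * pi) + 2 * e / delta ^+ 2 * A + normc c * e * (1 + 1 / delta ^+ 2) * (2 * pi)) = e0 / 4 + C * e.
  by rewrite /eta /C; field; rewrite !gt_eqF //; lra.
lra.
Qed.

(** The Abel means have two limits: the inversion integral, by dominated convergence with majorant
    [|g^|], and $2\pi c$, by concentration of the Poisson kernel. *)
Lemma fourier_inversion (g : R -> R[i]) (y : R) (c : R[i]) : cintegrable mu g ->
  cintegrable mu (fourier g) ->
  (forall eta : R, 0 < eta -> exists2 delta : R, 0 < delta &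
     {ae mu, forall v, `|v - y| < delta -> normc (g v - c) <= eta}) ->
  inv_fourier (fourier g) y = c.
Proof.
move=> ig ifg gc; have h1 := abel_concentrates ig gc.
have h2 : ccvg (fun n => cintegral mu (fun x => (expabs n.+1%:R^-1 x)%:C * (cis (y * x) * fourier g x)))
    (cintegral mu (fun x => cis (y * x) * fourier g x)).
  have icf := cintegrable_cis y ifg; have mcf := cintegrable_meas icf.
  apply: (@cdct _ _ _ mu _ _ (fun x => normc (fourier g x))) => //.
  - move=> n; apply: cmeasurableM => //; apply: cmeasurable_real.
    by apply: continuous_measurable_fun; exact: continuous_expabs.
  - move=> x; rewrite -[X in ccvg _ X]mul1r; apply: ccvgMr.
    apply: ccvg_ReIm => /=; last exact: cvg_cst.
    rewrite /expabs -[X in _ --> X]expR0; apply: continuous_cvg; first exact: continuous_expR.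
    rewrite -oppr0; apply: cvgN; rewrite -[X in _ --> X](mul0r `|x|); apply: cvgMl.
    exact: cvg_harmonic.
  - exact: cintegrable_normc.
  - move=> n x; rewrite !Normc.normcM normc_cis mul1r normc_real ger0_norm ?expabs_ge0 //.
    by rewrite ler_piMl ?normc_ge0 // expabs_le1.
have e1 n : cintegral mu (fun x => (expabs n.+1%:R^-1 x)%:C * (cis (y * x) * fourier g x)) =
    cintegral mu (fun v => (abel n.+1%:R^-1 (y - v))%:C * g v) by exact: abel_fourier.
rewrite /inv_fourier [X in _ * X](_ : _ = (2 * pi)%:C * c); last first.
  rewrite -(ccvg_unique h2 (eq_ccvg (fun n => esym (e1 n)) h1)).
  by apply: eq_cintegral => x; rewrite mulrC (mulrC y) mulrC.
rewrite mulrA -rmorphM mulVf ?mul1r // gt_eqF //.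
by have := @pi_gt0 R; lra.
Qed.

Lemma fourier_inversion_continuous (g : R -> R[i]) (y : R) : ccontinuous_at g y ->
  cintegrable mu g -> cintegrable mu (fourier g) -> inv_fourier (fourier g) y = g y.
Proof.
move=> /ccontinuous_atP cg ig ifg; apply: fourier_inversion => // eta /cg[delta d0 hd].
by exists delta => //; apply: aeW => v /hd /ltW.
Qed.

End fourier_inversion.

(** * Mean value bounds, symmetric sums and regularity of Fourier transforms *)

Section mean_value.
Context {R : realType}.

Lemma mvt_bound (h : R -> R) (M x y : R) : (forall t : R, derivable h t 1) ->
  (forall t, `|t| <= Num.max `|x| `|y| -> `|derive1 h t| <= M) ->
  `|h y - h x| <= M * `|y - x|.
Proof.
wlog xy : x y / x <= y => [hw dh hM|].
  have [xy|yx] := leP x y; first exact: hw.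
  rewrite distrC (distrC y); apply: hw => //; first exact: ltW.
  by move=> t; rewrite maxC; exact: hM.
move=> dh hM.
have [||c cxy ->] := @MVT_segment R h (derive1 h) x y xy.
- by move=> t _; rewrite derive1E; exact: derivableP.
- by apply: continuous_subspaceT => t; apply: differentiable_continuous; exact/derivable1_diffP.
rewrite normrM ler_wpM2r //; apply: hM.
move: cxy; rewrite in_itv /= => /andP[xc cy].
have m1 : `|x| <= Num.max `|x| `|y| by rewrite le_max lexx.
have m2 : `|y| <= Num.max `|x| `|y| by rewrite le_max lexx orbT.
have := ler_norm y; have := ler_norm (- x); rewrite normrN ler_norml => h1 h2.
by apply/andP; split; lra.
Qed.

End mean_value.

Section real_complex_theory.
Context {R : realType}.

Lemma realcD (x y : R) : (x + y)%:C = x%:C + y%:C.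
Proof. by apply: complex_ext; rewrite //= addr0. Qed.

Lemma realcM (x y : R) : (x * y)%:C = x%:C * y%:C.
Proof. by apply: complex_ext; rewrite /= ?mul0r ?mulr0 ?subr0 ?addr0. Qed.

Lemma realc_sum I (s : seq I) (F : I -> R) :
  (\sum_(i <- s) F i)%:C = \sum_(i <- s) (F i)%:C.
Proof.
elim: s => [|i s IH]; first by rewrite !big_nil.
by rewrite !big_cons realcD IH.
Qed.

End real_complex_theory.

Section sym_sums.
Context {R : realType}.

(** Splitting by parity. The odd indices [2 l + 1] with [|l| <= K] overshoot the window at the upper
    end only, by the single index [2 K + 1]. *)
Lemma sym_sum_double K (F : int -> R[i]) : sym_sum K.*2 F =
  sym_sum K (fun l => F (2 * l)) + sym_sum K (fun l => F (2 * l + 1)) - F (2 * K%:Z + 1).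
Proof.
elim: K => [|K IH]; first by rewrite double0 !sym_sum0 !mulr0 add0r; ring.
rewrite doubleS !sym_sumS IH.
rewrite (_ : 2 * K.+1%:Z = K.*2.+2%:Z); last lia.
rewrite (_ : 2 * - K.+1%:Z = - K.*2.+2%:Z); last lia.
rewrite (_ : K.*2.+2%:Z + 1 = 2 * K.+1%:Z + 1); last lia.
rewrite (_ : - K.*2.+2%:Z + 1 = - K.*2.+1%:Z); last lia.
rewrite (_ : 2 * K%:Z + 1 = K.*2.+1%:Z); last lia.
ring.
Qed.

Lemma esum_sym_sum (a : int -> R) (c : R) : (forall l, 0 <= a l) ->
  (\esum_(l in [set: int]) (a l)%:E = c%:E)%E ->
  ccvg (fun K => sym_sum K (fun l => (a l)%:C)) c%:C.
Proof.
move=> a0 asum.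
(* Grouping the integers by absolute value turns the unordered sum into a series of nonnegative
   terms whose partial sums are the symmetric ones. *)
pose F (i : nat) : set int := [set l | `|l|%N = i].
pose e (i : nat) : R := if i is j.+1 then a j.+1%:Z + a (- j.+1%:Z) else a 0.
have a0' l : (0 <= (a l)%:E)%E by rewrite lee_fin.
have eF i : (\esum_(l in F i) (a l)%:E = (e i)%:E)%E.
  case: i => [|i].
    rewrite (_ : F 0%N = [set 0]) ?esum_set1 //.
    by apply/seteqP; split => l; rewrite /F /=; lia.
  rewrite (esumID [set i.+1%:Z]) //.
  rewrite (_ : F i.+1 `&` [set i.+1%:Z] = [set i.+1%:Z]); last first.
    by apply/seteqP; split => l /=; [by case|by move=> ->; split; rewrite /F /=; lia].
  rewrite (_ : F i.+1 `&` ~` [set i.+1%:Z] = [set - i.+1%:Z]); last first.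
    apply/seteqP; split => l /=; rewrite /F /=.
      by move=> [h1 h2]; lia.
    by move=> ->; split; [lia|move=> h; lia].
  by rewrite !esum_set1.
have Fu : [set: int] = \bigcup_n F n.
  by apply/seteqP; split => l // _; exists `|l|%N.
have trF : trivIset [set: nat] F by move=> i j _ _ [l [/= <- <-]].
rewrite Fu nneseries_sum_bigcup // in asum.
have SE K : sym_sum K (fun l => (a l)%:C) = (\sum_(0 <= i < K.+1) e i)%:C.
  rewrite sym_sum_pair [in RHS]big_nat_recl // realcD realc_sum; congr (_ + _).
  by rewrite big_add1; apply: eq_bigr => i _; rewrite -realcD.
apply: ccvg_ReIm; rewrite /=; last first.
  by under eq_fun do rewrite SE /=; exact: cvg_cst.
under eq_fun do rewrite SE /=.
suff h : \sum_(0 <= i < n) e i @[n --> \oo] --> c.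
  by move: h; rewrite -(cvg_shiftS (fun n => \sum_(0 <= i < n) e i)).
have e0 i : (0 <= (e i)%:E)%E by rewrite lee_fin /e; case: i => // i; exact: addr_ge0.
have h : (\sum_(0 <= i < n) (e i)%:E)%E @[n --> \oo] --> c%:E.
  rewrite -asum; under eq_eseriesr do rewrite eF.
  exact: is_cvg_nneseries.
rewrite (_ : (fun n => _) = (fun n => fine (\sum_(0 <= i < n) (e i)%:E)%E)).
  exact: fine_cvg h.
by apply/funext => n; rewrite sumEFin.
Qed.

End sym_sums.

Section fourier_regularity.
Context {R : realType}.
Local Notation mu := (@lebesgue_measure R).
Local Notation rintegrable f := (mu.-integrable setT (EFin \o f)).

Lemma cderive_mvt (f : R -> R[i]) (M x y : R) : cderivable f ->
  (forall t, `|t| <= Num.max `|x| `|y| -> normc (cderive f t) <= M) ->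
  normc (f y - f x) <= 2 * M * `|y - x|.
Proof.
move=> df fM; rewrite (le_trans (normc_le_ReIm _)) // ReD ImD ReN ImN -mulrA mulr_natl mulr2n.
apply: lerD.
  apply: (@mvt_bound R (fun u => complex.Re (f u))) => [t|t xt]; first by have [] := df t.
  exact: le_trans (le_Re_normc (cderive f t)) (fM t xt).
apply: (@mvt_bound R (fun u => complex.Im (f u))) => [t|t xt]; first by have [] := df t.
exact: le_trans (le_Im_normc (cderive f t)) (fM t xt).
Qed.

(** The mean value inequality is applied twice, to [cderive f] and then to [f]; each use contributes
    a factor 2 for the real and imaginary parts. *)
Lemma quadratic_bound (f : R -> R[i]) (M u : R) : cderivable f -> cderivable (cderive f) ->
  f 0 = 0 -> cderive f 0 = 0 -> (forall u, normc (cderive (cderive f) u) <= M) ->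
  normc (f u) <= 4 * M * u ^+ 2.
Proof.
move=> df ddf f0 f'0 fM.
have f'b t : normc (cderive f t) <= 2 * M * `|t|.
  by have := @cderive_mvt _ M 0 t ddf (fun t _ => fM t); rewrite f'0 !subr0.
have M0 : 0 <= M := le_trans (normc_ge0 _) (fM 0).
have := @cderive_mvt _ (2 * M * `|u|) 0 u df; rewrite f0 !subr0 normr0.
rewrite -(real_normK (num_real u)) => h; apply: le_trans (h _) _; last first.
  by rewrite le_eqVlt; apply/orP; left; apply/eqP; ring.
move=> t; rewrite (max_r (normr_ge0 u)) => tu; apply: le_trans (f'b t) _.
by rewrite ler_wpM2l // mulr_ge0.
Qed.

Lemma fourier_ccontinuous (g : R -> R[i]) : cintegrable mu g -> ccontinuous (fourier g).
Proof.
(* Dominated convergence is a statement about sequences, so a failure of continuity is first turned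
   into a sequence tending to [x] along which the transform stays away from its value. *)
move=> ig x; apply/ccontinuous_atP => e e0; apply: contrapT => /forall2NP h.
have {}h n : exists y, `|y - x| < n.+1%:R^-1 /\ ~ normc (fourier g y - fourier g x) < e.
  have [|] := h n.+1%:R^-1; first by rewrite invr_gt0.
  by move=> /existsNP[y /not_implyP[]]; exists y.
have [y hy] := choice h.
have yx : ccvg (fun n => (y n)%:C) x%:C.
  apply: (@ccvg_le _ _ _ (fun n => n.+1%:R^-1)); first exact: cvg_harmonic.
  move=> n; rewrite (_ : (y n)%:C - x%:C = (y n - x)%:C); last by apply: complex_ext; rewrite /= ?subr0.
  by rewrite normc_real ltW //; have [] := hy n.
have mg := cintegrable_meas ig.
have : ccvg (fun n => fourier g (y n)) (fourier g x).
  apply: (@cdct _ _ _ mu _ _ (fun x => normc (g x))).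
  - by move=> n; have /cintegrable_meas := cintegrable_fourier (y n) ig.
  - by have /cintegrable_meas := cintegrable_fourier x ig.
  - move=> t; apply: ccvgMr; apply: ccvg_ReIm => /=.
      apply: continuous_cvg; first exact: continuous_cos.
      by apply: cvgN; apply: cvgMl; exact: (ccvg_Re yx).
    apply: continuous_cvg; first exact: continuous_sin.
    by apply: cvgN; apply: cvgMl; exact: (ccvg_Re yx).
  - exact: cintegrable_normc.
  - by move=> n t; rewrite Normc.normcM normc_cis mul1r.
by move=> /ccvgP /(_ e e0)[N /(_ N (leqnn N))]; have [] := hy N.
Qed.

Definition itv_indic (a b : R) : R -> R := \1_(`[a, b[%classic).

Lemma itv_indicE a b x : itv_indic a b x = if a <= x < b then 1 else 0.
Proof. by rewrite /itv_indic indicE mem_setE in_itv /=; case: ifP. Qed.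

Lemma rintegrable_itv a b : rintegrable (itv_indic a b).
Proof. exact: integrable_indic_itv. Qed.

Lemma Rintegral_itv a b : a <= b -> Rintegral mu setT (itv_indic a b) = b - a.
Proof.
move=> ab; rewrite /Rintegral integral_indic //= setIT lebesgue_measure_itv /= lte_fin.
move: ab; rewrite le_eqVlt => /predU1P[->|->]; last by rewrite -EFinD.
by rewrite ltxx /= subrr.
Qed.

Lemma measurable_itv_indic a b : measurable_fun setT (itv_indic a b).
Proof. by have /measurable_int/measurable_EFinP := rintegrable_itv a b. Qed.

Lemma rintegrable_itvM a b (f : R -> R) : rintegrable f -> rintegrable (fun x => itv_indic a b x * f x).
Proof.
move=> fi; have mf : measurable_fun setT f by move/measurable_int : fi => /measurable_EFinP.
apply: (@le_rintegrable _ _ _ mu _ (fun x => `|f x|)).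
- by apply: measurable_funM => //; exact: measurable_itv_indic.
- by move=> x; rewrite itv_indicE; case: ifP => _; rewrite ?mul1r // mul0r normr0.
- exact: integrable_norm.
Qed.

(* [f] stays above [normc (f v) / 2] on an interval of length
   [normc (f v) / (2 L)]. *)
Lemma lipschitz_integral (f : R -> R[i]) (L v : R) : 0 < L ->
  (forall x y, normc (f y - f x) <= L * `|y - x|) -> (forall x, normc (f x) <= L) ->
  cintegrable mu f ->
  normc (f v) ^+ 2 <= 4 * L * Rintegral mu setT (fun x => itv_indic v (v + 1) x * normc (f x)).
Proof.
move=> L0 fL fM fi; set a := normc (f v).
have a0 : 0 <= a := normc_ge0 _.
pose d := a / (2 * L).
have d0 : 0 <= d by rewrite divr_ge0 // mulr_ge0 // ltW.
have d1 : d <= 1 by rewrite ler_pdivrMr ?mulr_gt0 // mul1r; have := fM v; rewrite -/a; lra.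
have ifn := cintegrable_normc fi.
have : Rintegral mu setT (fun x => a / 2 * itv_indic v (v + d) x) <=
    Rintegral mu setT (fun x => itv_indic v (v + 1) x * normc (f x)).
  apply: le_Rintegral => //.
  - by apply: rintegrableZ; exact: rintegrable_itv.
  - exact: rintegrable_itvM.
  - move=> x _; rewrite !itv_indicE; case: ifP => [/andP[h1 h2]|_]; last first.
      by rewrite mulr0; case: ifP => _; rewrite ?mul0r // mul1r normc_ge0.
    rewrite ifT; last lra; rewrite mulr1 mul1r.
    have := normcD (f v - f x) (f x); rewrite subrK -/a.
    have := fL v x; rewrite normc_distC ger0_norm; last lra.
    have : L * (x - v) <= L * d by rewrite ler_pM2l //; lra.
    have -> : L * d = a / 2 by rewrite /d; field; lra.
    lra.
have vd : v <= v + d by lra.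
rewrite (RintegralZl (a / 2) measurableT (rintegrable_itv v (v + d))) Rintegral_itv // addrAC subrr add0r.
have -> : a ^+ 2 = 4 * L * (a / 2 * d) by rewrite /d; field; lra.
by rewrite ler_pM2l // mulr_gt0.
Qed.

(** Write [a] as [a^(1 - gamma) * a^gamma] and bound the first factor by means of [M]. The threshold
    [e] on [|u|] makes the logarithm at least 1, so its power may be inserted. *)
Lemma log_moment_pointwise (a M gamma alpha u : R) : 0 <= a -> a <= M -> 0 < gamma < 1 ->
  0 <= alpha -> expR 1 <= `|u| ->
  a <= M `^ (1 - gamma) * ((ln (1 + `|u|)) `^ alpha * a `^ gamma).
Proof.
move=> a0 aM g01 al0 u1; have M0 : 0 <= M := le_trans a0 aM.
have ln1 : 1 <= ln (1 + `|u|).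
  have e1 := expR_gt0 (1 : R); have u0 := normr_ge0 u.
  by rewrite -[leLHS](expRK 1) ler_ln ?posrE //; lra.
have ln1' : 1 <= ln (1 + `|u|) `^ alpha.
  have : 1 `^ alpha <= ln (1 + `|u|) `^ alpha by apply: ge0_ler_powR => //; rewrite nnegrE //; lra.
  by rewrite powR1.
have aE : a = a `^ (1 - gamma) * a `^ gamma.
  rewrite -powRD; first by rewrite subrK powRr1.
  by rewrite subrK oner_eq0.
have m1 : a `^ (1 - gamma) <= M `^ (1 - gamma).
  by apply: ge0_ler_powR => //; rewrite ?nnegrE //; lra.
have p0 := powR_ge0 a gamma; have p1 := powR_ge0 a (1 - gamma).
rewrite {1}aE mulrA ler_wpM2r // -[leLHS]mulr1.
by apply: ler_pM.
Qed.

Lemma log_moment_cintegrable (f : R -> R[i]) (M gamma alpha : R) : cmeasurable f ->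
  (forall u, normc (f u) <= M) -> 0 < gamma < 1 -> 0 <= alpha ->
  (\int[mu]_u ((ln (1 + `|u|)) `^ alpha * (normc (f u)) `^ gamma)%:E < +oo)%E ->
  cintegrable mu f.
Proof.
move=> mf fM g01 al0 logm.
have M0 : 0 <= M := le_trans (normc_ge0 _) (fM 0).
pose h (u : R) := (ln (1 + `|u|)) `^ alpha * (normc (f u)) `^ gamma.
have h0 u : 0 <= h u by rewrite mulr_ge0 // powR_ge0.
have mn := measurable_normc mf.
have mh : measurable_fun setT h.
  apply: measurable_funM.
    apply: (measurableT_comp (measurable_powR alpha)).
    apply: (measurableT_comp (@measurable_ln R)).
    by apply: measurable_funD => //; exact: measurableT_comp.
  exact: (measurableT_comp (measurable_powR gamma) mn).
have ih : rintegrable h by exact: ge0_rintegrable.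
pose E := expR (1 : R).
apply: (@le_cintegrable _ _ _ mu _ (fun u => M * itv_indic (- E) E u + M `^ (1 - gamma) * h u)) => //.
  apply: aeW => u; have hu : 0 <= M `^ (1 - gamma) * h u by rewrite mulr_ge0 // powR_ge0.
  have [u2|u2] := ltP `|u| E.
    rewrite itv_indicE ifT; last by move: u2; rewrite ltr_norml => /andP[]; lra.
    by rewrite mulr1; have := fM u; lra.
  apply: le_trans (log_moment_pointwise (normc_ge0 _) (fM u) g01 al0 u2) _.
  by rewrite lerDr mulr_ge0 // itv_indicE; case: ifP.
apply: rintegrableD; last exact: rintegrableZ.
by apply: rintegrableZ; exact: rintegrable_itv.
Qed.

End fourier_regularity.

(** * Identities for the filter and the wavelet *)

Section low_pass_filter.
Context {R : realType}.
Local Notation mu := (@lebesgue_measure R).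
Local Notation rintegrable f := (mu.-integrable setT (EFin \o f)).

Definition vanishing (F : R -> R[i]) : Prop :=
  forall e : R, 0 < e -> exists A : R, forall y, A < `|y| -> normc (F y) < e.

Lemma vanishing_affine (F : R -> R[i]) (a b : R) : 0 < a -> vanishing F ->
  ccvg (fun K => F (a * K%:R + b)) 0.
Proof.
move=> a0 Finf; apply/ccvgP => e /Finf[A hA].
have [B hB] := normr_le_nat ((`|A| + `|b|) / a).
exists B.+1 => n Bn; rewrite subr0; apply: hA.
have Bn' : B.+1%:R <= n%:R :> R by rewrite ler_nat.
rewrite -natr1 in Bn'; have := ler_norm A; have := ler_norm b; have := ler_norm (- b).
have := le_trans (ler_norm _) hB; rewrite ler_pdivrMr // normrN => h1 h2 h3 h4.
have h5 : a * (B%:R + 1) <= a * n%:R by rewrite ler_pM2l.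
by rewrite (lt_le_trans _ (ler_norm _)) //; lra.
Qed.

Lemma vanishing_at_infty (F : R -> R[i]) :
  normc (F u) @[u --> +oo] --> (0 : R) -> normc (F u) @[u --> -oo] --> (0 : R) ->
  vanishing F.
Proof.
move=> h1 h2 e e0.
move/cvgrPdist_lt : h1 => /(_ e e0)[A [_ hA]].
move/cvgrPdist_lt : h2 => /(_ e e0)[B [_ hB]].
exists (Num.max A (- B)) => y; rewrite gt_max => /andP[yA yB].
have [y0|y0] := leP 0 y.
  rewrite ger0_norm // in yA; have := hA y yA; rewrite sub0r normrN; apply: le_lt_trans.
  exact: ler_norm.
rewrite ltr0_norm // ltrN2 in yB; have := hB y yB; rewrite sub0r normrN; apply: le_lt_trans.
exact: ler_norm.
Qed.

Variables (F m0 : R -> R[i]).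
Hypotheses (cF : ccontinuous F) (F0 : F 0 != 0) (Finf : vanishing F)
  (m0per : forall y, m0 (y + 2 * pi) = m0 y)
  (m0F : {ae mu, forall y, F y = m0 (y / 2) * F (y / 2)})
  (sumF : {ae mu, forall y, (\esum_(k in [set: int])
     ((normc (F (y + 2 * pi * k%:~R))) ^+ 2)%:E = 1)%E}).

Lemma filter_periodic y (k : int) : m0 (y + 2 * pi * k%:~R) = m0 y.
Proof.
have per (n : nat) t : m0 (t + 2 * pi * n%:R) = m0 t.
  elim: n => [|n IH]; first by rewrite mulr0 addr0.
  by rewrite -[n.+1]addn1 natrD mulrDr mulr1 addrA m0per.
case: k => k; first exact: per.
by rewrite -[in RHS](subrK (2 * pi * k.+1%:R) y) per NegzE rmorphN /= mulrN.
Qed.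

Lemma refinement_shift : {ae mu, forall u, forall k : int,
  F (2 * u + 2 * pi * k%:~R) = m0 (u + pi * k%:~R) * F (u + pi * k%:~R)}.
Proof.
apply: ae_int => k; have := ae_affine (2 * pi * k%:~R) (ltr0n R 2) m0F.
apply: ae_mono => u ->.
by rewrite (_ : (2 * u + 2 * pi * k%:~R) / 2 = u + pi * k%:~R) //; field.
Qed.

Lemma sumF_ccvg : {ae mu, forall y,
  ccvg (fun K => sym_sum K (fun l => (normc (F (y + 2 * pi * l%:~R)) ^+ 2)%:C)) 1}.
Proof.
apply: ae_mono sumF => y hy.
by apply: esum_sym_sum => // l; exact: sqr_ge0.
Qed.

(** Split the sum of [|F (2 u + 2 pi l)|^2], which is 1, by the parity of [l]. The refinement
    equation and the period of [m0] take [|m0 u|^2] out of the even part and [|m0 (u + pi)|^2] out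
    of the odd part; what remains in each part sums to 1. *)
Lemma quadrature_mirror : {ae mu, forall u, normc (m0 u) ^+ 2 + normc (m0 (u + pi)) ^+ 2 = 1}.
Proof.
have h2 := ae_affine 0 (ltr0n R 2) sumF_ccvg.
have h3 := ae_shift pi sumF_ccvg.
apply: ae_mono (ae_and refinement_shift (ae_and sumF_ccvg (ae_and h2 h3))) => u [hA [hC [hB hD]]].
have {}hB : ccvg (fun K => sym_sum K.*2 (fun l => (normc (F (2 * u + 2 * pi * l%:~R)) ^+ 2)%:C)) 1.
  apply/ccvgP => e e0; have [N hN] := (ccvgP _ _).1 hB e e0.
  by exists N => n Nn; have := hN n.*2 ltac:(lia); rewrite addr0.
have aE l : (normc (F (2 * u + 2 * pi * (2 * l)%:~R)) ^+ 2)%:C =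
    (normc (m0 u) ^+ 2)%:C * (normc (F (u + 2 * pi * l%:~R)) ^+ 2)%:C.
  rewrite hA -realcM -exprMn -Normc.normcM intrM.
  by rewrite (_ : pi * (2%:~R * l%:~R) = 2 * pi * l%:~R) ?filter_periodic //; ring.
have aO l : (normc (F (2 * u + 2 * pi * (2 * l + 1)%:~R)) ^+ 2)%:C =
    (normc (m0 (u + pi)) ^+ 2)%:C * (normc (F (u + pi + 2 * pi * l%:~R)) ^+ 2)%:C.
  rewrite hA -realcM -exprMn -Normc.normcM intrD intrM.
  by rewrite (_ : u + pi * (2%:~R * l%:~R + 1%:~R) = u + pi + 2 * pi * l%:~R) ?filter_periodic //; ring.
have SE K : sym_sum K.*2 (fun l => (normc (F (2 * u + 2 * pi * l%:~R)) ^+ 2)%:C) =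
    (normc (m0 u) ^+ 2)%:C * sym_sum K (fun l => (normc (F (u + 2 * pi * l%:~R)) ^+ 2)%:C) +
    (normc (m0 (u + pi)) ^+ 2)%:C * sym_sum K (fun l => (normc (F (u + pi + 2 * pi * l%:~R)) ^+ 2)%:C) +
    - (normc (m0 (u + pi)) ^+ 2)%:C * (normc (F (u + pi + 2 * pi * K%:Z%:~R)) ^+ 2)%:C.
  rewrite sym_sum_double (eq_sym_sum _ aE) (eq_sym_sum _ aO) aO -!sym_sumM mulNr.
  by [].
(* The surplus odd index left by [sym_sum_double] runs off to infinity, where [F] vanishes. *)
have last0 : ccvg (fun K => (normc (F (u + pi + 2 * pi * K%:Z%:~R)) ^+ 2)%:C) 0.
  have p0 : 0 < 2 * pi :> R by rewrite mulr_gt0 // pi_gt0.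
  have := vanishing_affine (u + pi) p0 Finf => h.
  have := ccvgM h (ccvg_conj h); rewrite mul0r; apply: eq_ccvg => K.
  by rewrite mul_conjc addrC.
have := ccvg_unique hB (eq_ccvg (fun K => esym (SE K))
  (ccvgD (ccvgD (ccvgMl _ hC) (ccvgMl _ hD)) (ccvgMl _ last0))).
by rewrite !mulr1 mulr0 addr0 -realcD => -[].
Qed.

Lemma filter_le1 : {ae mu, forall u, normc (m0 u) <= 1}.
Proof.
apply: ae_mono quadrature_mirror => u h.
rewrite -(@ler_pXn2r _ 2) ?nnegrE ?normc_ge0 // expr1n -h lerDl; exact: sqr_ge0.
Qed.

(* Comparing [F (2 d)] with [F (2 d + 4 pi l)] through the common factor
   [m0 d] gives [F (4 pi l) = F (2 pi l)]; iterate towards infinity. *)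
Lemma low_pass_zeros (l : int) : l != 0 -> F (2 * pi * l%:~R) = 0.
Proof.
have dbl (k : int) : F (2 * pi * (2 * k)%:~R) = F (2 * pi * k%:~R).
  pose f1 d := F (2 * d + 4 * pi * k%:~R) * F (1 * d + 0).
  pose f2 d := F (2 * d + 0) * F (1 * d + 2 * pi * k%:~R).
  have cf (a b : R) : ccontinuous (fun d => F (a * d + b)).
    by apply: (ccontinuous_comp _ cF); exact: continuous_affine.
  have /(_ 0) : f1 =1 f2.
    apply: ae_eq_ccontinuous; [exact: ccontinuousM|exact: ccontinuousM|].
    apply: ae_mono refinement_shift => d h; rewrite /f1 /f2 !mul1r !addr0.
    have := h 0; rewrite !mulr0 !addr0 => ->.
    have := h (2 * k); rewrite intrM.
    rewrite (_ : pi * (2%:~R * k%:~R) = 2 * pi * k%:~R); last by ring.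
    rewrite (_ : 2 * pi * (2%:~R * k%:~R) = 4 * pi * k%:~R); last by ring.
    by rewrite filter_periodic => ->; ring.
  rewrite /f1 /f2 !mulr0 !addr0 !add0r mulrC => /(mulfI F0) <-.
  by rewrite intrM; congr F; ring.
move=> l0; have it n : F (2 * pi * (2 ^+ n * l)%:~R) = F (2 * pi * l%:~R).
  elim: n => [|n IH]; first by rewrite expr0 mul1r.
  by rewrite exprS -[2 * _ * l]mulrA dbl.
apply: Normc.eq0_normc; apply/eqP; rewrite eq_le normc_ge0 andbT.
apply/ler_addgt0Pr => e /Finf[A hA]; rewrite add0r.
have [B hB] := normr_le_nat A.
rewrite -(it B); apply: ltW; apply: hA.
have l1 : 1 <= `|l%:~R| :> R by rewrite -intr_norm ler1z -gtz0_ge1 normr_gt0.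
have p1 : 1 <= 2 * pi :> R by have := pi_ge2 R; lra.
rewrite !normrM intrM normrM (ger0_norm (x := pi)) ?pi_ge0 //.
rewrite (ger0_norm (x := 2)) //.
rewrite rmorphXn /= normrX (ger0_norm (x := 2%:~R)) //.
have B2 : B%:R < 2%:~R ^+ B :> R by rewrite -natrX ltr_nat ltn_expl.
have h1 : 1 * B%:R < (2 * pi) * 2%:~R ^+ B :> R.
  by apply: (@lt_le_trans _ _ (1 * 2%:~R ^+ B)); [rewrite ltr_pM2l|rewrite ler_wpM2r // exprn_ge0].
have h2 : 0 <= 2 * pi * 2%:~R ^+ B :> R by rewrite mulr_ge0 ?exprn_ge0 //; lra.
rewrite mulrA (lt_le_trans _ (ler_peMr h2 l1)) //.
by have := ler_norm A; lra.
Qed.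

(* Near 0 the terms [k <> 0] of the sum [\sum_k |F (y + 2 pi k)|^2 = 1] are
   dominated by a convergent series, and they tend to [|F (2 pi k)|^2 = 0]. *)
Lemma low_pass_norm1 (L : R) : 0 < L -> (forall x y, normc (F y - F x) <= L * `|y - x|) ->
  (forall x, normc (F x) <= L) -> cintegrable mu F -> normc (F 0) = 1.
Proof.
move=> L0 FL FM iF.
have iFn := cintegrable_normc iF.
have mF : measurable_fun setT (fun x => normc (F x)).
  exact: (measurable_normc (cmeasurable_continuous cF)).
have p2 := pi_ge2 R.
(* This affine map sends the interval from [v + 2 pi l] to [v + 2 pi l + 1], for any [|v| <= 1 / 2],
   into the [l]-th cell of the unit partition. The windows [J l] are thus disjoint pieces of [|F|]
   that do not depend on [v], and the sum of the [b l] is at most [4 * L] times the integral of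
   [|F|]. *)
pose w (x : R) := - (2 * pi)^-1 * x + 3 / (4 * pi).
pose J (l : int) x := unit_indic (w x + l%:~R) * normc (F x).
have mUw (l : int) : measurable_fun setT (fun x => unit_indic (w x + l%:~R)).
  apply: (measurableT_comp measurable_unit); apply: measurable_funD => //.
  by apply: measurable_funD => //; exact: measurable_funM.
have U01 (x : R) : 0 <= unit_indic x <= 1 by rewrite unit_indicE; case: ifP; rewrite ?lexx ler01.
have iJ l : rintegrable (J l).
  apply: (@le_rintegrable _ _ _ mu _ (fun x => normc (F x))) => //.
    exact: (measurable_funM (mUw l) mF).
  move=> x; have /andP[u0 u1] := U01 (w x + l%:~R).
  by rewrite normrM !ger0_norm ?normc_ge0 // ler_piMl ?normc_ge0.
pose b l := 4 * L * Rintegral mu setT (J l).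
have J0 l x : 0 <= J l x by have /andP[u0 _] := U01 (w x + l%:~R); rewrite mulr_ge0 ?normc_ge0.
have b0 l : 0 <= b l by apply: mulr_ge0; [rewrite mulr_ge0 // ltW|apply: Rintegral_ge0 => x _; exact: J0].
have Fb (v : R) (l : int) : `|v| <= 1 / 2 -> normc (F (v + 2 * pi * l%:~R)) ^+ 2 <= b l.
  rewrite ler_norml => /andP[v1 v2].
  apply: le_trans (lipschitz_integral _ L0 FL FM iF) _.
  rewrite ler_pM2l ?mulr_gt0 //; apply: le_Rintegral => //.
  - exact: rintegrable_itvM.
  - exact: (iJ l).
  move=> x _; rewrite itv_indicE; case: ifP => [/andP[x1 x2]|_]; last by rewrite mul0r; exact: (J0 l x).
  rewrite mul1r /J unit_indicE ifT ?mul1r //.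
  have -> : w x + l%:~R = (3 / 2 + 2 * pi * l%:~R - x) / (2 * pi) by rewrite /w; field; lra.
  rewrite ler_pdivlMr ?ltr_pdivrMr; lra.
pose e (i : nat) : R := if i is j.+1 then b j.+1%:Z + b (- j.+1%:Z) else b 0.
have SE K : sym_sum K (fun l => (b l)%:C) = (\sum_(0 <= i < K.+1) e i)%:C.
  rewrite sym_sum_pair [in RHS]big_nat_recl // realcD realc_sum; congr (_ + _).
  by rewrite big_add1; apply: eq_bigr => i _; rewrite -realcD.
have e0 i : 0 <= e i by case: i => [|i] /=; rewrite ?addr_ge0.
pose S n := \sum_(0 <= i < n) e i.
have Sd : {homo S : n m / (n <= m)%N >-> n <= m}.
  move=> n m nm; rewrite /S (big_cat_nat (n := n) (p := m)) //= lerDl.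
  exact: sumr_ge0.
have Sb : has_ubound (range S).
  exists (4 * L * Rintegral mu setT (fun x => normc (F x))) => _ [N _ <-].
  apply: (@le_trans _ _ (S N.+1)); first exact: Sd.
  have -> : S N.+1 = 4 * L * Rintegral mu setT (fun x => \sum_(i < N.*2.+1) J (i%:Z - N%:Z) x).
    rewrite Rintegral_sum // mulr_sumr; have := SE N; rewrite -/(S _) /sym_sum -realc_sum.
    by case.
  rewrite ler_pM2l ?mulr_gt0 //; apply: le_Rintegral => //.
    have -> : (EFin \o (fun x => \sum_(i < N.*2.+1) J (i%:Z - N%:Z) x)) =
        (fun x => \sum_(i < N.*2.+1) (J (i%:Z - N%:Z) x)%:E)%E.
      by apply/funext => x /=; rewrite sumEFin.
    by apply: integrable_sum => // i _; exact: iJ.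
  move=> x _; rewrite -mulr_suml ler_piMl ?normc_ge0 //.
  have [_ /(_ N)] := unit_indic_sum (w x); rewrite /sym_sum -realc_sum normc_real.
  exact: le_trans (ler_norm _).
have cS := nondecreasing_is_cvgn Sd Sb.
have key (eta : R) : 0 < eta -> `|1 - normc (F 0) ^+ 2| <= eta.
  move=> eta0.
  have [K hK] : exists K, forall n, (K <= n)%N -> S n.+1 - S K.+1 <= eta.
    have /cvgrPdist_lt/(_ eta eta0)[N _ hN] := cS.
    exists N => n Nn; have := hN N.+1 ltac:(rewrite /=; lia).
    have := nondecreasing_cvgn_le Sd cS n.+1; have := ler_norm (limn S - S N.+1); lra.
  (* A finite sum, hence continuous, with value [|F 0|^2] at 0 by [low_pass_zeros]. It is evaluated
     at a small [v] where the full sum is 1 and the tail is at most [eta]. *)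
  pose T (v : R) := sym_sum K (fun l => (normc (F (v + 2 * pi * l%:~R)) ^+ 2)%:C).
  have cT : ccontinuous T.
    apply: ccontinuous_sum => i.
    under eq_fun do rewrite -mul_conjc.
    have cc : ccontinuous (fun v => F (v + 2 * pi * (i%:Z - K%:Z)%:~R)).
      under eq_fun do rewrite -[X in X + _]mul1r.
      by apply: (ccontinuous_comp _ cF); exact: continuous_affine.
    exact: (ccontinuousM cc (ccontinuous_conj cc)).
  have T0 : T 0 = (normc (F 0) ^+ 2)%:C.
    have TE l : (normc (F (0 + 2 * pi * l%:~R)) ^+ 2)%:C =
        if l == 0 then (normc (F 0) ^+ 2)%:C else 0.
      rewrite add0r; case: eqVneq => [->|l0]; first by rewrite mulr0.
      by rewrite low_pass_zeros // Normc.normc0 expr0n.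
    by rewrite /T (eq_sym_sum _ TE) sym_sum_indic.
  apply/ler_addgt0Pr => r r0.
  have [dl dl0 hd] := (ccontinuous_atP _ _).1 (cT 0) r r0.
  have m0' : 0 < Num.min dl (1 / 2) by rewrite lt_min dl0; lra.
  have [v [hv /andP[v1 v2]]] := ae_dense 0 sumF_ccvg m0'.
  rewrite add0r lt_min in v2; case/andP: v2 => v2 v3.
  have vn : `|v| <= 1 / 2 by rewrite ger0_norm ltW.
  have h1 : normc (1 - T v) <= eta.
    apply: (ccvg_le_dist (N := K) hv) => n Kn; rewrite /T sym_sum_diff //.
    apply: le_trans (hK n Kn).
    rewrite /S [X in X - _](big_cat_nat (n := K.+1)) //= addrAC subrr add0r.
    rewrite (le_trans (normc_sum _ _ _)) //; apply: ler_sum_nat => i /andP[i1 _].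
    rewrite -realcD normc_real ger0_norm ?addr_ge0 ?sqr_ge0 //.
    by case: i i1 => // i _; apply: lerD; exact: Fb.
  have h2 : normc (T v - T 0) < r by apply: hd; rewrite subr0 gtr0_norm.
  rewrite -normc_real (_ : (1 - _)%:C = (1 - T v) + (T v - T 0)); last first.
    by rewrite T0 addrA subrK; apply: complex_ext; rewrite /= ?subr0.
  by rewrite (le_trans (normcD _ _)) // lerD // ltW.
have : `|1 - normc (F 0) ^+ 2| <= 0 by apply/ler_addgt0Pr => r /key; rewrite add0r.
rewrite normr_le0 subr_eq0 eq_sym sqrf_eq1 => /orP[/eqP//|/eqP h].
by have := normc_ge0 (F 0); lra.
Qed.

End low_pass_filter.

Section mother_wavelet.
Context {R : realType}.
Local Notation mu := (@lebesgue_measure R).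
Local Notation rintegrable f := (mu.-integrable setT (EFin \o f)).

(* For [G] that is only known a.e., inversion holds where [G] agrees a.e. with
   a quotient of continuous functions. *)
Lemma fourier_inversion_quotient (G D N : R -> R[i]) (B : R) : 0 <= B ->
  cintegrable mu G -> cintegrable mu (fourier G) ->
  {ae mu, forall v, normc (G v) <= B} -> ccontinuous D -> ccontinuous N ->
  {ae mu, forall v, G v * D v = N v} ->
  {ae mu, forall y, D y != 0 -> inv_fourier (fourier G) y = G y}.
Proof.
move=> B0 iG iFG GB cD cN GDN; apply: ae_mono (GDN) => y GDy Dy.
have nD : 0 < normc (D y).
  rewrite lt_neqAle normc_ge0 andbT eq_sym; apply: contra_neq Dy; exact: Normc.eq0_normc.
apply: fourier_inversion => // eta eta0.
pose r := eta * normc (D y) / (B + 1).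
have r0 : 0 < r by rewrite divr_gt0 ?mulr_gt0 //; lra.
have [d1 d10 hD] := (ccontinuous_atP _ _).1 (cD y) r r0.
have [d2 d20 hN] := (ccontinuous_atP _ _).1 (cN y) r r0.
exists (Num.min d1 d2); first by rewrite lt_min d10.
apply: ae_mono (ae_and GDN GB) => v [GDv GBv]; rewrite lt_min => /andP[v1 v2].
rewrite -(ler_pM2r nD) -Normc.normcM.
have -> : (G v - G y) * D y = G v * (D y - D v) + (N v - N y) by rewrite -GDv -GDy; ring.
rewrite (le_trans (normcD _ _)) // Normc.normcM.
have h1 : normc (G v) * normc (D y - D v) <= B * r.
  by apply: ler_pM; rewrite ?normc_ge0 // normc_distC ltW // hD.
have h2 := hN v v2.
have -> : eta * normc (D y) = B * r + r by rewrite /r; field; lra.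
by rewrite lerD // ltW.
Qed.

Variables (F m0 psi : R -> R[i]) (M : R).
Hypotheses (cF : ccontinuous F) (iF : cintegrable mu F)
  (FM : forall y, normc (F y) <= M) (Finf : vanishing F)
  (F0 : F 0 != 0) (m0meas : cmeasurable m0)
  (m0per : forall y, m0 (y + 2 * pi) = m0 y)
  (m0F : {ae mu, forall y, F y = m0 (y / 2) * F (y / 2)})
  (sumF : {ae mu, forall y, (\esum_(k in [set: int])
     ((normc (F (y + 2 * pi * k%:~R))) ^+ 2)%:E = 1)%E})
  (cpsi : ccontinuous psi) (ipsi : cintegrable mu psi)
  (psiE : {ae mu, forall x, psi x = inv_fourier (fun y =>
       conjc (m0 (y / 2 + pi)) * cis (- (y / 2)) * F (y / 2)) x}).

(* [m0] is not continuous, but [m0 (v + 2 pi l) F (v + 2 pi l) = F (2 v + 4 pi l)]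
   and for a.e. [v] some [F (v + 2 pi l)] is nonzero. *)
Lemma fourier_mother : {ae mu, forall y,
  fourier psi y = conjc (m0 (y / 2 + pi)) * cis (- (y / 2)) * F (y / 2)}.
Proof.
(* [K] is the conjugate of the claimed transform. The definition of [psi] as an inverse transform
   then says that the forward transform of [K] is [2 pi * conjc psi], which is continuous and
   integrable, so [K] can be recovered by inversion. *)
pose K y := m0 (2^-1 * y + pi) * (cis (2^-1 * y) * conjc (F (2^-1 * y + 0))).
have half (y : R) : y / 2 = 2^-1 * y by rewrite mulrC.
have KE y : conjc (m0 (y / 2 + pi)) * cis (- (y / 2)) * F (y / 2) = conjc (K y).
  by rewrite /K !conjcM conj_cis conjcK addr0 half mulrA.
have h0 : 0 < 2^-1 :> R by rewrite invr_gt0.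
have M0 : 0 <= M := le_trans (normc_ge0 _) (FM 0).
have iF2 := cintegrable_affine 0 h0 iF.
have m1 : {ae mu, forall v, normc (m0 (2^-1 * v + pi)) <= 1}.
  have := filter_le1 F0 Finf m0per m0F sumF => /(ae_affine pi h0).
  exact: ae_mono.
have KF : {ae mu, forall v, normc (K v) <= normc (F (2^-1 * v + 0))}.
  apply: ae_mono m1 => v h; rewrite /K !Normc.normcM normc_cis normc_conj mul1r.
  by rewrite ler_piMl // normc_ge0.
have mK : cmeasurable K.
  apply: cmeasurableM; first by apply: (cmeasurable_comp m0meas); exact: measurable_affine.
  apply: cmeasurableM; first exact: cmeasurable_cisZ.
  exact: (cmeasurable_conj (cintegrable_meas iF2)).
have iK : cintegrable mu K.
  apply: (@le_cintegrable _ _ _ mu _ (fun v => normc (F (2^-1 * v + 0)))) => //.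
  exact: (cintegrable_normc iF2).
have fK : fourier K =1 (fun x => (2 * pi)%:C * conjc (psi x)).
  apply: ae_eq_ccontinuous; first exact: fourier_ccontinuous.
    by apply: ccontinuousM; [exact: ccontinuous_cst|exact: ccontinuous_conj].
  apply: ae_mono psiE => x ->; rewrite /inv_fourier conjcM.
  rewrite (_ : conjc _ = ((2 * pi)^-1)%:C); last by apply: complex_ext; rewrite //= oppr0.
  rewrite mulrA -realcM divff ?mul1r; last by rewrite mulf_neq0 // gt_eqF // pi_gt0.
  rewrite -cintegral_conj.
    by apply: eq_cintegral => y; rewrite KE conjcM conjcK conj_cis (mulrC x).
  under eq_fun do rewrite KE mulrC.
  have := cintegrable_cis x (cintegrable_conj iK).
  by congr (cintegrable mu _); apply/funext => y; rewrite mulrC (mulrC x).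
have iFK : cintegrable mu (fourier K).
  by rewrite (funext fK); apply: cintegrableZ; exact: cintegrable_conj.
have invK y : inv_fourier (fourier K) y = conjc (fourier psi y).
  rewrite (funext fK) /inv_fourier /fourier -cintegral_conj; last exact: cintegrable_fourier.
  rewrite -cintegralZ.
    apply: eq_cintegral => x; rewrite conjcM conj_cis opprK (mulrC y x).
    rewrite mulrCA; congr (_ * _); rewrite mulrA -realcM mulVf ?mul1r //.
    by rewrite mulf_neq0 // gt_eqF // pi_gt0.
  have := cintegrable_cis y (cintegrableZ (2 * pi)%:C (cintegrable_conj ipsi)).
  by congr (cintegrable mu _); apply/funext => x; rewrite [y * x]mulrC.
pose D (l : int) v := F (2^-1 * v + (pi + 2 * pi * l%:~R)).
pose N (l : int) v := F (1 * v + (2 * pi + 4 * pi * l%:~R)) * (cis (2^-1 * v) * conjc (F (2^-1 * v + 0))).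
have cFa (a b : R) : ccontinuous (fun d => F (a * d + b)).
  by apply: (ccontinuous_comp _ cF); exact: continuous_affine.
have KDN (l : int) : {ae mu, forall v, K v * D l v = N l v}.
  have := ae_affine pi h0 (refinement_shift m0F).
  apply: ae_mono => v /(_ (2 * l)); rewrite intrM.
  rewrite (_ : pi * (2%:~R * l%:~R) = 2 * pi * l%:~R); last by ring.
  rewrite (filter_periodic m0per) -addrA.
  rewrite /K /D /N (_ : 2 * (2^-1 * v + pi) + 2 * pi * (2%:~R * l%:~R) = 1 * v + (2 * pi + 4 * pi * l%:~R)); last by field.
  by move=> ->; ring.
have inv (l : int) : {ae mu, forall y, D l y != 0 -> inv_fourier (fourier K) y = K y}.
  apply: (@fourier_inversion_quotient _ _ (N l) M) => //.
    by apply: ae_mono KF => v h; exact: le_trans h (FM _).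
    exact: cFa.
  apply: ccontinuousM => //; apply: ccontinuousM; first exact: ccontinuous_cisZ.
  exact: ccontinuous_conj.
have h3 := ae_affine pi h0 (sumF_ccvg sumF).
apply: ae_mono (ae_and h3 (ae_int inv)) => y [hs hl].
have [l Dl] : exists l, D l y != 0.
  apply: contrapT => /forallNP h; have /eqP := oner_neq0 R[i]; apply.
  apply: (ccvg_unique hs); apply: (eq_ccvg _ (ccvg_cst 0)) => n.
  rewrite /sym_sum big1 // => i _.
  have := h (i%:Z - n%:Z); rewrite /D addrA => /negP; rewrite negbK => /eqP ->.
  by rewrite Normc.normc0 expr0n.
by rewrite KE -(hl l Dl) invK conjcK.
Qed.

End mother_wavelet.

(** * Telescoping over the scales at a fixed frequency *)

Section fourier_coefficients.
Context {R : realType}.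
Local Notation mu := (@lebesgue_measure R).
Local Notation rintegrable f := (mu.-integrable setT (EFin \o f)).

(** Doubling the variable gives an integral over an interval of length 2, whose second half equals
    the first times [cis (- (pi * l))]. The resulting factor vanishes for odd [l]. *)
Lemma fcoef_double (f : R -> R[i]) (M : R) (l : int) : cmeasurable f ->
  (forall x, normc (f x) <= M) -> (forall x, f (x + 1) = f x) ->
  fcoef (fun x => f (2 * x)) l = 2^-1%:C * (1 + cis (- (pi * l%:~R))) *
    cintegral mu (fun x => (unit_indic x)%:C * (f x * cis (- (pi * l%:~R) * x))).
Proof.
move=> mf fM fper; set c := - (pi * l%:~R).
pose g x := (unit_indic x)%:C * (f x * cis (c * x)).
have ig : cintegrable mu g.
  apply: (@cintegrable_unit _ _ M); first by apply: cmeasurableM => //; exact: cmeasurable_cisZ.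
  by move=> x; rewrite Normc.normcM normc_cis mulr1.
have ig' : cintegrable mu (fun x => cis c * g (x + -1)).
  by apply: cintegrableZ; exact: cintegrable_shift.
have h0 : 0 < 2 :> R by [].
transitivity (cintegral mu (fun x => g (2 * x + 0) + cis c * g (2 * x + 0 + -1))).
  apply: eq_cintegral => x; rewrite /g addr0 !unit_indicE.
  have -> : f (2 * x + -1) = f (2 * x) by rewrite -[2 * x in RHS](subrK 1) fper.
  have -> : cis (- (2 * pi * l%:~R * x)) = cis (c * (2 * x)) :> R[i] by rewrite /c; congr cis; ring.
  have -> : cis (c * (2 * x + -1)) = cis (- c) * cis (c * (2 * x)) by rewrite -cisD; congr cis; ring.
  have e := cisN c.
  case: ifPn => h1; case: ifPn => h2; case: ifPn => h3; try (exfalso; lra).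
  - by rewrite mul0r mulr0 addr0.
  - rewrite mul0r add0r (_ : cis c * _ = 1%:C * (f (2 * x) * (cis c * cis (- c) * cis (c * (2 * x))))).
      by rewrite e mul1r.
    by ring.
  - by rewrite !mul0r mulr0 addr0.
rewrite (cintegral_affine 0 (f := fun x => g x + cis c * g (x + -1))) //; last exact: cintegrableD.
rewrite cintegralD // cintegralZ; last exact: cintegrable_shift.
by rewrite cintegral_shift // mulrDr -mulrA mulrDl mul1r -mulrDr.
Qed.

(** Orthogonality without primitives: a constant is unchanged by doubling the variable, so
    [fcoef_double] makes its odd coefficients vanish and reduces the coefficient at [2 m] to that at
    [m]. The induction is on a bound for [|l|]. *)
Lemma fcoef_cst (c : R[i]) (l : int) : fcoef (fun=> c) l = if l == 0 then c else 0.
Proof.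
have m1 : cmeasurable (fun _ : R => 1 : R[i]) by exact: cmeasurable_cst.
have n1 (x : R) : normc (1 : R[i]) <= 1 by rewrite Normc.normc1.
transitivity (fcoef (fun=> c * 1 : R[i]) l); first by rewrite mulr1.
rewrite (fcoefZ c l m1 n1).
suff -> : fcoef (fun=> 1 : R[i]) l = (l == 0)%:R by case: eqP => _; rewrite ?mulr1 ?mulr0.
have dbl := fcoef_double _ m1 n1 (fun=> erefl).
have [n ln] : exists n : nat, (`|l| <= n)%N by exists `|l|%N.
elim: n l ln => [|n IH] l ln.
  have -> : l = 0 by lia.
  transitivity (cintegral mu (fun x => (unit_indic x)%:C : R[i])).
    by apply: eq_cintegral => x; rewrite mulr0 mul0r oppr0 cis0 !mulr1.
  by rewrite cintegral_real (Rintegral_itv ler01) subr0 eqxx.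
have [->|l0] := eqVneq l 0; first by rewrite IH.
have [m lE] : exists m : int, l = 2 * m \/ l = 2 * m + 1.
  by exists (l %/ 2)%Z; lia.
rewrite dbl; case: lE => lE.
  have -> : cis (- (pi * l%:~R)) = 1 :> R[i].
    by rewrite -conj_cis lE intrM (_ : pi * _ = 2 * pi * m%:~R) ?cis_int_2pi ?conjc1 //; ring.
  have -> : cintegral mu (fun x : R => (unit_indic x)%:C * (1 * cis (- (pi * l%:~R) * x))) = fcoef (fun=> 1) m.
    by apply: eq_cintegral => x; rewrite lE intrM; congr (_ * (_ * cis _)); ring.
  rewrite IH; last lia.
  by rewrite (_ : (m == 0) = false) ?mulr0 //; apply/eqP; lia.
have -> : cis (- (pi * l%:~R)) = -1 :> R[i].
  rewrite -conj_cis lE intrD intrM (_ : pi * _ = 2 * pi * m%:~R + pi); last by ring.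
  by rewrite cisD cis_int_2pi cis_pi mul1r; apply: complex_ext; rewrite /= ?oppr0.
by rewrite subrr mulr0 mul0r.
Qed.

End fourier_coefficients.

Section modulation.
Context {R : realType}.
Local Notation mu := (@lebesgue_measure R).

Definition modulate (y : R) (g : R -> R[i]) (x : R) : R[i] := cis (- y * x) * g x.

Lemma modulate_continuous y g : ccontinuous g -> ccontinuous (modulate y g).
Proof. by move=> cg; apply: ccontinuousM => //; exact: ccontinuous_cisZ. Qed.

Lemma normc_modulate y g x : normc (modulate y g x) = normc (g x).
Proof. by rewrite Normc.normcM normc_cis mul1r. Qed.

Lemma modulate_envelope y g s tau : envelope g s tau -> envelope (modulate y g) s tau.
Proof. by case=> ? ? ? ? h; split => // x i xi; rewrite normc_modulate h. Qed.

Lemma modulate_cintegrable y g : cintegrable mu g -> cintegrable mu (modulate y g).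
Proof. exact: cintegrable_cis. Qed.

Lemma fcoef_periodize_modulate y g s tau l : ccontinuous g -> envelope g s tau ->
  cintegrable mu g -> fcoef (periodize (modulate y g)) l = fourier g (y + 2 * pi * l%:~R).
Proof.
move=> cg eg ig.
rewrite (fcoef_periodize (modulate_continuous y cg) (modulate_envelope y eg)) //; last first.
  exact: modulate_cintegrable.
apply: eq_cintegral => x; rewrite /modulate mulrAC -cisD; congr (cis _ * _); ring.
Qed.

Lemma sym_sum_index_le K (i : 'I_K.*2.+1) : `|i%:Z - K%:Z| <= K%:Z.
Proof. by case: i => j /= hj; lia. Qed.

(** Continuity in the frequency at 0, uniformly in [x]; uniformity matters because [x] will be
    [2^n t] with [n] growing. By periodicity [x] may be taken in the unit interval, where finitely
    many terms matter and each phase moves by at most [(K + 2) |y|]. *)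
Lemma periodize_modulate_near0 g s tau (e : R) : ccontinuous g -> envelope g s tau -> 0 < e ->
  exists2 delta : R, 0 < delta & forall y x : R, `|y| < delta ->
    normc (periodize (modulate y g) x - periodize (modulate 0 g) x) < e.
Proof.
move=> cg eg e0; have eyg y := modulate_envelope y eg.
have s0 : 0 <= s 0%N by case: (eg).
have [N hN] := tau_small eg (ltac:(lra) : 0 < e / 8).
pose K := N.+1.
have tK : tau (K.+1 - 1)%N < e / 8 by apply: hN; rewrite /K; lia.
pose n := K.*2.+1.
(* With [n] terms bounded by [s 0], phases within [r] of 1 change the finite sum by at most [e / 4];
   the summand 1 keeps the denominator positive. *)
pose r := e / (4 * n%:R * (s 0%N + 1)).
have n0 : 0 < n%:R :> R by rewrite ltr0n.
have r0 : 0 < r by rewrite divr_gt0 // mulr_gt0 ?mulr_gt0 //; lra.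
have [d d0 hd] := (ccontinuous_atP _ _).1 (@ccontinuous_cis R 0) r r0.
have K2 : 0 < K%:R + 2 :> R by rewrite ltr_wpDl.
exists (d / (K%:R + 2)); first by rewrite divr_gt0.
move=> y x; rewrite ltr_pdivlMr // => yd.
have /andP[x1 x2] := floor_itv x; rewrite intrD in x2.
have perE z : periodize (modulate z g) x = periodize (modulate z g) (x - (Num.floor x)%:~R).
  by rewrite -{1}(subrK (Num.floor x)%:~R x) (periodize_periodicz (eyg z)).
rewrite !perE; set w := x - _; have w1 : `|w| <= 1%:R by rewrite ler_norml /w; lra.
have h1 := periodize_tail (eyg y) w1 (ltac:(by rewrite /K) : (1 <= K)%N).
have h2 := periodize_tail (eyg 0) w1 (ltac:(by rewrite /K) : (1 <= K)%N).
set S1 := sym_sum _ _ in h1; set S2 := sym_sum _ _ in h2.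
have h3 : normc (S1 - S2) <= e / 4.
  rewrite /S1 /S2 /sym_sum -sumrB (le_trans (normc_sum _ _ _)) //.
  apply: (@le_trans _ _ (\sum_(i < K.*2.+1) r * s 0%N)).
    apply: ler_sum => i _; rewrite /modulate -mulrBl Normc.normcM.
    apply: ler_pM; rewrite ?normc_ge0 //; last first.
      by have [_ _ _ _ h] := eg; apply: h; rewrite normr_ge0.
    rewrite oppr0 mul0r ltW // hd // subr0 normrM normrN.
    apply: le_lt_trans yd; rewrite ler_wpM2l ?normr_ge0 //.
    rewrite (le_trans (ler_normB _ _)) // addrC; apply: lerD; last by rewrite (le_trans w1) // ler1n.
    have iK : (`|i%:Z - K%:Z| <= K%:Z)%R by exact: sym_sum_index_le.
    by rewrite -intr_norm -[K%:R]/(K%:Z%:~R) ler_int.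
  rewrite sumr_const card_ord -[leLHS]mulr_natl -/n.
  have -> : n%:R * (r * s 0%N) = e / 4 * (s 0%N / (s 0%N + 1)) by rewrite /r; field; rewrite gt_eqF //=; lra.
  by rewrite ler_piMr //; [lra|rewrite ler_pdivrMr; lra].
rewrite (_ : _ - _ = (periodize (modulate y g) w - S1) + (S1 - S2) - (periodize (modulate 0 g) w - S2)); last by ring.
have := normcB (periodize (modulate y g) w - S1 + (S1 - S2)) (periodize (modulate 0 g) w - S2).
have := normcD (periodize (modulate y g) w - S1) (S1 - S2).
lra.
Qed.

End modulation.

Section telescoping.
Context {R : realType}.
Local Notation mu := (@lebesgue_measure R).
Variables (phi psi m0 : R -> R[i]) (s1 tau1 s2 tau2 : nat -> R).
Hypotheses (cphi : ccontinuous phi) (cpsi : ccontinuous psi)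
  (ephi : envelope phi s1 tau1) (epsi : envelope psi s2 tau2)
  (iphi : cintegrable mu phi) (ipsi : cintegrable mu psi).

Lemma periodize_modulate_telescope (y t : R) :
  (forall k : int, fourier phi (y + 2 * pi * k%:~R) =
     m0 (y / 2 + pi * k%:~R) * fourier phi (y / 2 + pi * k%:~R)) ->
  (forall k : int, fourier psi (y + 2 * pi * k%:~R) =
     conjc (m0 ((y + 2 * pi * k%:~R) / 2 + pi)) *
     cis (- ((y + 2 * pi * k%:~R) / 2)) * fourier phi ((y + 2 * pi * k%:~R) / 2)) ->
  normc (m0 (y / 2)) ^+ 2 + normc (m0 (y / 2 + pi)) ^+ 2 = 1 ->
  (forall x, m0 (x + 2 * pi) = m0 x) ->
  conjc (fourier phi y) * periodize (modulate y phi) t +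
  conjc (fourier psi y) * periodize (modulate y psi) t =
  conjc (fourier phi (y / 2)) * periodize (modulate (y / 2) phi) (2 * t).
Proof.
move=> phiE psiE qmf m0per.
set a := conjc (fourier phi y); set b := conjc (fourier psi y); set c := conjc _.
pose p1 := periodize (modulate y phi); pose p2 := periodize (modulate y psi).
pose p3 := periodize (modulate (y / 2) phi).
have c1 : ccontinuous p1 by exact: (periodize_continuous (modulate_continuous y cphi) (modulate_envelope y ephi)).
have c2 : ccontinuous p2 by exact: (periodize_continuous (modulate_continuous y cpsi) (modulate_envelope y epsi)).
have c3 : ccontinuous p3 by exact: (periodize_continuous (modulate_continuous _ cphi) (modulate_envelope _ ephi)).
have c3' : ccontinuous (fun x => p3 (2 * x)).
  rewrite (_ : (fun x => _) = (fun x => p3 (2 * x + 0))); last by apply/funext => x; rewrite addr0.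
  by apply: (ccontinuous_comp _ c3); exact: continuous_affine.
have per1 x : p1 (x + 1) = p1 x := periodize_periodic (modulate_envelope y ephi) x.
have per2 x : p2 (x + 1) = p2 x := periodize_periodic (modulate_envelope y epsi) x.
have per3 x : p3 (x + 1) = p3 x := periodize_periodic (modulate_envelope _ ephi) x.
have b1 x : normc (p1 x) <= _ := periodize_bound (modulate_envelope y ephi) x.
have b2 x : normc (p2 x) <= _ := periodize_bound (modulate_envelope y epsi) x.
have b3 x : normc (p3 x) <= _ := periodize_bound (modulate_envelope _ ephi) x.
set B1 := 3 * s1 0 + 2 * tau1 0 in b1 b3; set B2 := 3 * s2 0 + 2 * tau2 0 in b2.
apply/eqP; rewrite -subr_eq0 -mulNr; apply/eqP.
have ab x : normc (a * p1 x + b * p2 x) <= normc a * B1 + normc b * B2.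
  by rewrite (le_trans (normcD _ _)) // !Normc.normcM lerD // ler_wpM2l // normc_ge0.
have cb x : normc (- c * p3 (2 * x)) <= normc c * B1.
  by rewrite Normc.normcM normcN ler_wpM2l // normc_ge0.
have B10 : 0 <= B1 := le_trans (normc_ge0 _) (b1 0).
have B20 : 0 <= B2 := le_trans (normc_ge0 _) (b2 0).
pose B := normc a * B1 + normc b * B2 + normc c * B1.
have [na nb nc] : [/\ 0 <= normc a * B1, 0 <= normc b * B2 & 0 <= normc c * B1].
  by rewrite !mulr_ge0 ?normc_ge0.
have cm (f : R -> R[i]) : ccontinuous f -> cmeasurable f := @cmeasurable_continuous R f.
have cc (z : R[i]) f : ccontinuous f -> ccontinuous (fun x : R => z * f x).
  by move=> cf; apply: ccontinuousM => //; exact: ccontinuous_cst.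
have cab : ccontinuous (fun x => a * p1 x + b * p2 x) by apply: ccontinuousD; exact: cc.
have ccc : ccontinuous (fun x => - c * p3 (2 * x)) by exact: cc.
apply: (@fourier_unique R (fun x => a * p1 x + b * p2 x + - c * p3 (2 * x)) B).
- exact: ccontinuousD.
- by move=> x; rewrite per1 per2 mulrDr mulr1 (_ : 2 * x + 2 = 2 * x + 1 + 1) ?per3 //; ring.
- by move=> x; rewrite (le_trans (normcD _ _)) // lerD.
move=> l.
rewrite (fcoefD (M := B) l (cm _ cab) (cm _ ccc)); last 2 first.
- by move=> x; rewrite (le_trans (ab x)) // /B; lra.
- by move=> x; rewrite (le_trans (cb x)) // /B; lra.
rewrite (fcoefD (M := B) l (cm _ (cc _ _ c1)) (cm _ (cc _ _ c2))); last 2 first.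
- by move=> x; rewrite Normc.normcM (@le_trans _ _ (normc a * B1)) ?ler_wpM2l ?normc_ge0 // /B; lra.
- by move=> x; rewrite Normc.normcM (@le_trans _ _ (normc b * B2)) ?ler_wpM2l ?normc_ge0 // /B; lra.
rewrite (fcoefZ _ l (cm _ c1) b1) (fcoefZ _ l (cm _ c2) b2).
rewrite (fcoefZ (M := B1) _ l (cm _ c3')) //.
rewrite (fcoef_double l (cm _ c3) b3 per3).
rewrite (fcoef_periodize_modulate y l cphi ephi iphi) (fcoef_periodize_modulate y l cpsi epsi ipsi).
have e1 : fourier phi y = m0 (y / 2) * fourier phi (y / 2) by have := phiE 0; rewrite !mulr0 !addr0.
have e2 : fourier psi y = conjc (m0 (y / 2 + pi)) * cis (- (y / 2)) * fourier phi (y / 2).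
  by have := psiE 0; rewrite !mulr0 !addr0.
have qmf' : m0 (y / 2) * conjc (m0 (y / 2)) + m0 (y / 2 + pi) * conjc (m0 (y / 2 + pi)) = 1.
  by rewrite !mul_conjc -realcD qmf.
have ce := cisN (y / 2).
have cE : c = conjc (fourier phi (y / 2)) by [].
rewrite /a /b e1 e2 !conjcM conjcK -cE conj_cis opprK phiE psiE.
rewrite (_ : (y + 2 * pi * l%:~R) / 2 = y / 2 + pi * l%:~R); last by field.
have [m lE] : exists m : int, l = 2 * m \/ l = 2 * m + 1 by exists (l %/ 2)%Z; lia.
case: lE => lE.
  (* Even [l]: all filter values are those at [y / 2] and [y / 2 + pi], and the two products on the
     left add up by the quadrature mirror identity. *)
  have pl : pi * l%:~R = 2 * pi * m%:~R :> R by rewrite lE intrM; ring.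
  have -> : cintegral mu (fun x => (unit_indic x)%:C * (p3 x * cis (- (pi * l%:~R) * x))) =
      fourier phi (y / 2 + pi * l%:~R).
    rewrite pl -(fcoef_periodize_modulate (y / 2) m cphi ephi iphi).
    by apply: eq_cintegral => x; rewrite mulNr.
  have -> : cis (- (pi * l%:~R)) = 1 :> R[i].
    by rewrite -conj_cis pl cis_int_2pi conjc1.
  have -> : cis (- (y / 2 + pi * l%:~R)) = cis (- (y / 2)) :> R[i].
    by rewrite opprD cisD -[X in _ * X]conj_cis pl cis_int_2pi conjc1 mulr1.
  have -> : m0 (y / 2 + pi * l%:~R) = m0 (y / 2) by rewrite pl (filter_periodic m0per).
  have -> : m0 (y / 2 + pi * l%:~R + pi) = m0 (y / 2 + pi).
    by rewrite pl addrAC (filter_periodic m0per).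
  set E := fourier phi (y / 2 + _).
  have h2 : 2^-1%:C * (1 + 1) = 1 :> R[i].
    by apply: complex_ext; rewrite /=; field.
  rewrite h2 mul1r.
  transitivity (c * E * (m0 (y / 2) * conjc (m0 (y / 2)) +
    m0 (y / 2 + pi) * conjc (m0 (y / 2 + pi)) * (cis (y / 2) * cis (- (y / 2))) - 1)); first by ring.
  by rewrite ce mulr1 qmf' subrr mulr0.
(* Odd [l]: the coefficient on the right is 0. On the left the shift by [pi] exchanges the two
   filter values and changes the sign of the phase, so the two products cancel. *)
have pl : pi * l%:~R = 2 * pi * m%:~R + pi :> R by rewrite lE intrD intrM; ring.
have cpl : cis (- (pi * l%:~R)) = -1 :> R[i].
  by rewrite -conj_cis pl cisD cis_int_2pi cis_pi mul1r; apply: complex_ext; rewrite /= ?oppr0.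
rewrite cpl subrr mulr0 mul0r mulr0 addr0.
have -> : cis (- (y / 2 + pi * l%:~R)) = - cis (- (y / 2)) :> R[i].
  by rewrite opprD cisD cpl mulrN1.
have -> : m0 (y / 2 + pi * l%:~R) = m0 (y / 2 + pi).
  by rewrite pl addrCA addrC addrA (filter_periodic m0per) addrC.
have -> : m0 (y / 2 + pi * l%:~R + pi) = m0 (y / 2).
  rewrite pl (_ : _ + pi = y / 2 + 2 * pi + 2 * pi * m%:~R); last by ring.
  by rewrite (filter_periodic m0per) m0per.
set E := fourier phi (y / 2 + _).
transitivity (c * E * (m0 (y / 2 + pi) * conjc (m0 (y / 2))) * (1 - cis (y / 2) * cis (- (y / 2)))); first by ring.
by rewrite ce subrr mulr0.
Qed.

End telescoping.

Section wavelet_spectrum.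
Context {R : realType}.
Local Notation mu := (@lebesgue_measure R).
Local Notation rintegrable f := (mu.-integrable setT (EFin \o f)).

Lemma cmeasurable_ccvg (f_ : nat -> R -> R[i]) (f : R -> R[i]) :
  (forall n, cmeasurable (f_ n)) -> (forall x, ccvg (f_^~ x) (f x)) -> cmeasurable f.
Proof.
move=> mf ff; split.
  apply: (@measurable_fun_cvg _ _ _ _ (fun n x => complex.Re (f_ n x))) => [n|x _].
    by have [] := mf n.
  exact: (ccvg_Re (ff x)).
apply: (@measurable_fun_cvg _ _ _ _ (fun n x => complex.Im (f_ n x))) => [n|x _].
  by have [] := mf n.
exact: (ccvg_Im (ff x)).
Qed.

Lemma normc_fourier (g : R -> R[i]) y : cintegrable mu g ->
  normc (fourier g y) <= 2 * Rintegral mu setT (fun x => normc (g x)).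
Proof.
move=> ig; apply: normc_cintegral; [exact: cintegrable_fourier|exact: cintegrable_normc|].
by move=> x; rewrite Normc.normcM normc_cis mul1r.
Qed.

Lemma sym_sum_modulate K (g : R -> R[i]) (u x : R) :
  sym_sum K (fun k => cis (u * k%:~R) * g (x - k%:~R)) =
  cis (u * x) * sym_sum K (fun k => modulate u g (x - k%:~R)).
Proof.
rewrite sym_sumM; apply: eq_sym_sum => k; rewrite /modulate mulrA -cisD.
by congr (cis _ * _); ring.
Qed.

Variables (phi psi m0 : R -> R[i]) (s1 tau1 s2 tau2 : nat -> R).
Hypotheses (cphi : ccontinuous phi) (cpsi : ccontinuous psi)
  (ephi : envelope phi s1 tau1) (epsi : envelope psi s2 tau2)
  (iphi : cintegrable mu phi) (ipsi : cintegrable mu psi)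
  (m0per : forall x, m0 (x + 2 * pi) = m0 x)
  (phiE : {ae mu, forall u, forall k : int,
    fourier phi (2 * u + 2 * pi * k%:~R) =
    m0 (u + pi * k%:~R) * fourier phi (u + pi * k%:~R)})
  (psiE : {ae mu, forall y,
    fourier psi y = conjc (m0 (y / 2 + pi)) * cis (- (y / 2)) * fourier phi (y / 2)})
  (qmf : {ae mu, forall u, normc (m0 u) ^+ 2 + normc (m0 (u + pi)) ^+ 2 = 1})
  (phi0 : forall l : int, l != 0 -> fourier phi (2 * pi * l%:~R) = 0)
  (phi1 : normc (fourier phi 0) = 1).

Lemma ae_telescope : {ae mu, forall y, forall t,
  conjc (fourier phi y) * periodize (modulate y phi) t +
  conjc (fourier psi y) * periodize (modulate y psi) t =
  conjc (fourier phi (y / 2)) * periodize (modulate (y / 2) phi) (2 * t)}.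
Proof.
have h0 : 0 < 2^-1 :> R by rewrite invr_gt0.
have a1 := ae_affine 0 h0 phiE; have a2 := ae_affine 0 h0 qmf.
have a3 := ae_int (fun k : int => ae_shift (2 * pi * k%:~R) psiE).
apply: ae_mono (ae_and a1 (ae_and a2 a3)) => y [h1 [h2 h3]] t.
have yE : 2^-1 * y + 0 = y / 2 by rewrite addr0 mulrC.
have yE' : 2 * (y / 2) = y by field.
rewrite yE yE' in h1; rewrite yE in h2.
exact: (periodize_modulate_telescope cphi cpsi ephi epsi iphi ipsi).
Qed.

Lemma periodize_low_pass x : periodize (modulate 0 phi) x = fourier phi 0.
Proof.
have e0 := modulate_envelope 0 ephi; have c0 := modulate_continuous 0 cphi.
have b0 := periodize_bound e0; set B := 3 * _ + _ in b0.
have B0 : 0 <= B := le_trans (normc_ge0 _) (b0 0).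
apply/eqP; rewrite -subr_eq0; apply/eqP.
have cp := periodize_continuous c0 e0.
apply: (@fourier_unique R (fun x => periodize (modulate 0 phi) x + - fourier phi 0) (B + normc (fourier phi 0))).
- by apply: ccontinuousD => //; exact: ccontinuous_cst.
- by move=> z; rewrite (periodize_periodic e0).
- by move=> z; rewrite (le_trans (normcB _ _)) // lerD.
move=> l; rewrite (fcoefD (M := B + normc (fourier phi 0))).
- rewrite fcoef_cst (fcoef_periodize_modulate _ _ cphi ephi iphi) add0r.
  by case: eqVneq => [->|/phi0 ->]; rewrite ?mulr0 ?subrr // addr0.
- exact: cmeasurable_continuous.
- exact: cmeasurable_cst.
- by move=> z; rewrite (le_trans (b0 z)) // lerDl normc_ge0.
- by move=> z; rewrite normcN lerDr.
Qed.

(* The spectral function of the expansion at time [t] with [n] wavelet levels,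
   truncated to translations [|k| <= K]. *)
Definition wavelet_spectrum (n K : nat) (t u : R) : R[i] :=
  conjc (fourier phi u) * sym_sum K (fun k => cis (u * k%:~R) * phi (t - k%:~R)) +
  \sum_(j < n) conjc (fourier psi (u / 2 ^+ j)) *
    sym_sum K (fun k => cis (u / 2 ^+ j * k%:~R) * psi (2 ^+ j * t - k%:~R)).

(** What telescoping leaves of the untruncated expansion with [n] wavelet levels. Only the frequency
    [u / 2 ^+ n] occurs in it, besides the phase. *)
Let residual (n : nat) (t u : R) : R[i] :=
  cis (u * t) * (conjc (fourier phi (u / 2 ^+ n)) *
    periodize (modulate (u / 2 ^+ n) phi) (2 ^+ n * t)).

Let spectrum_cvg n t : {ae mu, forall u,
  ccvg (fun K => wavelet_spectrum n K t u) (residual n t u)}.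
Proof.
have p2 (k : int) : 0 < (2 ^+ `|k|%N)^-1 :> R by rewrite invr_gt0 exprn_gt0.
(* One null set must serve all scales at once. The countable family is indexed by integers, with the
   scale given by the absolute value. *)
have a1 := ae_int (fun k : int => ae_affine 0 (p2 k) ae_telescope).
apply: ae_mono a1 => u h.
have {}h j x : conjc (fourier phi (u / 2 ^+ j)) * periodize (modulate (u / 2 ^+ j) phi) x +
  conjc (fourier psi (u / 2 ^+ j)) * periodize (modulate (u / 2 ^+ j) psi) x =
  conjc (fourier phi (u / 2 ^+ j.+1)) * periodize (modulate (u / 2 ^+ j.+1) phi) (2 * x).
  have := h j%:Z x; rewrite addr0 (mulrC _ u) /= => ->.
  by rewrite (_ : u / 2 ^+ j / 2 = u / 2 ^+ j.+1) // exprSr invfM mulrA.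
have eE (j : nat) : u * t = u / 2 ^+ j * (2 ^+ j * t).
  by rewrite mulrA divfK // expf_neq0.
have resE : residual n t u = conjc (fourier phi u) * (cis (u * t) * periodize (modulate u phi) t) +
    \sum_(j < n) conjc (fourier psi (u / 2 ^+ j)) *
      (cis (u / 2 ^+ j * (2 ^+ j * t)) * periodize (modulate (u / 2 ^+ j) psi) (2 ^+ j * t)).
  rewrite {}/residual; elim: n => [|m IH].
    by rewrite big_ord0 addr0 expr0 divr1 mul1r; ring.
  rewrite big_ord_recr /= addrA -IH -eE.
  rewrite (_ : 2 ^+ m.+1 * t = 2 * (2 ^+ m * t)); last by rewrite exprS mulrA.
  by rewrite -h mulrDr; congr (_ + _); rewrite mulrCA.
rewrite resE; apply: (eq_ccvg (fun K => _)); last first.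
  apply: ccvgD; last apply: ccvg_sum => j; apply: ccvgMl; apply: ccvgMl.
    exact: (periodize_cvg (modulate_envelope u ephi)).
  exact: (periodize_cvg (modulate_envelope (u / 2 ^+ j) epsi)).
move=> K; rewrite /wavelet_spectrum sym_sum_modulate; congr (_ + _).
by apply: eq_bigr => j _; rewrite sym_sum_modulate.
Qed.

Let spectrum_bound n t : exists B : R, forall K u, normc (wavelet_spectrum n K t u) <= B.
Proof.
have bound g s tau (x : R) : ccontinuous g -> envelope g s tau -> cintegrable mu g ->
    exists B : R, forall K v, normc (conjc (fourier g v) * sym_sum K (fun k => cis (v * k%:~R) * g (x - k%:~R))) <= B.
  move=> cg eg ig; have [b xb] := normr_le_nat x.
  exists (2 * Rintegral mu setT (fun x => normc (g x)) * ((2 * b%:R + 1) * s 0%N + 2 * tau 0%N)) => K v.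
  rewrite Normc.normcM normc_conj sym_sum_modulate Normc.normcM normc_cis mul1r.
  apply: ler_pM; rewrite ?normc_ge0 //; first exact: normc_fourier.
  exact: (sym_sum_bound (modulate_envelope v eg)).
have [B0 hB0] := bound _ _ _ t cphi ephi iphi.
have /choice[B1 hB1] : forall j : nat, exists B : R, forall K v, normc (conjc (fourier psi v) *
    sym_sum K (fun k => cis (v * k%:~R) * psi (2 ^+ j * t - k%:~R))) <= B.
  by move=> j; exact: (bound _ _ _ _ cpsi epsi ipsi).
exists (B0 + \sum_(j < n) B1 j) => K u; rewrite (le_trans (normcD _ _)) // lerD //.
by rewrite (le_trans (normc_sum _ _ _)) //; apply: ler_sum.
Qed.

(** As [u / 2 ^+ n] tends to 0, the two factors tend to [conjc (phi^ 0)] and to the constant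
    [phi^ 0], whose product is 1. The second limit uses uniformity, since the point [2 ^+ n * t]
    moves. *)
Let residual_cvg t u : ccvg (fun n => residual n t u) (cis (u * t)).
Proof.
rewrite -[X in ccvg _ X]mulr1; apply: ccvgMl.
rewrite (_ : 1 = conjc (fourier phi 0) * fourier phi 0); last first.
  by rewrite mulrC mul_conjc phi1 expr1n.
have small (d : R) : 0 < d -> exists N, forall n, (N <= n)%N -> `|u / 2 ^+ n| < d.
  move=> d0; have [b ub] := normr_le_nat (u / d).
  exists b => n bn; rewrite normrM (gtr0_norm (x := (2 ^+ n)^-1)) ?invr_gt0 ?exprn_gt0 //.
  rewrite ltr_pdivrMr ?exprn_gt0 //.
  have h1 : b%:R < 2 ^+ n :> R by rewrite -natrX ltr_nat (leq_ltn_trans bn) // ltn_expl.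
  rewrite normrM (gtr0_norm (x := d^-1)) ?invr_gt0 // ler_pdivrMr // in ub.
  by rewrite (le_lt_trans ub) // mulrC ltr_pM2l.
apply: ccvgM.
  apply: ccvg_conj; apply/ccvgP => e e0.
  have [d d0 hd] := (ccontinuous_atP _ _).1 (fourier_ccontinuous iphi 0) e e0.
  by have [N hN] := small d d0; exists N => n Nn; apply: hd; rewrite subr0 hN.
apply/ccvgP => e e0.
have [d d0 hd] := periodize_modulate_near0 cphi ephi e0.
have [N hN] := small d d0; exists N => n Nn.
by rewrite -(periodize_low_pass (2 ^+ n * t)); apply: hd; exact: hN.
Qed.

Let cmeasurable_residual n t : cmeasurable (residual n t).
Proof.
have ca : continuous (fun u : R => u / 2 ^+ n) by exact: mulrr_continuous.
have ct : continuous (fun u : R => u * t) by exact: mulrr_continuous.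
apply: (@cmeasurable_ccvg (fun K u => cis (u * t) * (conjc (fourier phi (u / 2 ^+ n)) *
  sym_sum K (fun k => modulate (u / 2 ^+ n) phi (2 ^+ n * t - k%:~R))))).
  move=> K; apply: cmeasurable_continuous; apply: ccontinuousM.
    exact: (ccontinuous_comp ct (@ccontinuous_cis R)).
  apply: ccontinuousM.
    exact: (ccontinuous_conj (ccontinuous_comp ca (fourier_ccontinuous iphi))).
  apply: ccontinuous_sum => i; apply: ccontinuousM; last exact: ccontinuous_cst.
  set c := _ - _; rewrite (_ : (fun u => _) = (fun u : R => cis (u * (- (2 ^+ n)^-1 * c)))).
    exact: (ccontinuous_comp (@mulrr_continuous _ _) (@ccontinuous_cis R)).
  by apply/funext => u; congr cis; ring.
by move=> u; do 2 apply: ccvgMl; exact: (periodize_cvg (modulate_envelope _ ephi)).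
Qed.

Let cmeasurable_spectrum n K t : cmeasurable (wavelet_spectrum n K t).
Proof.
have lin (a : R) : continuous (fun u : R => u * a) by exact: mulrr_continuous.
have term g (a x : R) : cintegrable mu g ->
    ccontinuous (fun u => conjc (fourier g (u * a)) * sym_sum K (fun k => cis (u * a * k%:~R) * g (x - k%:~R))).
  move=> ig; apply: ccontinuousM.
    exact: (ccontinuous_conj (ccontinuous_comp (lin a) (fourier_ccontinuous ig))).
  apply: ccontinuous_sum => i; apply: ccontinuousM; last exact: ccontinuous_cst.
  apply: (@ccontinuous_comp _ _ (fun u => u * a * _)); last exact: ccontinuous_cis.
  by under eq_fun do rewrite -mulrA; exact: lin.
apply: cmeasurable_continuous; apply: ccontinuousD; last first.
  by apply: ccontinuous_sum => j; exact: term.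
by have := term phi 1 t iphi; under eq_fun do rewrite !mulr1.
Qed.

(** Two dominated convergences: [K] to infinity for fixed [n], with a majorant depending on [n] and
    [t], and then [n] to infinity, with a uniform majorant of the telescoped form. *)
Lemma wavelet_spectrum_L2 (w : R -> R) (t e : R) : rintegrable w -> (forall u, 0 <= w u) -> 0 < e ->
  exists N, forall n, (N <= n)%N -> exists K0, forall K, (K0 <= K)%N ->
    Rintegral mu setT (fun u => normc (cis (u * t) - wavelet_spectrum n K t u) ^+ 2 * w u) < e.
Proof.
move=> iw w0 e0.
have mw : measurable_fun setT w by move/measurable_int : iw => /measurable_EFinP.
have mt : cmeasurable (fun u : R => cis (u * t)).
  by under eq_fun do rewrite mulrC; exact: cmeasurable_cisZ.
have md (h : R -> R[i]) : cmeasurable h -> measurable_fun setT (fun u : R => normc (cis (u * t) - h u) ^+ 2 * w u).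
  move=> mh; apply: measurable_funM => //; apply: measurable_funX.
  by apply: measurable_normc; apply: cmeasurableD => //; exact: cmeasurableN.
have dom (z : R[i]) (B u : R) : normc z <= B ->
    `|normc (cis (u * t) - z) ^+ 2 * w u| <= (2 + 2 * B ^+ 2) * w u.
  move=> zB; have p0 : 0 <= normc (cis (u * t) - z) ^+ 2 * w u by rewrite mulr_ge0 ?sqr_ge0.
  rewrite (ger0_norm p0) ler_wpM2r //.
  have := sqr_normcD (cis (u * t)) (- z); rewrite normc_cis normcN expr1n mulr1.
  move=> /le_trans; apply; rewrite lerD2l ler_pM2l // ler_pXn2r ?nnegrE ?normc_ge0 //.
  exact: le_trans (normc_ge0 _) zB.
have to0 (u_ : nat -> R[i]) (z l : R[i]) (c : R) : ccvg u_ l ->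
    normc (z - u_ n) ^+ 2 * c @[n --> \oo] --> normc (z - l) ^+ 2 * c.
  move=> h; rewrite expr2; under eq_fun do rewrite expr2.
  have hz : normc (z - u_ n) @[n --> \oo] --> normc (z - l).
    by apply: ccvg_normc; apply: ccvgD; [exact: ccvg_cst|exact: ccvgN].
  exact: (cvgM (cvgM hz hz) (cvg_cst c)).
have cvg1 n : Rintegral mu setT (fun u => normc (cis (u * t) - wavelet_spectrum n K t u) ^+ 2 * w u)
    @[K --> \oo] --> Rintegral mu setT (fun u => normc (cis (u * t) - residual n t u) ^+ 2 * w u).
  have [B hB] := spectrum_bound n t.
  apply: (@Rdct _ _ _ mu _ _ (fun u => (2 + 2 * B ^+ 2) * w u)).
  - by move=> K; apply: md; exact: cmeasurable_spectrum.
  - by apply: md; exact: cmeasurable_residual.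
  - by apply: ae_mono (spectrum_cvg n t) => u h; exact: to0.
  - exact: rintegrableZ.
  - by move=> K u; apply: dom.
have cvg2 : Rintegral mu setT (fun u => normc (cis (u * t) - residual n t u) ^+ 2 * w u)
    @[n --> \oo] --> (0 : R).
  rewrite -[X in _ --> X](@Rintegral_cst0 _ _ _ mu).
  pose B := 2 * Rintegral mu setT (fun x => normc (phi x)) * (3 * s1 0%N + 2 * tau1 0%N).
  apply: (@Rdct _ _ _ mu _ _ (fun u => (2 + 2 * B ^+ 2) * w u)).
  - by move=> n; apply: md; exact: cmeasurable_residual.
  - exact: measurable_cst.
  - apply: aeW => u; have := to0 _ (cis (u * t)) _ (w u) (residual_cvg t u).
    by rewrite subrr Normc.normc0 expr0n mul0r.
  - exact: rintegrableZ.
  - move=> n u; apply: dom; rewrite /residual !Normc.normcM normc_cis mul1r normc_conj.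
    apply: ler_pM; rewrite ?normc_ge0 //; first exact: normc_fourier.
    exact: (periodize_bound (modulate_envelope _ ephi)).
move/cvgrPdist_lt : cvg2 => /(_ (e / 2) ltac:(lra))[N _ hN].
exists N => n /hN /=; rewrite sub0r normrN => h1.
move/cvgrPdist_lt : (cvg1 n) => /(_ (e / 2) ltac:(lra))[K0 _ hK].
exists K0 => K /hK /=.
move: h1; set a := Rintegral _ _ _; set b := Rintegral _ _ _ => h1 h2.
have := ler_norm a; have := ler_norm (- (a - b)); rewrite normrN; lra.
Qed.

End wavelet_spectrum.

(** * Spectral representation of the process *)

Section gaussian_moments.
Context {R : realType}.
Local Notation mu := (@lebesgue_measure R).

(** With [q = (x - m)^2 / (8 s^2)] the two exponentials are [e^(-4 q)] and [e^(-q)]. The spare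
    factor [e^(-3 q)] absorbs the quadratic growth of [x^2 <= 2 m^2 + 16 s^2 q], so the second
    moment is controlled by the mass of a wider normal density. *)
Lemma normal_pdf_sqr_le (m s x : R) : s != 0 ->
  x ^+ 2 * normal_pdf m s x <=
  (2 * m ^+ 2 + 16 * s ^+ 2) * (normal_peak s / normal_peak (2 * s)) * normal_pdf m (2 * s) x.
Proof.
move=> s0; have s20 : 2 * s != 0 by rewrite mulf_neq0.
have ss : 0 < s ^+ 2 by rewrite exprn_even_gt0.
rewrite !normal_pdfE // /normal_fun.
pose q := (x - m) ^+ 2 / (8 * s ^+ 2).
have q0 : 0 <= q by rewrite divr_ge0 ?sqr_ge0 // mulr_ge0 // sqr_ge0.
have -> : - (x - m) ^+ 2 / (s ^+ 2 *+ 2) = - (4 * q).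
  by rewrite /q -mulr_natr; field; rewrite ?s0.
have -> : - (x - m) ^+ 2 / ((2 * s) ^+ 2 *+ 2) = - q.
  by rewrite /q -mulr_natr; field; rewrite ?s0.
have p0 := normal_peak_gt0 s0; have p1 := normal_peak_gt0 s20.
rewrite (_ : _ * (_ / _) * (_ * _) = (2 * m ^+ 2 + 16 * s ^+ 2) * normal_peak s * expR (- q)); last by field; lra.
rewrite mulrCA (mulrC _ (normal_peak s)) -[leRHS]mulrA ler_pM2l //.
have xE : x ^+ 2 <= 2 * m ^+ 2 + 16 * s ^+ 2 * q.
  have -> : 16 * s ^+ 2 * q = 2 * (x - m) ^+ 2 by rewrite /q; field.
  rewrite -subr_ge0 (_ : _ - _ = (x - 2 * m) ^+ 2); [exact: sqr_ge0|ring].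
have e1 : expR (- (4 * q)) <= expR (- q) by rewrite ler_expR; lra.
have e2 : q * expR (- (4 * q)) <= expR (- q).
  have -> : expR (- (4 * q)) = expR (- q) * expR (- (3 * q)) by rewrite -expRD; congr expR; ring.
  rewrite mulrCA ler_piMr ?expR_ge0 // -[leRHS](_ : expR (3 * q) * expR (- (3 * q)) = 1); last first.
    by rewrite -expRD subrr expR0.
  rewrite ler_wpM2r ?expR_ge0 //; have := expR_ge1Dx (3 * q); lra.
apply: le_trans (_ : (2 * m ^+ 2 + 16 * s ^+ 2 * q) * expR (- (4 * q)) <= _).
  by rewrite ler_wpM2r // expR_ge0.
have a1 : m ^+ 2 * expR (- (4 * q)) <= m ^+ 2 * expR (- q) by rewrite ler_wpM2l // sqr_ge0.
have a2 : s ^+ 2 * (q * expR (- (4 * q))) <= s ^+ 2 * expR (- q) by rewrite ler_wpM2l // sqr_ge0.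
rewrite (_ : (_ + _) * _ = 2 * (m ^+ 2 * expR (- (4 * q))) + 16 * (s ^+ 2 * (q * expR (- (4 * q))))); last by ring.
rewrite (_ : (_ + _) * expR (- q) = 2 * (m ^+ 2 * expR (- q)) + 16 * (s ^+ 2 * expR (- q))); last by ring.
lra.
Qed.

(** Integration against [normal_prob] goes through the abstract Radon-Nikodym derivative; equal
    integrals over all measurable sets identify it a.e. with the explicit density. *)
Lemma normal_prob_density (m s : R) (f : R -> \bar R) : (forall x, (0 <= f x)%E) ->
  measurable_fun setT f ->
  (\int[normal_prob m s]_x f x = \int[mu]_x (f x * (normal_pdf m s x)%:E))%E.
Proof.
move=> f0 mf; have dom := @normal_prob_dominates R m s.
rewrite -(Radon_Nikodym_SigmaFinite.change_of_variables dom) //.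
have mpdf : measurable_fun setT (fun x => (normal_pdf m s x)%:E).
  by apply/measurable_EFinP; exact: measurable_normal_pdf.
have mrn : measurable_fun setT (Radon_Nikodym_SigmaFinite.f (normal_prob m s) mu).
  exact: measurable_int (Radon_Nikodym_SigmaFinite.f_integrable dom).
apply: ae_eq_integral => //; [exact: emeasurable_funM|exact: emeasurable_funM|].
have : ae_eq mu setT (Radon_Nikodym_SigmaFinite.f (normal_prob m s) mu) (fun x => (normal_pdf m s x)%:E).
  apply: integral_ae_eq => //; first exact: Radon_Nikodym_SigmaFinite.f_integrable.
  by move=> E _ mE; rewrite -Radon_Nikodym_SigmaFinite.f_integral.
by apply: filterS => x h _; rewrite h.
Qed.

Context {d : measure_display} {Omega : measurableType d}.
Variable P : probability Omega R.

Lemma gaussian_sqr_lty (Y : Omega -> R) : gaussian_rv P Y ->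
  (\int[P]_w (Y w ^+ 2)%:E < +oo)%E.
Proof.
move=> [mY [m [s law]]].
have mY' : measurable_fun setT (Y : Omega -> measurableTypeR R) := mY.
pose Y' : {mfun Omega >-> measurableTypeR R} :=
  HB.pack (Y : Omega -> measurableTypeR R) (isMeasurableFun.Build _ _ _ _ _ mY').
have msq : measurable_fun setT (fun x : measurableTypeR R => (x ^+ 2)%:E).
  by apply/measurable_EFinP; exact: measurable_funX.
have sq0 (x : R) : (0 <= (x ^+ 2)%:E)%E by rewrite lee_fin sqr_ge0.
have -> : (\int[P]_w (Y w ^+ 2)%:E = \int[pushforward P Y']_x (x ^+ 2)%:E)%E.
  by rewrite ge0_integral_pushforward // preimage_setT.
have [s0|s0] := eqVneq s 0.
  have -> : (\int[pushforward P Y']_x (x ^+ 2)%:E = \int[\d_(m : measurableTypeR R)]_x (x ^+ 2)%:E)%E.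
    apply: eq_measure_integral => A mA _; have := law _ mA.
    by rewrite s0 eqxx.
  by rewrite integral_dirac // diracT mul1e ltry.
have -> : (\int[pushforward P Y']_x (x ^+ 2)%:E = \int[normal_prob m s]_x (x ^+ 2)%:E)%E.
  apply: eq_measure_integral => A mA _; have := law _ mA.
  by rewrite (negbTE s0).
rewrite normal_prob_density //.
pose C := (2 * m ^+ 2 + 16 * s ^+ 2) * (normal_peak s / normal_peak (2 * s)).
have := rintegrable_lty (rintegrableZ C (integrable_normal_pdf m (2 * s))) => h.
apply: le_lt_trans (h _); last first.
  move=> x; rewrite mulr_ge0 ?normal_pdf_ge0 // mulr_ge0 //.
    by have := sqr_ge0 m; have := sqr_ge0 s; lra.
  by rewrite divr_ge0 ?normal_peak_ge0.
apply: ge0_le_integral => //=.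
- by move=> x _; rewrite mule_ge0 // lee_fin normal_pdf_ge0.
- by apply: emeasurable_funM => //; apply/measurable_EFinP; exact: measurable_normal_pdf.
- by apply/measurable_EFinP; apply: measurable_funM => //; exact: measurable_normal_pdf.
- by move=> x _; rewrite -EFinM lee_fin; exact: normal_pdf_sqr_le.
Qed.

End gaussian_moments.

Section square_integrable.
Context {R : realType} {d : measure_display} {T : measurableType d}.
Variable m : {measure set T -> \bar R}.
Local Notation rintegrable f := (m.-integrable setT (EFin \o f)).

Definition sqint (Z : T -> R[i]) : Prop :=
  cmeasurable Z /\ rintegrable (fun w => normc (Z w) ^+ 2).

Definition nrm2 (Z : T -> R[i]) : R := Rintegral m setT (fun w => normc (Z w) ^+ 2).

Lemma nrm2_ge0 Z : 0 <= nrm2 Z.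
Proof. by apply: Rintegral_ge0 => x _; exact: sqr_ge0. Qed.

Lemma sqint_le (Z : T -> R[i]) (g : T -> R) : cmeasurable Z ->
  (forall w, normc (Z w) ^+ 2 <= g w) -> rintegrable g -> sqint Z.
Proof.
move=> mZ Zg ig; split => //.
apply: (@le_rintegrable _ _ _ m _ g) => //; first by apply: measurable_funX; exact: measurable_normc.
by move=> w; rewrite ger0_norm ?sqr_ge0.
Qed.

Lemma sqintD Z W : sqint Z -> sqint W -> sqint (fun w => Z w + W w).
Proof.
move=> [mZ iZ] [mW iW].
apply: (@sqint_le _ (fun w => 2 * normc (Z w) ^+ 2 + 2 * normc (W w) ^+ 2)).
- exact: cmeasurableD.
- by move=> w; exact: sqr_normcD.
- by apply: rintegrableD; exact: rintegrableZ.
Qed.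

Lemma nrm2D Z W : sqint Z -> sqint W -> nrm2 (fun w => Z w + W w) <= 2 * nrm2 Z + 2 * nrm2 W.
Proof.
move=> hZ hW; have [mZ iZ] := hZ; have [mW iW] := hW; have [_ iZW] := sqintD hZ hW.
have i1 := rintegrableZ 2 iZ; have i2 := rintegrableZ 2 iW.
rewrite /nrm2 -(RintegralZl 2 measurableT iZ) -(RintegralZl 2 measurableT iW) -RintegralD //.
apply: le_Rintegral => //; first exact: rintegrableD.
by move=> w _; exact: sqr_normcD.
Qed.

Lemma sqintZ c Z : sqint Z -> sqint (fun w => c * Z w).
Proof.
move=> [mZ iZ]; apply: (@sqint_le _ (fun w => normc c ^+ 2 * normc (Z w) ^+ 2)).
- by apply: cmeasurableM => //; exact: cmeasurable_cst.
- by move=> w; rewrite Normc.normcM exprMn.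
- exact: rintegrableZ.
Qed.

Lemma nrm2Z c Z : sqint Z -> nrm2 (fun w => c * Z w) = normc c ^+ 2 * nrm2 Z.
Proof.
move=> [mZ iZ]; rewrite /nrm2 -(RintegralZl _ measurableT iZ).
by congr (Rintegral m setT _); apply/funext => w; rewrite Normc.normcM exprMn.
Qed.

Lemma eq_nrm2 Z W : Z =1 W -> nrm2 Z = nrm2 W.
Proof. by move=> /funext ->. Qed.

Lemma nrm2N Z : nrm2 (fun w => - Z w) = nrm2 Z.
Proof. by rewrite /nrm2; under eq_fun do rewrite normcN. Qed.

Lemma sqintN Z : sqint Z -> sqint (fun w => - Z w).
Proof. by move=> [mZ iZ]; split; [exact: cmeasurableN|under eq_fun do rewrite normcN]. Qed.

Lemma sqintB Z W : sqint Z -> sqint W -> sqint (fun w => Z w - W w).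
Proof. by move=> hZ hW; apply: sqintD => //; exact: sqintN. Qed.

Lemma sqint0 : sqint (fun=> 0).
Proof.
split; first exact: cmeasurable_cst.
by under eq_fun do rewrite Normc.normc0 expr0n; exact: integrable0.
Qed.

Lemma sqint_sum I (s : seq I) (F : I -> T -> R[i]) : (forall i, sqint (F i)) ->
  sqint (fun w => \sum_(i <- s) F i w).
Proof.
move=> hF; elim: s => [|i s IH]; first by under eq_fun do rewrite big_nil; exact: sqint0.
by under eq_fun do rewrite big_cons; exact: sqintD.
Qed.

Lemma cintegrable_sqint Z W : sqint Z -> sqint W -> cintegrable m (fun w => Z w * conjc (W w)).
Proof.
move=> [mZ iZ] [mW iW].
apply: (@le_cintegrable _ _ _ m _ (fun w => normc (Z w) ^+ 2 + normc (W w) ^+ 2)).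
- by apply: cmeasurableM => //; exact: cmeasurable_conj.
- apply: aeW => w; rewrite Normc.normcM normc_conj.
  have := sqr_ge0 (normc (Z w) - normc (W w)).
  have := mulr_ge0 (normc_ge0 (Z w)) (normc_ge0 (W w)); nra.
- exact: rintegrableD.
Qed.

Lemma sqint_lty Z (e : R) : cmeasurable Z ->
  (\int[m]_w ((normc (Z w)) ^+ 2)%:E < e%:E)%E -> sqint Z /\ nrm2 Z < e.
Proof.
move=> mZ Ze; have iZ : sqint Z.
  split => //; apply: ge0_rintegrable; last exact: lt_le_trans Ze (leey _).
    by apply: measurable_funX; exact: measurable_normc.
  by move=> w; exact: sqr_ge0.
split => //; have [_ i] := iZ.
by rewrite -lte_fin EFin_Rintegral.
Qed.

End square_integrable.

Section spectral_representation.
Context {R : realType} {d : measure_display} {Omega : measurableType d}.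
Variable P : probability Omega R.
Local Notation mu := (@lebesgue_measure R).
Local Notation rintegrable f := (mu.-integrable setT (EFin \o f)).

Variables (X : R -> Omega -> R[i]) (Rcov : R -> R[i]).
Hypotheses (sX : forall t, sqint P (X t))
  (cov : forall t s, covariance_fun P X t s = Rcov (t - s))
  (cR : ccontinuous Rcov) (iR : cintegrable mu Rcov)
  (iRhat : cintegrable mu (fourier Rcov)).

Definition sqrt_density (u : R) : R := Num.sqrt (normc (fourier Rcov u)).

(** Absorbing the square root of [|R^|] into the function turns the norm with weight [|R^|] into a
    plain [nrm2 mu], so the same calculus serves random variables and spectral functions. *)
Definition weighted (f : R -> R[i]) (u : R) : R[i] := (sqrt_density u)%:C * f u.

Lemma sqr_normc_weighted f u : normc (weighted f u) ^+ 2 = normc (f u) ^+ 2 * normc (fourier Rcov u).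
Proof.
rewrite Normc.normcM exprMn normc_real mulrC; congr (_ * _).
by rewrite ger0_norm ?sqrtr_ge0 // sqr_sqrtr // normc_ge0.
Qed.

Lemma cmeasurable_weighted f : cmeasurable f -> cmeasurable (weighted f).
Proof.
move=> mf; apply: cmeasurableM => //; apply: cmeasurable_real.
apply: (measurableT_comp (f := @Num.sqrt R)).
  by apply: continuous_measurable_fun; exact: sqrt_continuous.
exact: (measurable_normc (cintegrable_meas iRhat)).
Qed.

Lemma sqint_weighted f (M : R) : cmeasurable f -> (forall u, normc (f u) <= M) ->
  sqint mu (weighted f).
Proof.
move=> mf fM; apply: (@sqint_le _ _ _ mu _ (fun u => M ^+ 2 * normc (fourier Rcov u))).
- exact: cmeasurable_weighted.
- move=> u; rewrite sqr_normc_weighted ler_wpM2r ?normc_ge0 //.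
  by rewrite ler_pXn2r ?nnegrE ?normc_ge0 // (le_trans (normc_ge0 _) (fM u)).
- by apply: rintegrableZ; exact: cintegrable_normc.
Qed.

Definition trig_poly (s : seq (R[i] * R)) (u : R) : R[i] := \sum_(p <- s) p.1 * cis (u * p.2).

Definition process_comb (s : seq (R[i] * R)) (w : Omega) : R[i] := \sum_(p <- s) p.1 * X p.2 w.

Lemma sqint_process_comb s : sqint P (process_comb s).
Proof. by apply: sqint_sum => p; apply: sqintZ. Qed.

Lemma cmeasurable_trig_poly s : cmeasurable (trig_poly s).
Proof.
apply: cmeasurable_sum => p; apply: cmeasurableM; first exact: cmeasurable_cst.
by under eq_fun do rewrite mulrC; exact: cmeasurable_cisZ.
Qed.

Lemma trig_poly_bound s u : normc (trig_poly s u) <= \sum_(p <- s) normc p.1.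
Proof.
rewrite (le_trans (normc_sum _ _ _)) //; apply: ler_sum => p _.
by rewrite Normc.normcM normc_cis mulr1.
Qed.

Lemma sqint_trig_poly s : sqint mu (weighted (trig_poly s)).
Proof. exact: (sqint_weighted (cmeasurable_trig_poly s) (trig_poly_bound s)). Qed.

(** Expanding the square gives a double sum of covariances; Fourier inversion of [Rcov] turns it
    into $(2\pi)^{-1}$ times the integral of [|trig_poly|^2] against [R^]. Passing to [|R^|] costs a
    factor 2, and $2/(2\pi)\le 1$. *)
Lemma process_comb_le s : nrm2 P (process_comb s) <= nrm2 mu (weighted (trig_poly s)).
Proof.
have p0 : 0 < 2 * pi :> R by rewrite mulr_gt0 // pi_gt0.
have RE x : Rcov x = ((2 * pi)^-1)%:C * cintegral mu (fun u => cis (u * x) * fourier Rcov u).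
  by rewrite -{1}(fourier_inversion_continuous (cR x) iR iRhat).
have icis x : cintegrable mu (fun u => cis (u * x) * fourier Rcov u).
  have := cintegrable_cis x iRhat.
  by congr (cintegrable mu _); apply/funext => u; rewrite [x * u]mulrC.
have polar (a : seq (R[i] * R)) (F : R -> R[i]) : (\sum_(p <- a) p.1 * F p.2) * conjc (\sum_(p <- a) p.1 * F p.2) =
    \sum_(p <- a) \sum_(q <- a) (p.1 * conjc q.1) * (F p.2 * conjc (F q.2)).
  rewrite conjc_sum mulr_suml; apply: eq_bigr => p _; rewrite mulr_sumr.
  by apply: eq_bigr => q _; rewrite conjcM; ring.
have iXX t v : cintegrable P (fun w => X t w * conjc (X v w)) by exact: cintegrable_sqint.
have e1 : (nrm2 P (process_comb s))%:C = \sum_(p <- s) \sum_(q <- s) (p.1 * conjc q.1) * Rcov (p.2 - q.2).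
  rewrite -cintegral_real (eq_cintegral P (g := fun w => \sum_(p <- s) \sum_(q <- s) (p.1 * conjc q.1) * (X p.2 w * conjc (X q.2 w)))); last first.
    by move=> w; rewrite -mul_conjc -(polar s (fun t => X t w)).
  rewrite cintegral_sum; last by move=> p; apply: cintegrable_sum => q; exact: cintegrableZ.
  apply: eq_bigr => p _; rewrite cintegral_sum; last by move=> q; exact: cintegrableZ.
  by apply: eq_bigr => q _; rewrite cintegralZ // -cov.
have e2 : (nrm2 P (process_comb s))%:C = ((2 * pi)^-1)%:C *
    cintegral mu (fun u => (normc (trig_poly s u) ^+ 2)%:C * fourier Rcov u).
  rewrite e1 (eq_cintegral mu (g := fun u => \sum_(p <- s) \sum_(q <- s) (p.1 * conjc q.1) * (cis (u * (p.2 - q.2)) * fourier Rcov u))); last first.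
    move=> u; rewrite -mul_conjc (polar s (fun t => cis (u * t))) mulr_suml.
    apply: eq_bigr => p _; rewrite mulr_suml; apply: eq_bigr => q _.
    by rewrite mulrBr cisD conj_cis !mulrA.
  rewrite cintegral_sum; last by move=> p; apply: cintegrable_sum => q; exact: cintegrableZ.
  rewrite mulr_sumr; apply: eq_bigr => p _; rewrite cintegral_sum; last by move=> q; exact: cintegrableZ.
  rewrite mulr_sumr; apply: eq_bigr => q _; rewrite cintegralZ // RE; ring.
(* A nonnegative real equals its own modulus, so the complex identity [e2] can be estimated by norms
   without knowing the sign of [R^]. *)
have := normc_real (nrm2 P (process_comb s)); rewrite e2 ger0_norm ?nrm2_ge0 // => <-.
rewrite Normc.normcM normc_real gtr0_norm ?invr_gt0 //.
have [_ iw] := sqint_trig_poly s.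
have iT : cintegrable mu (fun u => (normc (trig_poly s u) ^+ 2)%:C * fourier Rcov u).
  apply: (@le_cintegrable _ _ _ mu _ (fun u => normc (weighted (trig_poly s) u) ^+ 2)) => //.
    apply: cmeasurableM; last exact: cintegrable_meas iRhat.
    apply: cmeasurable_real; apply: measurable_funX; exact: (measurable_normc (cmeasurable_trig_poly s)).
  by apply: aeW => u; rewrite Normc.normcM normc_real ger0_norm ?sqr_ge0 // sqr_normc_weighted.
have := normc_cintegral iT iw; rewrite -/(nrm2 mu _) => h.
have {h} : normc (cintegral mu (fun u => (normc (trig_poly s u) ^+ 2)%:C * fourier Rcov u)) <=
    2 * nrm2 mu (weighted (trig_poly s)).
  by apply: h => u; rewrite Normc.normcM normc_real ger0_norm ?sqr_ge0 // sqr_normc_weighted.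
move=> h; rewrite ler_pdivrMl //; apply: (le_trans h); rewrite ler_wpM2r ?nrm2_ge0 //.
by have := pi_ge2 R; lra.
Qed.

(* The correspondence [X t <-> e^(i t u)], extended by mean-square limits.
   The weight is [|R^|] because the positivity of [R^] is not available. *)
Definition represents (Z : Omega -> R[i]) (f : R -> R[i]) : Prop :=
  [/\ sqint P Z, sqint mu (weighted f) &
    forall e : R, 0 < e -> exists s,
      nrm2 P (fun w => Z w - process_comb s w) < e /\
      nrm2 mu (weighted (fun u => f u - trig_poly s u)) < e].

Let weightedD f g : weighted (fun u => f u + g u) = fun u => weighted f u + weighted g u.
Proof. by apply/funext => u; rewrite /weighted mulrDr. Qed.

Let weightedB f g : weighted (fun u => f u - g u) = fun u => weighted f u - weighted g u.
Proof. by apply/funext => u; rewrite /weighted mulrBr. Qed.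

Let weightedZ c f : weighted (fun u => c * f u) = fun u => c * weighted f u.
Proof. by apply/funext => u; rewrite /weighted mulrCA. Qed.

Lemma represents_process t : represents (X t) (fun u => cis (u * t)).
Proof.
have hs u : trig_poly [:: (1, t)] u = cis (u * t) by rewrite /trig_poly big_seq1 mul1r.
split => //.
  by have := sqint_trig_poly [:: (1, t)]; rewrite (funext hs).
move=> e e0; exists [:: (1, t)]; split.
  rewrite (eq_nrm2 P (W := fun=> 0)); last by move=> w; rewrite /process_comb big_seq1 mul1r subrr.
  by rewrite /nrm2 Normc.normc0 expr0n Rintegral_cst0.
rewrite (eq_nrm2 mu (W := fun=> 0)); last by move=> u; rewrite /weighted hs subrr mulr0.
by rewrite /nrm2 Normc.normc0 expr0n Rintegral_cst0.
Qed.

Lemma representsZ c Z f : represents Z f -> represents (fun w => c * Z w) (fun u => c * f u).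
Proof.
move=> [sZ sf app]; split; [exact: sqintZ|by rewrite weightedZ; exact: sqintZ|].
move=> e e0; have c1 : 0 < normc c ^+ 2 + 1 by have := sqr_ge0 (normc c); lra.
have [s [h1 h2]] := app (e / (normc c ^+ 2 + 1)) (divr_gt0 e0 c1).
pose s' := [seq (c * p.1, p.2) | p <- s]; exists s'.
have E a b : 0 <= b -> a <= normc c ^+ 2 * b -> b < e / (normc c ^+ 2 + 1) -> a < e.
  move=> b0 ab; rewrite ltr_pdivlMr // => be; have := sqr_ge0 (normc c); nra.
split.
  apply: (E _ _ _ _ h1); first exact: nrm2_ge0.
  rewrite -nrm2Z; last by apply: sqintB => //; exact: sqint_process_comb.
  rewrite le_eqVlt; apply/orP; left; apply/eqP; apply: eq_nrm2 => w.
  rewrite /process_comb big_map mulrBr mulr_sumr; congr (_ - _).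
  by apply: eq_bigr => p _; rewrite mulrA.
apply: (E _ _ _ _ h2); first exact: nrm2_ge0.
rewrite -nrm2Z; last by rewrite weightedB; apply: sqintB => //; exact: sqint_trig_poly.
rewrite le_eqVlt; apply/orP; left; apply/eqP; apply: eq_nrm2 => u.
rewrite /weighted /trig_poly big_map mulrCA; congr (_ * _); rewrite mulrBr mulr_sumr; congr (_ - _).
by apply: eq_bigr => p _; rewrite mulrA.
Qed.

Lemma representsD Z W f g : represents Z f -> represents W g ->
  represents (fun w => Z w + W w) (fun u => f u + g u).
Proof.
move=> [sZ sf appZ] [sW sg appW]; split; [exact: sqintD|by rewrite weightedD; exact: sqintD|].
move=> e e0; have e4 : 0 < e / 4 by lra.
have [s [h1 h2]] := appZ _ e4; have [s' [h3 h4]] := appW _ e4.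
exists (s ++ s'); split.
  have := nrm2D (sqintB sZ (sqint_process_comb s)) (sqintB sW (sqint_process_comb s')).
  rewrite (eq_nrm2 P (W := fun w => Z w + W w - process_comb (s ++ s') w)); first lra.
  by move=> w; rewrite /process_comb big_cat /=; ring.
rewrite !weightedB in h2 h4.
have := nrm2D (sqintB sf (sqint_trig_poly s)) (sqintB sg (sqint_trig_poly s')).
rewrite (eq_nrm2 mu (W := weighted (fun u => f u + g u - trig_poly (s ++ s') u))); first lra.
by move=> u; rewrite /weighted /trig_poly big_cat /=; ring.
Qed.

(** The inequality for approximating combinations passes to the limit; using
    [|a + b|^2 <= 2 |a|^2 + 2 |b|^2] once on each side produces the constant 4. *)
Lemma represents_bound Z f : represents Z f -> nrm2 P Z <= 4 * nrm2 mu (weighted f).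
Proof.
move=> [sZ sf app]; apply/ler_addgt0Pr => e e0.
have [s [h1 h2]] := app (e / 8) (ltac:(lra)).
have i1 := sqintB sZ (sqint_process_comb s).
have := nrm2D i1 (sqint_process_comb s).
rewrite (eq_nrm2 P (W := Z)); last by move=> w; rewrite subrK.
rewrite weightedB in h2; have i2 := sqintB sf (sqint_trig_poly s).
have := nrm2D sf (sqintN i2); rewrite (eq_nrm2 mu (W := weighted (trig_poly s))); last first.
  by move=> u; rewrite opprB addrC subrK.
rewrite nrm2N.
have := process_comb_le s; lra.
Qed.

Lemma represents_sum I (r : seq I) (Z : I -> Omega -> R[i]) (f : I -> R -> R[i]) :
  (forall i, represents (Z i) (f i)) ->
  represents (fun w => \sum_(i <- r) Z i w) (fun u => \sum_(i <- r) f i u).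
Proof.
move=> rep; elim: r => [|i r IH].
  have := representsZ 0 (represents_process 0).
  by congr represents; apply/funext => x; rewrite mul0r big_nil.
by have := representsD (rep i) IH; congr represents; apply/funext => x; rewrite big_cons.
Qed.

End spectral_representation.

(** * Spectral functions of mean-square integrals *)

Section step_functions.
Context {R : realType}.
Local Notation mu := (@lebesgue_measure R).
Local Notation rintegrable f := (mu.-integrable setT (EFin \o f)).

(** Its integral is the Riemann sum of [F] with left tags, so that convergence of Riemann sums
    becomes a case of dominated convergence. *)
Definition step_fun (F : R -> R[i]) (a h : R) (n : nat) (x : R) : R[i] :=
  \sum_(i < n) (itv_indic (a + i%:R * h) (a + i.+1%:R * h) x)%:C * F (a + i%:R * h).

Lemma step_funE F a h n x : 0 < h -> a <= x < a + n%:R * h ->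
  exists2 y, `|x - y| < h & step_fun F a h n x = F y.
Proof.
move=> h0 /andP[ax xn].
have q0 : 0 <= (x - a) / h by rewrite divr_ge0; lra.
have /andP[k1 k2] := truncn_itv q0; set k := Num.truncn _ in k1 k2.
rewrite ler_pdivlMr // in k1; rewrite ltr_pdivrMr // in k2.
have kn : (k < n)%N.
  rewrite -(ltr_nat R) -(ltr_pM2r h0); lra.
exists (a + k%:R * h).
  rewrite -natr1 mulrDl mul1r in k2; rewrite ger0_norm; lra.
rewrite /step_fun (bigD1 (Ordinal kn)) //= big1 ?addr0; last first.
  move=> i ik; rewrite itv_indicE; case: ifPn; rewrite ?mul0r // => /andP[i1 i2].
  have l1 : (i < k.+1)%N by rewrite -(ltr_nat R) -(ltr_pM2r h0); lra.
  have l2 : (k < i.+1)%N by rewrite -(ltr_nat R) -(ltr_pM2r h0); lra.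
  by case/eqP: ik; apply: val_inj => /=; lia.
rewrite itv_indicE ifT ?mul1r //; lra.
Qed.

Lemma step_fun0 F a h n x : 0 < h -> ~~ (a <= x < a + n%:R * h) -> step_fun F a h n x = 0.
Proof.
move=> h0 xn; apply: big1 => i _; rewrite itv_indicE ifF ?mul0r //.
apply: contraNF xn => /andP[i1 i2].
have i0 : 0 <= i%:R * h by rewrite mulr_ge0 // ltW.
have : i.+1%:R * h <= n%:R * h by rewrite ler_wpM2r ?ler_nat // ltW.
by move=> i3; apply/andP; split; lra.
Qed.

Lemma cintegral_step_fun F a h n : 0 <= h ->
  cintegral mu (step_fun F a h n) = \sum_(i < n) h%:C * F (a + i%:R * h).
Proof.
move=> h0.
have iI (x y : R) : cintegrable mu (fun z => (itv_indic x y z)%:C).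
  exact: (cintegrable_real (rintegrable_itv x y)).
have iF (x y : R) (c : R[i]) : cintegrable mu (fun z => (itv_indic x y z)%:C * c).
  by under eq_fun do rewrite mulrC; apply: cintegrableZ.
rewrite /step_fun cintegral_sum //; apply: eq_bigr => i _.
under eq_cintegral do rewrite mulrC; rewrite cintegralZ // cintegral_real Rintegral_itv.
  rewrite mulrC; congr (_%:C * _); rewrite -[i.+1]addn1 natrD; ring.
by rewrite lerD2l ler_wpM2r // ler_nat.
Qed.

Lemma cmeasurable_step_fun F a h n : cmeasurable (step_fun F a h n).
Proof.
apply: cmeasurable_sum => i; apply: cmeasurableM; last exact: cmeasurable_cst.
by apply: cmeasurable_real; exact: measurable_itv_indic.
Qed.

End step_functions.

Section mean_square_integrals.
Context {R : realType} {d : measure_display} {Omega : measurableType d}.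
Variable P : probability Omega R.
Local Notation mu := (@lebesgue_measure R).
Local Notation rintegrable f := (mu.-integrable setT (EFin \o f)).

Variables (X : R -> Omega -> R[i]) (Rcov : R -> R[i]).
Hypotheses (sX : forall t, sqint P (X t)) (iRhat : cintegrable mu (fourier Rcov)).

(** The same Riemann sums are taken on both sides. Those of the process tend to [xi] in mean square
    by definition; those of [e^(i u x) conj (g x)] tend to [conj (g^ u)] for each [u] and are
    bounded by twice the integral of [H], hence they converge in the weighted norm. *)
Lemma represents_ms_integral (g : R -> R[i]) (H : R -> R) (r : R) (xi : Omega -> R[i]) :
  ccontinuous g -> rintegrable H -> 0 < r ->
  (forall x y, `|x - y| <= r -> normc (g y) <= H x) ->
  is_ms_integral P (fun t w => X t w * conjc (g t)) xi ->
  represents P X Rcov xi (fun u => conjc (fourier g u)).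
Proof.
move=> cg iH r0 gH [mxi [J hJ xiJ]].
have H0 x : 0 <= H x by apply: le_trans (normc_ge0 (g x)) (gH x x _); rewrite subrr normr0 ltW.
have ig : cintegrable mu g.
  apply: (@le_cintegrable _ _ _ mu _ H) => //; first exact: cmeasurable_continuous.
  by apply: aeW => x; apply: gH; rewrite subrr normr0 ltW.
pose F (u y : R) := cis (u * y) * conjc (g y).
pose mesh (M : nat) : R := M.+1%:R^-1.
have mesh0 M : 0 < mesh M by rewrite invr_gt0.
(* The number of steps of length [mesh M] from [- N] to [N]. *)
pose cnt (N M : nat) := (2 * N * M.+1)%N.
pose node (N M : nat) (i : nat) : R := - N%:R + i%:R * mesh M.
have cntE N M : - N%:R + (cnt N M)%:R * mesh M = N%:R.
  rewrite /cnt /mesh !natrM; field.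
  by rewrite addrC natr1 pnatr_eq0.
pose s (N M : nat) := [seq ((mesh M)%:C * conjc (g (node N M i)), node N M i)
  | i : 'I_(cnt N M) <- index_enum 'I_(cnt N M)].
have specE N M u : trig_poly (s N M) u = cintegral mu (step_fun (F u) (- N%:R) (mesh M) (cnt N M)).
  rewrite cintegral_step_fun ?ltW // /trig_poly big_map; apply: eq_bigr => i _.
  by rewrite /F /node /= -mulrA [conjc _ * _]mulrC.
have combE N M w : process_comb X (s N M) w =
    \sum_(i < cnt N M) (node N M i.+1 - node N M i)%:C * (X (node N M i) w * conjc (g (node N M i))).
  rewrite /process_comb big_map; apply: eq_bigr => i _ /=.
  rewrite (_ : node N M i.+1 - node N M i = mesh M); first by rewrite -mulrA [conjc _ * _]mulrC.
  by rewrite /node -[i.+1]addn1 natrD; ring.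
have app (e : R) : 0 < e -> exists sq, [/\ sqint P (fun w => xi w - process_comb X sq w),
      nrm2 P (fun w => xi w - process_comb X sq w) < e &
    nrm2 mu (weighted Rcov (fun u => conjc (fourier g u) - trig_poly sq u)) < e].
  move=> e0; have e8 : 0 < e / 8 by lra.
  have [A A0 hA] := xiJ _ e8.
  (* One mesh for each [N]: at most [r], so that [H] dominates; at most [mesh N], so that it shrinks
     as [N] grows; and fine enough for the mean-square integral over the interval from [- N] to
     [N]. *)
  have /choice[M hM] : forall N : nat, exists M : nat, [/\ mesh M <= r, mesh M <= mesh N &
      (mean_square P (fun w => (process_comb X (s N M) w - J (- N%:R) N%:R w)%R) < (e / 8)%:E)%E].
    move=> N; have N0 : 0 <= N%:R :> R by [].
    have [|_ /(_ _ e8)[dl dl0 hd]] := hJ (- N%:R) N%:R; first lra.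
    have m0 : 0 < Num.min dl r by rewrite lt_min dl0.
    have [M1 hM1] := normr_le_nat (Num.min dl r)^-1.
    pose M := (M1 + N)%N; exists M.
    have hm : mesh M < Num.min dl r.
      rewrite /mesh invf_plt ?posrE //; apply: le_lt_trans (ler_norm _) _.
      by apply: le_lt_trans hM1 _; rewrite ltr_nat ltnS leq_addr.
    move: hm; rewrite lt_min => /andP[hm1 hm2]; split; first exact: ltW.
      by rewrite /mesh lef_pV2 ?posrE // ler_nat ltnS leq_addl.
    have hstep i : node N M i.+1 - node N M i = mesh M by rewrite /node -[i.+1]addn1 natrD; ring.
    have -> : (fun w => process_comb X (s N M) w - J (- N%:R) N%:R w) = (fun w =>
      \sum_(i < cnt N M) (node N M i.+1 - node N M i)%:C * (X (node N M i) w * conjc (g (node N M i))) - J (- N%:R) N%:R w).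
      by apply/funext => w; rewrite combE.
    apply: (hd (cnt N M) (node N M) (node N M)).
    - by rewrite /node mul0r addr0.
    - exact: cntE.
    - by move=> i _; rewrite lexx /= -subr_ge0 hstep ltW.
    - by move=> i _; rewrite hstep.
  have mJ N : cmeasurable (J (- N%:R) N%:R).
    have N0 : 0 <= N%:R :> R by [].
    by have [|] := hJ (- N%:R) N%:R; first lra.
  have mcomb N : sqint P (process_comb X (s N (M N))) by exact: sqint_process_comb.
  have part1 N : A <= N%:R -> sqint P (fun w => xi w - process_comb X (s N (M N)) w) /\
      nrm2 P (fun w => xi w - process_comb X (s N (M N)) w) < e.
    move=> AN; have [_ _ h1] := hM N.
    have [|s1 n1] := sqint_lty _ h1.
      by apply: cmeasurableD; [have [] := mcomb N|exact: cmeasurableN].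
    have h2 := hA (- N%:R) N%:R ltac:(lra) AN.
    have [|s2 n2] := sqint_lty _ h2.
      by apply: cmeasurableD => //; exact: cmeasurableN.
    have := nrm2D s1 s2; have := sqintD s1 s2.
    have -> : (fun w => process_comb X (s N (M N)) w - J (- N%:R) N%:R w + (J (- N%:R) N%:R w - xi w)) =
        (fun w => - (xi w - process_comb X (s N (M N)) w)).
      by apply/funext => w; rewrite addrA subrK opprB.
    move=> /sqintN; under eq_fun do rewrite opprK.
    rewrite nrm2N.
    by move=> h3 h4; split => //; lra.
  pose G N u x := step_fun (F u) (- N%:R) (mesh (M N)) (cnt N (M N)) x.
  have GH N u x : normc (G N u x) <= H x.
    rewrite /G; have [xN|xN] := boolP (- N%:R <= x < - N%:R + (cnt N (M N))%:R * mesh (M N)).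
      have [y xy ->] := step_funE (F u) (mesh0 _) xN.
      rewrite Normc.normcM normc_cis mul1r normc_conj; apply: gH.
      by have [h _ _] := hM N; rewrite ltW // (lt_le_trans xy).
    by rewrite step_fun0 // Normc.normc0.
  have cF u : ccontinuous (F u).
    by apply: ccontinuousM; [exact: ccontinuous_cisZ|exact: ccontinuous_conj].
  have GF u x : ccvg (fun N => G N u x) (F u x).
    apply/ccvgP => e' e'0; have [dl dl0 hd] := (ccontinuous_atP _ _).1 (cF u x) e' e'0.
    have [N1 hN1] := normr_le_nat x; have [N2 hN2] := normr_le_nat dl^-1.
    exists (N1 + N2).+1 => N NN.
    have l1 : N1.+1%:R <= N%:R :> R by rewrite ler_nat (leq_ltn_trans (leq_addr N2 N1) NN).
    have l2 : N2%:R < N.+1%:R :> R by rewrite ltr_nat ltnS ltnW // (leq_ltn_trans (leq_addl N1 N2) NN).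
    have xN : - N%:R <= x < - N%:R + (cnt N (M N))%:R * mesh (M N).
      by rewrite cntE; move: hN1; rewrite ler_norml -natr1 in l1 * => /andP[x1 x2]; apply/andP; split; lra.
    rewrite /G; have [y xy ->] := step_funE (F u) (mesh0 _) xN.
    apply: hd; rewrite distrC; apply: (lt_trans xy).
    have [_ h _] := hM N; apply: le_lt_trans h _; rewrite /mesh invf_plt ?posrE //.
    by apply: le_lt_trans (ler_norm _) (le_lt_trans hN2 l2).
  have specF u : ccvg (fun N => trig_poly (s N (M N)) u) (conjc (fourier g u)).
    have -> : conjc (fourier g u) = cintegral mu (F u).
      rewrite /fourier -cintegral_conj; last exact: cintegrable_fourier.
      by apply: eq_cintegral => x; rewrite conjcM conj_cis opprK.
    apply: (eq_ccvg (fun N => esym (specE N (M N) u))).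
    apply: (@cdct _ _ _ mu _ _ H) => //.
    - by move=> N; exact: cmeasurable_step_fun.
    - exact: cmeasurable_continuous.
    - exact: GF.
    - by move=> N x; exact: GH.
  pose B := 2 * Rintegral mu setT H.
  have specB N u : normc (trig_poly (s N (M N)) u) <= B.
    rewrite specE; apply: normc_cintegral => //; last exact: GH.
    apply: (@le_cintegrable _ _ _ mu _ H) => //; first exact: cmeasurable_step_fun.
    by apply: aeW => x; exact: GH.
  have fB u : normc (conjc (fourier g u)) <= B.
    rewrite normc_conj; apply: normc_cintegral => //; first exact: cintegrable_fourier.
    by move=> x; rewrite Normc.normcM normc_cis mul1r gH // subrr normr0 ltW.
  have mf : cmeasurable (fun u => conjc (fourier g u)).
    by apply: cmeasurable_conj; apply: cmeasurable_continuous; exact: fourier_ccontinuous.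
  have md N : cmeasurable (fun u => conjc (fourier g u) - trig_poly (s N (M N)) u).
    by apply: cmeasurableD => //; apply: cmeasurableN; exact: cmeasurable_trig_poly.
  have part2 : nrm2 mu (weighted Rcov (fun u => conjc (fourier g u) - trig_poly (s N (M N)) u))
      @[N --> \oo] --> (0 : R).
    rewrite /nrm2 -[X in _ --> X](@Rintegral_cst0 _ _ _ mu).
    apply: (@Rdct _ _ _ mu _ _ (fun u => (2 * B) ^+ 2 * normc (fourier Rcov u))).
    - move=> N; apply: measurable_funX; apply: measurable_normc; exact: cmeasurable_weighted.
    - exact: measurable_cst.
    - apply: aeW => u; under eq_fun do rewrite sqr_normc_weighted.
      rewrite -(mul0r (normc (fourier Rcov u))); apply: cvgMl.
      rewrite -(mulr0 0); under eq_fun do rewrite expr2.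
      have h := ccvgD (ccvg_cst (conjc (fourier g u))) (ccvgN (specF u)).
      have := ccvg_normc h; rewrite subrr Normc.normc0 => h'; exact: cvgM.
    - by apply: rintegrableZ; exact: cintegrable_normc.
    - move=> N u; rewrite ger0_norm ?sqr_ge0 // sqr_normc_weighted ler_wpM2r ?normc_ge0 //.
      have := normcB (conjc (fourier g u)) (trig_poly (s N (M N)) u).
      have := specB N u; have := fB u; have := normc_ge0 (conjc (fourier g u) - trig_poly (s N (M N)) u).
      by move=> n0 b1 b2 b3; rewrite ler_pXn2r ?nnegrE //; lra.
  move/cvgrPdist_lt : part2 => /(_ e e0)[N1 _ hN1].
  have [N2 hN2] := normr_le_nat A.
  have [|p1 p2] := part1 (N1 + N2)%N.
    by apply: le_trans (ler_norm _) (le_trans hN2 _); rewrite ler_nat leq_addl.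
  exists (s (N1 + N2)%N (M (N1 + N2)%N)); split => //.
  have := hN1 (N1 + N2)%N (leq_addr _ _); rewrite /= sub0r normrN; apply: le_lt_trans.
  exact: ler_norm.
split.
- have [sq [h _ _]] := app 1 ltr01.
  by have := sqintD h (sqint_process_comb sX sq); under eq_fun do rewrite subrK.
- apply: (@sqint_weighted _ _ iRhat _ (2 * Rintegral mu setT (fun x => normc (g x)))).
  by apply: cmeasurable_conj; apply: cmeasurable_continuous; exact: fourier_ccontinuous.
  by move=> u; rewrite normc_conj; exact: normc_fourier.
- by move=> e /app[sq [_ h1 h2]]; exists sq.
Qed.

End mean_square_integrals.

(** * Uniform convergence in probability *)

Section level_sums.
Context {R : realType}.

(** [c] is one more than the truncation already reached. The value 0 stands for a row that is absent
    altogether, unlike [sym_sum 0], which contains the index 0. *)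
Lemma sym_sum_row_tail K c (F : int -> R[i]) : (c <= K.+1)%N ->
  normc (sym_sum K F - (if c is c'.+1 then sym_sum c' F else 0)) <=
  \sum_(c <= l < K.+1) (normc (F l%:Z) + normc (F (- l%:Z))).
Proof.
case: c => [_|c cK].
  rewrite subr0 sym_sum_pair (le_trans (normcD _ _)) // [leRHS]big_nat_recl //.
  apply: lerD; first by rewrite lerDl normc_ge0.
  rewrite big_add1 (le_trans (normc_sum _ _ _)) //; apply: ler_sum => i _.
  exact: normcD.
rewrite sym_sum_diff // (le_trans (normc_sum _ _ _)) //; apply: ler_sum => i _.
exact: normcD.
Qed.

(** The terms in the larger sum but not in the smaller one have indices inside the [q] by [q] square
    and outside the [N] by [N] block. The bound depends neither on [t] nor on the truncations. *)
Lemma level_tail (F : nat -> int -> R[i]) (b : nat -> nat -> R) (n0 n K N q : nat) (k : nat -> nat) :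
  (forall i (l : nat), normc (F i l%:Z) + normc (F i (- l%:Z)) <= b i l) ->
  (n0 <= n)%N -> (forall i, (i < n0)%N -> (k i <= K)%N) ->
  (N <= n0)%N -> (forall i, (i < N)%N -> (N <= (k i).+1)%N) ->
  (n <= q)%N -> (K < q)%N ->
  normc (\sum_(i < n) sym_sum K (F i) - \sum_(i < n0) sym_sum (k i) (F i)) <=
  \sum_(i < q) \sum_(l < q) b i l - \sum_(i < N) \sum_(l < N) b i l.
Proof.
move=> Fb n0n kK Nn0 Nk nq Kq.
have b0 i l : 0 <= b i l by apply: le_trans (Fb i l); rewrite addr_ge0 ?normc_ge0.
pose c i := if (i < n0)%N then (k i).+1 else 0%N.
(* The part of row [i] of the large square that lies outside the block; rows beyond [N] count in
   full. *)
pose r i := \sum_(0 <= l < q) b i l - (if (i < N)%N then \sum_(0 <= l < N) b i l else 0).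
have Nq : (N <= q)%N by lia.
have r0 i : 0 <= r i.
  rewrite /r; case: ifP => _; last by rewrite subr0 sumr_ge0.
  by rewrite [X in X - _](big_cat_nat (n := N)) //= addrAC subrr add0r sumr_ge0.
have row i : (i < n)%N -> normc (sym_sum K (F i) - (if (i < n0)%N then sym_sum (k i) (F i) else 0)) <= r i.
  move=> _; have ci : (c i <= K.+1)%N by rewrite /c; case: ifP => // /kK.
  have -> : (if (i < n0)%N then sym_sum (k i) (F i) else 0) =
      (if c i is c'.+1 then sym_sum c' (F i) else 0) by rewrite /c; case: ifP.
  apply: (le_trans (sym_sum_row_tail (F i) ci)).
  apply: (@le_trans _ _ (\sum_(c i <= l < K.+1) b i l)); first by apply: ler_sum => l _.
  rewrite /r; case: ifP => iN.
    rewrite [X in X - _](big_cat_nat (n := N)) //= addrAC subrr add0r.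
    have Nc : (N <= c i)%N by rewrite /c (leq_trans iN Nn0); exact: Nk.
    rewrite (big_cat_nat Nc (n := c i) (p := q)) /=; last by lia.
    rewrite [X in _ + X](big_cat_nat (n := K.+1)) //=.
    have := @sumr_ge0 _ _ (index_iota N (c i)) xpredT (b i) (fun l _ => b0 i l).
    have := @sumr_ge0 _ _ (index_iota K.+1 q) xpredT (b i) (fun l _ => b0 i l).
    lra.
  rewrite subr0 (big_cat_nat (n := c i) (p := q)) //=; last by lia.
  rewrite [X in _ + X](big_cat_nat (n := K.+1)) //=.
  have := @sumr_ge0 _ _ (index_iota 0 (c i)) xpredT (b i) (fun l _ => b0 i l).
  have := @sumr_ge0 _ _ (index_iota K.+1 q) xpredT (b i) (fun l _ => b0 i l).
  lra.
have -> : \sum_(i < n0) sym_sum (k i) (F i) =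
    \sum_(i < n) (if (i < n0)%N then sym_sum (k i) (F i) else 0).
  by rewrite (big_ord_widen n (fun i => sym_sum (k i) (F i)) n0n) big_mkcond.
rewrite -sumrB (le_trans (normc_sum _ _ _)) //.
apply: (@le_trans _ _ (\sum_(i < n) r i)); first by apply: ler_sum => i _; exact: row.
apply: (@le_trans _ _ (\sum_(0 <= i < q) r i)).
  rewrite -(big_mkord xpredT r) [leRHS](big_cat_nat (n := n)) //= lerDl.
  exact: sumr_ge0.
rewrite big_mkord /r sumrB; apply: lerB; first by apply: ler_sum => i _; rewrite big_mkord.
rewrite (big_ord_widen q (fun i => \sum_(l < N) b i l) Nq) big_mkcond /=.
by apply: ler_sum => i _; case: ifP => // _; rewrite big_mkord.
Qed.

End level_sums.

Section probability_bounds.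
Context {R : realType} {d : measure_display} {Omega : measurableType d}.
Variable P : probability Omega R.
Local Notation rintegrable f := (P.-integrable setT (EFin \o f)).

Lemma markov_lt (Y : Omega -> R) (e : R) : rintegrable Y -> (forall w, 0 <= Y w) -> 0 < e ->
  (P [set w | (e < Y w)%R] <= (Rintegral P setT Y / e)%:E)%E.
Proof.
move=> iY Y0 e0; have mY : measurable_fun setT Y by move/measurable_int : iY => /measurable_EFinP.
have mA : measurable [set w | e < Y w].
  rewrite (_ : [set w | e < Y w] = Y @^-1` `]e, +oo[); last by apply/seteqP; split => w /=; rewrite in_itv /= andbT.
  by rewrite -[X in measurable X]setTI; apply: mY => //; exact: measurable_itv.
suff : (e%:E * P [set w | (e < Y w)%R] <= (Rintegral P setT Y)%:E)%E.
  rewrite -(fineK (fin_num_measure P _ mA)) -EFinM !lee_fin => h.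
  by rewrite ler_pdivlMr // mulrC.
rewrite EFin_Rintegral //.
have -> : (e%:E * P [set w | (e < Y w)%R] = \int[P]_(w in [set w | (e < Y w)%R]) (cst e%:E) w)%E.
  by rewrite integral_cst.
apply: (@le_trans _ _ (\int[P]_(w in [set w | (e < Y w)%R]) (Y w)%:E)%E).
  apply: ge0_le_integral => //.
  - by move=> w _; rewrite lee_fin ltW.
  - by apply/measurable_EFinP; exact: measurable_funTS.
  - by move=> w /=; rewrite lee_fin => /ltW.
apply: ge0_subset_integral => //.
- exact/measurable_EFinP.
- by move=> w _; rewrite lee_fin.
Qed.

Lemma chebyshev_lt (Z : Omega -> R[i]) (r : R) : sqint P Z -> 0 < r ->
  (P [set w | (r < normc (Z w))%R] <= (nrm2 P Z / r ^+ 2)%:E)%E.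
Proof.
move=> [mZ iZ] r0.
have := markov_lt iZ (fun w => sqr_ge0 _) (exprn_gt0 2 r0).
rewrite (_ : [set w | r ^+ 2 < normc (Z w) ^+ 2] = [set w | r < normc (Z w)]) //.
by apply/seteqP; split => w /=; rewrite ltr_pXn2r ?nnegrE ?normc_ge0 // ltW.
Qed.

Lemma rintegrable_cst (c : R) : rintegrable (fun=> c).
Proof. exact: finite_measure_integrable_cst. Qed.

Lemma sqint_normc (Z : Omega -> R[i]) : sqint P Z -> rintegrable (fun w => normc (Z w)).
Proof.
move=> [mZ iZ]; apply: (@le_rintegrable _ _ _ P _ (fun w => normc (Z w) ^+ 2 + 1)).
- exact: measurable_normc.
- move=> w; rewrite ger0_norm ?normc_ge0 //.
  by have := sqr_ge0 (normc (Z w) - 1); have := normc_ge0 (Z w); nra.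
- by apply: rintegrableD => //; exact: rintegrable_cst.
Qed.

(* AM-GM; the choice of [c] balances the two terms. *)
Lemma expectation_normc (Z : Omega -> R[i]) (c : R) : sqint P Z -> 0 < c ->
  Rintegral P setT (fun w => normc (Z w)) <= (c * nrm2 P Z + c^-1) / 2.
Proof.
move=> sZ c0; have [mZ iZ] := sZ.
have i1 := rintegrableZ (c / 2) iZ; have i2 := rintegrable_cst (c^-1 / 2).
have -> : (c * nrm2 P Z + c^-1) / 2 = Rintegral P setT (fun w => c / 2 * normc (Z w) ^+ 2 + c^-1 / 2).
  rewrite (RintegralD measurableT i1 i2) (RintegralZl _ measurableT iZ) Rintegral_cst //.
  by rewrite -/(nrm2 P Z) /= probability_setT /=; field; lra.
apply: le_Rintegral => //; first exact: sqint_normc.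
  exact: rintegrableD.
move=> w _; have h := sqr_ge0 (c * normc (Z w) - 1).
rewrite -subr_ge0 (_ : _ - _ = (c * normc (Z w) - 1) ^+ 2 / (2 * c)); first by rewrite divr_ge0 //; lra.
by field; lra.
Qed.

End probability_bounds.

Section uniform_convergence.
Context {R : realType} {d : measure_display} {Omega : measurableType d}.
Variable P : probability Omega R.
Local Notation rintegrable f := (P.-integrable setT (EFin \o f)).

Lemma closed_normc_ball (z : R[i]) (r : R) :
  closed [set p : R * R | (p.1 - complex.Re z) ^+ 2 + (p.2 - complex.Im z) ^+ 2 <= r].
Proof.
pose f (p : R * R) : R := (p.1 - complex.Re z) ^+ 2 + (p.2 - complex.Im z) ^+ 2.
have cf : continuous f.
  move=> p; rewrite /f; under eq_fun do rewrite !expr2; rewrite ?expr2.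
  have c1 : (q.1 - complex.Re z) @[q --> p] --> p.1 - complex.Re z.
    by apply: cvgB; [exact: cvg_fst|exact: cvg_cst].
  have c2 : (q.2 - complex.Im z) @[q --> p] --> p.2 - complex.Im z.
    by apply: cvgB; [exact: cvg_snd|exact: cvg_cst].
  exact: (cvgD (cvgM c1 c1) (cvgM c2 c2)).
rewrite (_ : [set p | _] = f @^-1` [set x | x <= r]); last by [].
by apply: closed_comp; [move=> p _; exact: cf|exact: closed_le].
Qed.

Variables (X : R -> Omega -> R[i]) (Z : nat -> int -> Omega -> R[i])
  (theta : nat -> int -> R -> R[i]) (a : nat -> nat -> R) (B : nat) (C : R).

Definition level_sum (n : nat) (k : nat -> nat) (t : R) (w : Omega) : R[i] :=
  \sum_(i < n) sym_sum (k i) (fun l => Z i l w * theta i l t).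

Hypotheses (sX : forall t, sqint P (X t)) (sZ : forall i l, sqint P (Z i l))
  (ct : forall i l, ccontinuous (theta i l))
  (thetaB : forall i l t, `|t| <= B%:R -> normc (theta i l t) <= a i `|l|%N)
  (betaC : forall q, \sum_(i < q) \sum_(l < q)
    (Rintegral P setT (fun w => normc (Z i l%:Z w)) +
     Rintegral P setT (fun w => normc (Z i (- l%:Z) w))) * a i l <= C)
  (Xapp : forall t e, 0 < e -> exists N, forall n, (N <= n)%N ->
    exists K0, forall K, (K0 <= K)%N ->
      nrm2 P (fun w => X t w - level_sum n (fun=> K) t w) < e)
  (sepX : separable_process P X).

Let b i l w := (normc (Z i l%:Z w) + normc (Z i (- l%:Z) w)) * a i l.
Let S q w := \sum_(i < q) \sum_(l < q) b i l w.

Let a0 i l : 0 <= a i l.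
Proof.
have := @thetaB i l%:Z 0; rewrite normr0 => /(_ (ler0n _ _)) h.
exact: le_trans (normc_ge0 _) h.
Qed.

Let b0 i l w : 0 <= b i l w.
Proof. by rewrite mulr_ge0 // addr_ge0 ?normc_ge0. Qed.

Let rb i l : rintegrable (b i l).
Proof.
have h := rintegrableZ (a i l) (rintegrableD (sqint_normc (sZ i l%:Z)) (sqint_normc (sZ i (- l%:Z)))).
by have := h; congr (P.-integrable _ _); apply/funext => w; rewrite /= mulrC.
Qed.

Let rsum I (r : seq I) (F : I -> Omega -> R) : (forall i, rintegrable (F i)) ->
  rintegrable (fun w => \sum_(i <- r) F i w).
Proof.
move=> rF; elim: r => [|i r IH].
  by under eq_fun do rewrite big_nil; exact: rintegrable_cst.
by under eq_fun do rewrite big_cons; exact: rintegrableD.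
Qed.

Let rS q : rintegrable (S q).
Proof. by apply: rsum => i; exact: rsum. Qed.

Let Sd w : {homo (fun q => S q w) : q q' / (q <= q')%N >-> q <= q'}.
Proof.
move=> q q' qq'; rewrite /S (big_ord_widen q' (fun i => \sum_(l < q) b i l w) qq') big_mkcond /=.
apply: ler_sum => i _; case: ifP => _; last by exact: sumr_ge0.
rewrite (big_ord_widen q' (fun l => b i l w) qq') big_mkcond /=.
by apply: ler_sum => l _; case: ifP.
Qed.

Let ES q : Rintegral P setT (S q) <= C.
Proof.
apply: le_trans (betaC q); rewrite /S Rintegral_sum; last by move=> i; exact: rsum.
apply: ler_sum => i _; rewrite Rintegral_sum //; apply: ler_sum => l _.
have i1 := sqint_normc (sZ i l%:Z); have i2 := sqint_normc (sZ i (- l%:Z)).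
by rewrite (RintegralZr _ measurableT (rintegrableD i1 i2)) RintegralD.
Qed.

Let mlt (Y : Omega -> R) (e : R) : measurable_fun setT Y -> measurable [set w | e < Y w].
Proof.
move=> mY; rewrite (_ : [set w | e < Y w] = Y @^-1` `]e, +oo[); last first.
  by apply/seteqP; split => w /=; rewrite in_itv /= andbT.
by rewrite -[X in measurable X]setTI; apply: mY => //; exact: measurable_itv.
Qed.

(** The expectations of [S q] increase and are bounded, so [N] can be chosen with all later
    increments at most [delta * e]. Markov's inequality bounds each event [A q]; these events
    increase with [q], so their union obeys the same bound. *)
Lemma uniform_tails (e delta : R) : 0 < e -> 0 < delta -> exists (N : nat) (A : set Omega),
  [/\ measurable A, (P A <= delta%:E)%E &
    forall w q, ~ A w -> (N <= q)%N -> S q w - S N w <= e].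
Proof.
move=> e0 delta0.
pose E q := Rintegral P setT (S q).
have Ed : {homo E : q q' / (q <= q')%N >-> q <= q'}.
  by move=> q q' qq'; apply: le_Rintegral; [by []|exact: rS|exact: rS|move=> w _; exact: Sd].
have Eb : has_ubound (range E) by exists C => _ [q _ <-]; exact: ES.
have cE := nondecreasing_is_cvgn Ed Eb.
have [N hN] : exists N, forall q, (N <= q)%N -> E q - E N <= delta * e.
  have /cvgrPdist_lt/(_ _ (mulr_gt0 delta0 e0))[N _ hN] := cE.
  exists N => q Nq; have := hN N (leqnn N).
  have := nondecreasing_cvgn_le Ed cE q; have := ler_norm (limn E - E N); lra.
pose A q := [set w | e < S (N + q)%N w - S N w].
have rSS q : rintegrable (fun w => S (N + q)%N w - S N w) by exact: rintegrableB.
have mA q : measurable (A q).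
  by apply: mlt; move/measurable_int : (rSS q) => /measurable_EFinP.
have Ad : nondecreasing_seq A.
  move=> q q' qq'; apply/subsetPset => w; rewrite /A /=.
  by have := @Sd w (N + q)%N (N + q')%N ltac:(lia); lra.
exists N, (\bigcup_q A q); split; first exact: bigcupT_measurable.
- apply: (cvge_to_le (nondecreasing_cvg_mu mA (bigcupT_measurable _ mA) Ad)).
  apply: nearW => q /=.
  have := @markov_lt _ _ _ P _ e (rSS q) (fun w => _) e0 => h.
  apply: le_trans (h _) _.
    by move=> w; rewrite subr_ge0; apply: Sd; exact: leq_addr.
  rewrite lee_fin ler_pdivrMr // (RintegralB measurableT (rS _) (rS _)).
  exact: hN (leq_addr _ _).
- move=> w q nA Nq; rewrite leNgt; apply/negP => h; apply: nA.
  by exists (q - N)%N => //; rewrite /A /= subnKC.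
Qed.

Let sqint_level_sum n k t : sqint P (level_sum n k t).
Proof.
rewrite /level_sum; apply: sqint_sum => i; rewrite /sym_sum; apply: sqint_sum => l.
by under eq_fun do rewrite mulrC; apply: sqintZ.
Qed.

Let continuous_level_sum n k w : ccontinuous (fun t => level_sum n k t w).
Proof.
apply: ccontinuous_sum => i; apply: ccontinuous_sum => l.
by apply: ccontinuousM => //; exact: ccontinuous_cst.
Qed.

Let bFb t i (l : nat) w : `|t| <= B%:R ->
  normc (Z i l%:Z w * theta i l%:Z t) + normc (Z i (- l%:Z) w * theta i (- l%:Z) t) <= b i l w.
Proof.
move=> tB; rewrite !Normc.normcM /b mulrDl.
apply: lerD; rewrite ler_wpM2l ?normc_ge0 //; apply: le_trans (thetaB _ _ tB) _ => //.
by rewrite abszN.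
Qed.

(* The approximants at [(n, K)] differ from [level_sum n0 k] by at most [e] off
   [A], uniformly in [n] and [K]; as they converge in mean square to [X t], so
   does [X t], up to a null set depending on [t]. *)
Let pointwise_negligible (e : R) N A n0 (k : nat -> nat) t :
  measurable A -> (forall w q, ~ A w -> (N <= q)%N -> S q w - S N w <= e) ->
  (N <= n0)%N -> (forall i, (i < N)%N -> (N <= (k i).+1)%N) -> `|t| <= B%:R ->
  P.-negligible [set w | ~ A w /\ e < normc (X t w - level_sum n0 k t w)].
Proof.
move=> mA hA Nn0 Nk tB.
pose D w : R := normc (X t w - level_sum n0 k t w).
(* A strict excess over [e] leaves a margin [1 / (j + 1)] for some [j], and on this margin
   Chebyshev's inequality can act. *)
pose F j := [set w | ~ A w /\ e + j.+1%:R^-1 < D w].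
have sD : sqint P (fun w => X t w - level_sum n0 k t w) by exact: sqintB.
have mD : measurable_fun setT D by apply: measurable_normc; have [] := sD.
have mF j : measurable (F j).
  rewrite (_ : F j = ~` A `&` [set w | e + j.+1%:R^-1 < D w]); last by [].
  by apply: measurableI; [exact: measurableC|exact: mlt].
apply: (@negligibleS _ _ _ P (\bigcup_j F j)).
  move=> w [nA]; rewrite -/(D w) => eD.
  have h : 0 < D w - e by rewrite subr_gt0.
  have [M hM] := normr_le_nat (D w - e)^-1; exists M => //; split => //.
  rewrite addrC -ltrBrDr.
  rewrite invf_plt ?posrE //; apply: le_lt_trans (ler_norm _) (le_lt_trans hM _).
  by rewrite ltr_nat.
apply: negligible_bigcup => j; apply/negligibleP => //.
pose r : R := j.+1%:R^-1; have r0 : 0 < r by rewrite invr_gt0.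
apply/eqP; rewrite eq_le measure_ge0 andbT; apply/lee_addgt0Pr => c c0; rewrite add0e.
have [N1 hN1] := Xapp t (mulr_gt0 c0 (exprn_gt0 2 r0)).
pose n := (N1 + n0)%N; have [K0 hK0] := hN1 n (leq_addr _ _).
(* Large enough for the mean-square approximation and for the rectangular sum to contain
   [level_sum n0 k], as [level_tail] requires. *)
pose K := (K0 + \max_(i < n0) k i)%N.
have hK := hK0 K (leq_addr _ _).
have sDK : sqint P (fun w => X t w - level_sum n (fun=> K) t w) by exact: sqintB.
apply: (@le_trans _ _ (P [set w | (r < normc (X t w - level_sum n (fun=> K) t w))%R])).
  apply: le_measure; rewrite ?inE //.
    by apply: mlt; apply: measurable_normc; have [] := sDK.
  move=> w [nA] /=; rewrite -[_^-1]/r /D => eD.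
  have h : normc (level_sum n (fun=> K) t w - level_sum n0 k t w) <= e.
    apply: le_trans (hA w (n + K.+1 + N)%N nA (leq_addl _ _)).
    apply: (@level_tail R (fun i l => Z i l w * theta i l t) (fun i l => b i l w)) => //.
    - by move=> i l; exact: bFb.
    - exact: leq_addl.
    - move=> i i0; rewrite /K (leq_trans _ (leq_addl _ _)) //.
      exact: (leq_bigmax (Ordinal i0)).
    - by lia.
    - by lia.
  have := normcD (X t w - level_sum n (fun=> K) t w) (level_sum n (fun=> K) t w - level_sum n0 k t w).
  by rewrite addrA subrK; lra.
apply: le_trans (chebyshev_lt sDK r0) _.
by rewrite lee_fin ler_pdivrMr ?exprn_gt0 // ltW.
Qed.

(** The exceptional null sets, one for each time, are united over the countable separating set only;
    separability and the continuity of the partial sum carry the bound to all other times. *)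
Lemma uniform_bound (e : R) N A n0 (k : nat -> nat) (T : R) :
  0 < e -> measurable A -> (forall w q, ~ A w -> (N <= q)%N -> S q w - S N w <= e) ->
  (N <= n0)%N -> (forall i, (i < N)%N -> (N <= (k i).+1)%N) -> T + 1 <= B%:R ->
  exists2 Q, P.-negligible Q & forall w t, ~ A w -> ~ Q w -> 0 <= t <= T ->
    normc (X t w - level_sum n0 k t w) <= e.
Proof.
move=> e0 mA hA Nn0 Nk TB.
have [D [Q [/countable_injP[f finj] _ nQ sep]]] := sepX.
pose bad t := [set w | ~ A w /\ e < normc (X t w - level_sum n0 k t w)].
(* The separating set is enumerated through its injection [f] into [nat]; a number that is not
   attained contributes the empty set. *)
pose G n := [set w | exists t, [/\ D t, `|t| <= B%:R, f t = n & bad t w]].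
have nG n : P.-negligible (G n).
  have [[t0 [Dt0 t0B ft0]]|h] := pselect (exists t, [/\ D t, `|t| <= B%:R & f t = n]).
    apply: (@negligibleS _ _ _ P (bad t0)); last exact: (pointwise_negligible mA hA).
    move=> w [t [Dt tB ft bt]]; suff <- : t = t0 by [].
    by apply: finj; rewrite ?inE // ft ft0.
  apply: (@negligibleS _ _ _ P set0); last exact: negligible_set0.
  by move=> w [t [Dt tB ft _]]; apply: h; exists t.
exists ((\bigcup_n G n) `|` Q).
  by apply: negligibleU => //; exact: negligible_bigcup.
move=> w t nA nGQ /andP[t0 tT].
have goodD s : D s -> `|s| <= B%:R -> normc (X s w - level_sum n0 k s w) <= e.
  move=> Ds sB; rewrite leNgt; apply/negP => h; apply: nGQ; left.
  by exists (f s) => //; exists s.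
apply/ler_addgt0Pr => r r0.
have [dl dl0 hd] := (ccontinuous_atP _ _).1 (@continuous_level_sum n0 k w t) r r0.
have m0 : 0 < Num.min dl 1 by rewrite lt_min dl0 ltr01.
set z := level_sum n0 k t w.
(* A closed ball about the partial sum at the fixed time [t]. The extra radius [r] allows for the
   variation of the partial sum over the short interval, so the process lies in the ball at all
   nearby separating times, hence at [t]. *)
pose K := [set p : R * R | (p.1 - complex.Re z) ^+ 2 + (p.2 - complex.Im z) ^+ 2 <= (e + r) ^+ 2].
have KE y : K (complex.Re y, complex.Im y) <-> normc (y - z) <= e + r.
  have er0 : 0 <= e + r by lra.
  rewrite -(@ler_pXn2r _ 2) ?nnegrE ?normc_ge0 //.
  by rewrite sqr_normcE ReD ImD ReN ImN.
apply/KE.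
have inI s : s \in `]t - Num.min dl 1, t + Num.min dl 1[ -> `|s - t| < dl /\ `|s - t| < 1.
  rewrite in_itv /= => /andP[s1 s2].
  have h : `|s - t| < Num.min dl 1 by rewrite ltr_norml; apply/andP; split; lra.
  by move: h; rewrite lt_min => /andP[].
apply: contrapT => nK; apply: nGQ; right.
have cK : closed K by exact: closed_normc_ball.
have := sep (t - Num.min dl 1) (t + Num.min dl 1) K cK w.
apply; split => /=.
  move=> s sI Ds; apply/KE; have [s1 s2] := inI s sI.
  have sB : `|s| <= B%:R.
    by move: s2; rewrite ltr_norml ler_norml => /andP[s3 s4]; apply/andP; split; lra.
  have h1 := goodD s Ds sB; have h2 := hd s s1.
  have := normcD (X s w - level_sum n0 k s w) (level_sum n0 k s w - z).
  by rewrite addrA subrK /z; lra.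
move=> h; apply: nK; apply: h; rewrite in_itv /=; apply/andP; split; lra.
Qed.

(** Outer measure is estimated by covering the event with [A] and a measurable null set. The unit of
    room between [T] and [B] accommodates the separating times near [T]. *)
Theorem uniform_convergence_in_probability (n : nat -> nat) (k : nat -> nat -> nat) (T eps : R) :
  (forall N, exists m0, forall m, (m0 <= m)%N -> (N <= n m)%N) ->
  (forall N i, exists m0, forall m, (m0 <= m)%N -> (N <= (k m i).+1)%N) ->
  T + 1 <= B%:R -> 0 < eps ->
  mu_ext P [set w | (eps%:E < ereal_sup
    [set (normc (X t w - level_sum (n m) (k m) t w))%:E | t in `[0%R, T]%classic])%E]
    @[m --> \oo] --> (0 : \bar R).
Proof.
move=> ninf kinf TB eps0.
pose ev m : set Omega := [set w | (eps%:E < ereal_sup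
    [set (normc (X t w - level_sum (n m) (k m) t w))%:E | t in `[0%R, T]%classic])%E].
change (mu_ext P (ev m) @[m --> \oo] --> (0 : \bar R)).
have key (delta : R) : 0 < delta -> exists m0, forall m, (m0 <= m)%N -> (mu_ext P (ev m) <= delta%:E)%E.
  move=> delta0; have e2 : 0 < eps / 2 by lra.
  have [N [A [mA PA hA]]] := uniform_tails e2 delta0.
  have [m1 hm1] := ninf N; have /choice[m2 hm2] := kinf N.
  exists (m1 + \max_(i < N) m2 i)%N => m mm.
  have [|i iN||Q nQ hQ] := uniform_bound (n0 := n m) (k := k m) (T := T) e2 mA hA => //.
  - by apply: hm1; apply: leq_trans mm; exact: leq_addr.
  - apply: hm2; apply: leq_trans mm; apply: leq_trans (leq_addl _ _).
    exact: (leq_bigmax (Ordinal iN)).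
  have [Q' [mQ' Q'0 QQ']] := nQ.
  apply: (@le_trans _ _ (mu_ext P (A `|` Q'))).
    apply: le_mu_ext => w; rewrite /ev /= => evw.
    apply: contrapT => /not_orP[nA nQ'].
    have nQw : ~ Q w by move/QQ'.
    move: evw; apply/negP; rewrite -leNgt; apply: ub_ereal_sup => _ [t tT <-].
    move: tT; rewrite /= in_itv /= => tT.
    by rewrite lee_fin; have := hQ w t nA nQw tT; lra.
  rewrite measurable_mu_extE; last exact: measurableU.
  apply: le_trans (measureU2 _ _ _) _ => //.
  by rewrite [X in (_ + X)%E](_ : _ = 0%E) // adde0.
have ge0 m : (0 <= mu_ext P (ev m))%E by exact: mu_ext_ge0.
have [M hM] := key 1 ltr01.
apply/fine_cvgP; split.
  exists M => // m Mm /=; rewrite ge0_fin_numE //; apply: le_lt_trans (hM m Mm) _.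
  by rewrite ltry.
apply/cvgrPdist_le => delta delta0; have [m0 hm0] := key delta delta0.
exists m0 => // m mm /=; rewrite sub0r normrN ger0_norm ?fine_ge0 //.
rewrite -lee_fin fineK; first exact: hm0.
by rewrite ge0_fin_numE //; apply: le_lt_trans (hm0 m mm) _; rewrite ltry.
Qed.

End uniform_convergence.

(** * Moments of the wavelet coefficients and the approximation in the weighted norm *)

Section wavelet_coefficients.
Context {R : realType}.
Local Notation mu := (@lebesgue_measure R).
Local Notation rintegrable f := (mu.-integrable setT (EFin \o f)).

Lemma gaussian_process_sqint d (Omega : measurableType d) (P : probability Omega R)
  (X : R -> Omega -> R[i]) t : gaussian_process P X -> sqint P (X t).
Proof.
move=> gX.
have gRe : gaussian_rv P (fun w => complex.Re (X t w)).
  have := gX 1%N (fun=> t) (fun=> 1) (fun=> 0); congr (gaussian_rv P _).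
  by apply/funext => w; rewrite big_ord1 mul1r mul0r addr0.
have gIm : gaussian_rv P (fun w => complex.Im (X t w)).
  have := gX 1%N (fun=> t) (fun=> 0) (fun=> 1); congr (gaussian_rv P _).
  by apply/funext => w; rewrite big_ord1 mul1r mul0r add0r.
have [mRe _] := gRe; have [mIm _] := gIm; split => //.
under eq_fun do rewrite sqr_normcE; apply: rintegrableD.
  apply: ge0_rintegrable; [exact: measurable_funX|by move=> w; exact: sqr_ge0|].
  exact: gaussian_sqr_lty gRe.
apply: ge0_rintegrable; [exact: measurable_funX|by move=> w; exact: sqr_ge0|].
exact: gaussian_sqr_lty gIm.
Qed.

Lemma moment_rintegrable (f : R -> R[i]) : cmeasurable f ->
  (\int[mu]_z (normc (f z) * `|z| ^+ 4)%:E < +oo)%E -> rintegrable (fun z => normc (f z) * `|z| ^+ 4).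
Proof.
move=> mf fm; apply: ge0_rintegrable => //; last by move=> z; rewrite mulr_ge0 ?normc_ge0 ?exprn_ge0.
apply: measurable_funM; first exact: measurable_normc.
exact: (measurable_funX 4 (@normr_measurable R setT)).
Qed.

(** The uniform bound controls [|z| < 1], and elsewhere [|z|^4 >= 1]. *)
Lemma bounded_moment_cintegrable (f : R -> R[i]) (M : R) : cmeasurable f ->
  (forall z, normc (f z) <= M) ->
  (\int[mu]_z (normc (f z) * `|z| ^+ 4)%:E < +oo)%E -> cintegrable mu f.
Proof.
move=> mf fM fm; have im := moment_rintegrable mf fm.
have M0 : 0 <= M := le_trans (normc_ge0 _) (fM 0).
apply: (@le_cintegrable _ _ _ mu _ (fun z => M * itv_indic (-1) 1 z + normc (f z) * `|z| ^+ 4)) => //.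
  apply: aeW => z; have n0 := normc_ge0 (f z).
  have p0 : 0 <= normc (f z) * `|z| ^+ 4 by rewrite mulr_ge0 // exprn_ge0.
  have [z1|z1] := ltP `|z| 1.
    rewrite itv_indicE ifT; last by move: z1; rewrite ltr_norml => /andP[? ?]; apply/andP; split; lra.
    by rewrite mulr1; have := fM z; lra.
  have : normc (f z) <= normc (f z) * `|z| ^+ 4 by rewrite ler_peMr // exprn_ege1.
  have : 0 <= M * itv_indic (-1) 1 z by rewrite mulr_ge0 // itv_indicE; case: ifP.
  lra.
by apply: rintegrableD => //; apply: rintegrableZ; exact: rintegrable_itv.
Qed.

Lemma dilateE (g : R -> R[i]) (j : nat) (l : int) x :
  dilate g j%:Z l x = (2 `^ (j%:R / 2))%:C * g (2 ^+ j * x + - l%:~R).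
Proof. by []. Qed.

Lemma powR_half_sqr (j : nat) : (2 `^ (j%:R / 2)) * (2 `^ (j%:R / 2)) = 2 ^+ j :> R.
Proof.
rewrite -powRD; last by apply/implyP.
by rewrite (_ : j%:R / 2 + j%:R / 2 = j%:R) ?powR_mulrn //; field.
Qed.

(** The additional factor [2^(j/2)] joins the one in [dilate]; together they cancel the Jacobian
    [2^-j]. *)
Lemma fourier_dilate (g : R -> R[i]) (j : nat) (l : int) u : cintegrable mu g ->
  (2 `^ (j%:R / 2))%:C * fourier (dilate g j%:Z l) u =
  cis (- (u / 2 ^+ j * l%:~R)) * fourier g (u / 2 ^+ j).
Proof.
move=> ig; set c := 2 `^ _; set v := u / 2 ^+ j.
have j0 : 0 < 2 ^+ j :> R by rewrite exprn_gt0.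
pose h x := cis (- (v * x)) * g x.
have ih : cintegrable mu h by exact: cintegrable_fourier.
have ih' := cintegrable_affine (- l%:~R) j0 ih.
rewrite /fourier (eq_cintegral mu (g := fun x => (c%:C * cis (- (v * l%:~R))) * h (2 ^+ j * x + - l%:~R))).
  rewrite cintegralZ // (cintegral_affine _ j0 ih) -/(fourier g v).
  rewrite !mulrA -[c%:C * c%:C]realcM powR_half_sqr.
  have e1 : (2 ^+ j)%:C * (2 ^- j)%:C = 1 :> R[i] by rewrite -realcM divff ?gt_eqF.
  set E := cis _; transitivity ((2 ^+ j)%:C * (2 ^- j)%:C * (E * fourier g v)); first by ring.
  by rewrite e1 mul1r.
move=> x; rewrite dilateE /h -/c !mulrA; congr (_ * g _).
rewrite [cis _ * c%:C]mulrC -[in RHS]mulrA -cisD; congr (_ * cis _).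
by rewrite /v; field; rewrite gt_eqF.
Qed.

Lemma represents_dilate d (Omega : measurableType d) (P : probability Omega R)
    (X : R -> Omega -> R[i]) (Rcov : R -> R[i]) (g : R -> R[i]) (j : nat) (l : int)
    (xi : Omega -> R[i]) :
  (forall t, sqint P (X t)) -> cintegrable mu (fourier Rcov) ->
  ccontinuous g -> assumption_S g ->
  is_ms_integral P (fun t w => X t w * conjc (dilate g j%:Z l t)) xi ->
  represents P X Rcov (fun w => (2 `^ (j%:R / 2))%:C * xi w)
    (fun u => cis (u / 2 ^+ j * l%:~R) * conjc (fourier g (u / 2 ^+ j))).
Proof.
move=> sX iRhat cg Sg msxi.
have ig := assumption_S_cintegrable cg Sg.
have [H iH gH] := assumption_S_local_bound cg Sg.
have j0 : 0 < 2 ^+ j :> R by rewrite exprn_gt0.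
set c := 2 `^ _ : R; have c0 : 0 <= c by rewrite powR_ge0.
have : represents P X Rcov xi (fun u => conjc (fourier (dilate g j%:Z l) u)).
  (* The local majorant of [g] works at distance 1; after dilation it works at distance [2^-j]. *)
  apply: (@represents_ms_integral _ _ _ P X Rcov sX iRhat _
    (fun x => c * H (2 ^+ j * x + - l%:~R)) (2 ^+ j)^-1) => //.
  - apply: ccontinuousM; first exact: ccontinuous_cst.
    by apply: (ccontinuous_comp _ cg); exact: continuous_affine.
  - by apply: rintegrableZ; exact: rintegrable_affine.
  - move=> x y xy; rewrite dilateE Normc.normcM normc_real ger0_norm // ler_wpM2l //.
    apply: gH; rewrite (_ : _ - _ = 2 ^+ j * (x - y)); last by ring.
    by rewrite normrM gtr0_norm // mulrC -ler_pdivlMr // div1r.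
move=> /(representsZ sX iRhat c%:C); congr (represents P X Rcov _ _).
apply/funext => u; rewrite (_ : c%:C = conjc c%:C); last by apply: complex_ext; rewrite //= oppr0.
by rewrite -conjcM fourier_dilate // conjcM conj_cis opprK.
Qed.

(** By truncated subtraction the first [B] terms equal [s 0]; the others form an initial part of the
    series of the [s i]. *)
Lemma sum_envelope_shift (g : R -> R[i]) s tau (B q : nat) : envelope g s tau ->
  \sum_(l < q) s (l - B)%N <= B%:R * s 0%N + tau 0%N.
Proof.
move=> [s0 sD _ stau _].
have h1 : \sum_(l < q) s (l - B)%N <= \sum_(0 <= l < B + q) s (l - B)%N.
  rewrite -(big_mkord xpredT (fun l => s (l - B)%N)) [leRHS](big_cat_nat (n := q)) //=; last lia.
  by rewrite lerDl sumr_ge0.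
apply: (le_trans h1); rewrite (big_cat_nat (n := B)) //=; last lia.
apply: lerD.
  rewrite (eq_big_nat _ _ (F2 := fun=> s 0%N)); last by move=> i iB; rewrite (eqP (_ : i - B == 0)%N) //; lia.
  by rewrite sumr_const_nat subn0 mulr_natl.
rewrite -{1}[B]add0n big_addn addnC addnK.
by under eq_bigr do rewrite addnK; exact: stau.
Qed.

Lemma sum_geometric_half (q : nat) : \sum_(j < q) (2 ^+ j)^-1 <= 2 :> R.
Proof.
suff -> : \sum_(j < q) (2 ^+ j)^-1 = 2 - 2 * (2 ^+ q)^-1 :> R.
  by rewrite gerBl mulr_ge0 // invr_ge0 exprn_ge0.
elim: q => [|q IH]; first by rewrite big_ord0 expr0 invr1; ring.
by rewrite big_ord_recr /= IH exprS; field; rewrite expf_neq0.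
Qed.

End wavelet_coefficients.

Section wavelet_expansion.
Context {R : realType}.
Local Notation mu := (@lebesgue_measure R).
Local Notation rintegrable f := (mu.-integrable setT (EFin \o f)).

Lemma level_weights_le (beta : nat -> nat -> R) (g1 g2 : R -> R[i]) (s1 tau1 s2 tau2 : nat -> R)
    (B q : nat) (c0 c1 : R) : envelope g1 s1 tau1 -> envelope g2 s2 tau2 ->
  0 <= c0 -> 0 <= c1 ->
  (forall l, beta 0%N l <= c0 * s1 (l - B)%N) ->
  (forall j l, beta j.+1 l <= c1 / 4 ^+ j * s2 (l - 2 ^ j * B)%N) ->
  \sum_(i < q) \sum_(l < q) beta i l <=
  c0 * (B%:R * s1 0%N + tau1 0%N) + c1 * (B%:R * s2 0%N + tau2 0%N) * 2.
Proof.
move=> e1 e2 c00 c10 h1 h2.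
have s10 : 0 <= s1 0%N by case: e1.
have s20 : 0 <= s2 0%N by case: e2.
have t10 : 0 <= tau1 0%N by case: (e1) => _ _ _ /(_ 0%N 0%N); rewrite big_geq.
have t20 : 0 <= tau2 0%N by case: (e2) => _ _ _ /(_ 0%N 0%N); rewrite big_geq.
set A1 := B%:R * s1 0%N + _; set A2 := B%:R * s2 0%N + _.
have A10 : 0 <= A1 by rewrite addr_ge0 // mulr_ge0.
have A20 : 0 <= A2 by rewrite addr_ge0 // mulr_ge0.
have p0 : 0 <= c0 * A1 by rewrite mulr_ge0.
have p1 : 0 <= c1 * A2 * 2 by rewrite !mulr_ge0.
have row0 : \sum_(l < q) beta 0%N l <= c0 * A1.
  apply: (@le_trans _ _ (c0 * \sum_(l < q) s1 (l - B)%N)).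
    by rewrite mulr_sumr; apply: ler_sum => l _.
  by rewrite ler_wpM2l //; exact: sum_envelope_shift e1.
have rowj j : \sum_(l < q) beta j.+1 l <= c1 * A2 * (2 ^+ j)^-1.
  have p4 : 0 <= c1 / 4 ^+ j by rewrite divr_ge0 // exprn_ge0.
  apply: (@le_trans _ _ (c1 / 4 ^+ j * \sum_(l < q) s2 (l - 2 ^ j * B)%N)).
    by rewrite mulr_sumr; apply: ler_sum => l _.
  (* The row of scale [j] is longer by the factor [2^j], since [2^j t] ranges over that much more of
     the line; against [4^-j] this leaves a geometric series of ratio one half. *)
  apply: (@le_trans _ _ (c1 / 4 ^+ j * (2 ^+ j * A2))).
    rewrite ler_wpM2l //; apply: le_trans (sum_envelope_shift _ _ e2) _.
    rewrite natrM natrX /A2 mulrDr mulrA lerD2l ler_peMl //.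
    by rewrite exprn_ege1 // ler1n.
  rewrite (_ : 4 = 2 * 2 :> R); last by ring.
  by rewrite exprMn le_eqVlt; apply/orP; left; apply/eqP; field; rewrite expf_neq0.
case: q row0 rowj => [|q] row0 rowj; first by rewrite big_ord0 addr_ge0.
rewrite big_ord_recl; apply: lerD => //.
apply: (@le_trans _ _ (\sum_(j < q) c1 * A2 * (2 ^+ j)^-1)).
  by apply: ler_sum => j _; exact: rowj.
by rewrite -mulr_sumr ler_wpM2l ?sum_geometric_half // mulr_ge0.
Qed.

Lemma wavelet_approximation (phi psi : R -> R[i]) : f_wavelet phi -> m_wavelet phi psi ->
  ccontinuous phi -> ccontinuous psi -> assumption_S phi -> assumption_S psi ->
  cderivable (fourier phi) ->
  (exists M : R, forall u, normc (fourier phi u) <= M) ->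
  (exists M : R, forall u, normc (cderive (fourier phi) u) <= M) ->
  normc (fourier phi u) @[u --> +oo] --> (0 : R) ->
  normc (fourier phi u) @[u --> -oo] --> (0 : R) ->
  (exists gamma alpha : R, [/\ 0 < gamma < 1, 0 <= alpha &
     (\int[mu]_u ((ln (1 + `|u|)) `^ alpha * (normc (fourier phi u)) `^ gamma)%:E < +oo)%E]) ->
  forall (w : R -> R) (t e : R), rintegrable w -> (forall u, 0 <= w u) -> 0 < e ->
  exists N, forall n, (N <= n)%N -> exists K0, forall K, (K0 <= K)%N ->
    Rintegral mu setT (fun u => normc (cis (u * t) - wavelet_spectrum phi psi n K t u) ^+ 2 * w u) < e.
Proof.
move=> [_ F0 _ sumF _] [m0 [m0per [m0meas _] m0F] psiE] cphi cpsi Sphi Spsi dF [M FM] [M' F'M] Fp Fm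
  [gamma [alpha [gam al logm]]] w t e iw w0 e0.
have [s1 [tau1 e1]] := assumption_S_envelope cphi Sphi.
have [s2 [tau2 e2]] := assumption_S_envelope cpsi Spsi.
have iphi := assumption_S_cintegrable cphi Sphi.
have ipsi := assumption_S_cintegrable cpsi Spsi.
have cF := fourier_ccontinuous iphi.
have Finf := vanishing_at_infty Fp Fm.
have M0 : 0 <= M := le_trans (normc_ge0 _) (FM 0).
have M'0 : 0 <= M' := le_trans (normc_ge0 _) (F'M 0).
have iF : cintegrable mu (fourier phi).
  exact: (log_moment_cintegrable (cmeasurable_continuous cF) FM gam al logm).
have F1 : normc (fourier phi 0) = 1.
  (* One constant serves as Lipschitz constant ([2 * M']) and as bound ([M]); the summand 1 makes it
     positive. *)
  apply: (low_pass_norm1 cF F0 Finf m0per m0F sumF (L := 2 * M' + M + 1)) => //.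
  - by lra.
  - move=> x y; apply: le_trans (cderive_mvt (M := M') dF (fun t _ => F'M t)) _.
    by rewrite ler_wpM2r //; lra.
  - by move=> x; have := FM x; lra.
apply: (wavelet_spectrum_L2 cphi cpsi e1 e2 iphi ipsi m0per) => //.
- exact: refinement_shift.
- exact: (fourier_mother cF iF FM Finf F0 m0meas m0per m0F sumF cpsi ipsi psiE).
- exact: (quadrature_mirror F0 Finf m0per m0F sumF).
- by move=> l; exact: (low_pass_zeros cF F0 Finf m0per m0F).
Qed.

End wavelet_expansion.

Section level_enumeration.
Context {R : realType} {d : measure_display} {Omega : measurableType d}.

(* Level [0] is the scaling function, level [j.+1] the wavelets of scale [j];
   the factor [2^(j/2)] of [dilate] is moved to the coefficients. *)
Definition level_coef (xi : int -> Omega -> R[i]) (eta : nat -> int -> Omega -> R[i])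
    (i : nat) (l : int) (w : Omega) : R[i] :=
  if i is j.+1 then (2 `^ (j%:R / 2))%:C * eta j l w else xi l w.

Definition level_fun (phi psi : R -> R[i]) (i : nat) (l : int) (t : R) : R[i] :=
  if i is j.+1 then psi (2 ^+ j * t - l%:~R) else phi (t - l%:~R).

(** With the predecessor, levels 0 and 1, the scaling functions and the wavelets of scale 0, are
    both truncated at [k_0]. *)
Definition level_size n (k : n.-tuple nat) (i : nat) : nat := nth 0%N k i.-1.

Lemma dilate0 (phi : R -> R[i]) (l : int) (t : R) : dilate phi 0 l t = phi (t - l%:~R).
Proof. by rewrite (dilateE phi 0) mul0r powRr0 expr0 !mul1r. Qed.

Lemma wavelet_sumE phi psi xi eta n (k : n.-tuple nat) t w :
  wavelet_sum phi psi xi eta k t w =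
  level_sum (level_coef xi eta) (level_fun phi psi) n.+1 (level_size k) t w.
Proof.
rewrite /wavelet_sum /level_sum big_ord_recl; congr (_ + _).
  by apply: eq_sym_sum => l /=; rewrite dilate0.
apply: eq_bigr => j _; rewrite (tnth_nth 0%N); apply: eq_sym_sum => l.
by rewrite dilateE /= mulrA [eta _ _ _ * _]mulrC.
Qed.

End level_enumeration.

Section wavelet_coefficient_bounds.
Context {R : realType} {d : measure_display} {Omega : measurableType d}.
Variable P : probability Omega R.
Local Notation mu := (@lebesgue_measure R).
Local Notation rintegrable f := (mu.-integrable setT (EFin \o f)).

Variables (X : R -> Omega -> R[i]) (Rcov : R -> R[i]) (phi psi : R -> R[i])
  (xi : int -> Omega -> R[i]) (eta : nat -> int -> Omega -> R[i]).
Hypotheses (sX : forall t, sqint P (X t))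
  (cov : forall t s, covariance_fun P X t s = Rcov (t - s))
  (cR : ccontinuous Rcov) (iR : cintegrable mu Rcov)
  (iRhat : cintegrable mu (fourier Rcov))
  (cphi : ccontinuous phi) (cpsi : ccontinuous psi)
  (Sphi : assumption_S phi) (Spsi : assumption_S psi)
  (xi_def : forall l : int,
    is_ms_integral P (fun t w => X t w * conjc (dilate phi 0 l t)) (xi l))
  (eta_def : forall (j : nat) (l : int),
    is_ms_integral P (fun t w => X t w * conjc (dilate psi j l t)) (eta j l)).

Let rep0 l : represents P X Rcov (xi l) (fun u => cis (u * l%:~R) * conjc (fourier phi u)).
Proof.
have := represents_dilate sX iRhat cphi Sphi (xi_def l).
congr (represents P X Rcov _ _); first by apply/funext => w; rewrite mul0r powRr0 mul1r.
by apply/funext => u; rewrite expr0 divr1.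
Qed.

Let repj j l : represents P X Rcov (fun w => (2 `^ (j%:R / 2))%:C * eta j l w)
  (fun u => cis (u / 2 ^+ j * l%:~R) * conjc (fourier psi (u / 2 ^+ j))).
Proof. exact: (represents_dilate sX iRhat cpsi Spsi (eta_def j l)). Qed.

Lemma sqint_level_coef i l : sqint P (level_coef xi eta i l).
Proof. by case: i => [|j]; [have [] := rep0 l|have [] := repj j l]. Qed.

Lemma represents_level_sum n K t :
  represents P X Rcov (level_sum (level_coef xi eta) (level_fun phi psi) n.+1 (fun=> K) t)
    (wavelet_spectrum phi psi n K t).
Proof.
have part (Zl : int -> Omega -> R[i]) (f : int -> R -> R[i]) (c : int -> R[i]) :
    (forall l, represents P X Rcov (Zl l) (f l)) ->
    represents P X Rcov (fun w => sym_sum K (fun l => Zl l w * c l)) (fun u => sym_sum K (fun l => f l u * c l)).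
  move=> rep; rewrite /sym_sum; apply: (represents_sum sX iRhat) => i.
  have := representsZ sX iRhat (c (i%:Z - K%:Z)) (rep (i%:Z - K%:Z)).
  by congr (represents P X Rcov _ _); apply/funext => x; rewrite mulrC.
have h0 := part _ _ (fun l => phi (t - l%:~R)) rep0.
have hj := represents_sum sX iRhat (index_enum 'I_n)
  (fun j : 'I_n => part _ _ (fun l => psi (2 ^+ j * t - l%:~R)) (repj j)).
have := representsD sX iRhat h0 hj; congr (represents P X Rcov _ _).
  by apply/funext => w; rewrite /level_sum big_ord_recl.
apply/funext => u; rewrite /wavelet_spectrum sym_sumM; congr (_ + _).
  by apply: eq_sym_sum => l; rewrite [RHS]mulrA; congr (_ * _); exact: mulrC.
by apply: eq_bigr => j _; rewrite sym_sumM; apply: eq_sym_sum => l; rewrite [RHS]mulrA; congr (_ * _); exact: mulrC.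
Qed.

Lemma expectation_scaling_coef : exists2 c : R, 0 <= c &
  forall l, Rintegral P setT (fun w => normc (xi l w)) <= c.
Proof.
have iphi := assumption_S_cintegrable cphi Sphi.
pose B := 2 * Rintegral mu setT (fun x => normc (phi x)).
pose c := 4 * (B ^+ 2 * Rintegral mu setT (fun u => normc (fourier Rcov u))).
have iw := cintegrable_normc iRhat.
have I0 : 0 <= Rintegral mu setT (fun u => normc (fourier Rcov u)).
  by apply: Rintegral_ge0 => u _; exact: normc_ge0.
have c0 : 0 <= c by rewrite mulr_ge0 // mulr_ge0 // sqr_ge0.
exists ((c + 1) / 2) => [|l]; first lra.
have [sxi sf _] := rep0 l.
apply: le_trans (expectation_normc sxi ltr01) _; rewrite mul1r invr1.
suff : nrm2 P (xi l) <= c by lra.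
apply: le_trans (represents_bound sX cov cR iR iRhat (rep0 l)) _.
rewrite /c ler_pM2l // -(RintegralZl _ measurableT iw); have [_ isf] := sf.
apply: le_Rintegral => //; first exact: rintegrableZ.
move=> u _; rewrite sqr_normc_weighted ler_wpM2r ?normc_ge0 //.
rewrite Normc.normcM normc_cis mul1r normc_conj ler_pXn2r ?nnegrE ?normc_ge0 //.
  exact: normc_fourier.
by rewrite mulr_ge0 //; apply: Rintegral_ge0 => x _; exact: normc_ge0.
Qed.

Lemma expectation_wavelet_coef (M : R) :
  (forall u, normc (fourier psi u) <= M * u ^+ 2) ->
  rintegrable (fun z => normc (fourier Rcov z) * `|z| ^+ 4) ->
  exists2 c : R, 0 <= c & forall j l,
    Rintegral P setT (fun w => normc ((2 `^ (j%:R / 2))%:C * eta j l w)) <= c / 4 ^+ j.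
Proof.
move=> psiM im.
pose I4 := Rintegral mu setT (fun z => normc (fourier Rcov z) * `|z| ^+ 4).
have I40 : 0 <= I4 by apply: Rintegral_ge0 => u _; rewrite mulr_ge0 ?normc_ge0 ?exprn_ge0.
pose c := 4 * (M ^+ 2 * I4).
have c0 : 0 <= c by rewrite mulr_ge0 // mulr_ge0 // sqr_ge0.
exists ((c + 1) / 2) => [|j l]; first lra.
have [se sf _] := repj j l.
have j4 : 0 < 4 ^+ j :> R by rewrite exprn_gt0.
have j2 : 2 ^+ j != 0 :> R by rewrite expf_neq0.
have E4 : 4 ^+ j = 2 ^+ j * 2 ^+ j :> R by rewrite -exprMn; congr (_ ^+ j); ring.
(* The second moment is of order [16^-j], so the weight [4^j] makes both terms of the inequality of
   order [4^-j]. *)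
apply: le_trans (expectation_normc se j4) _.
suff h : nrm2 P (fun w => (2 `^ (j%:R / 2))%:C * eta j l w) <= c / (4 ^+ j * 4 ^+ j).
  have h' : 4 ^+ j * nrm2 P (fun w => (2 `^ (j%:R / 2))%:C * eta j l w) <= c / 4 ^+ j.
    apply: (@le_trans _ _ (4 ^+ j * (c / (4 ^+ j * 4 ^+ j)))); first by rewrite ler_wpM2l // ltW.
    by rewrite le_eqVlt; apply/orP; left; apply/eqP; field; lra.
  rewrite (_ : (c + 1) / 2 / 4 ^+ j = (c / 4 ^+ j + (4 ^+ j)^-1) / 2); last by field; lra.
  lra.
apply: le_trans (represents_bound sX cov cR iR iRhat (repj j l)) _.
rewrite (_ : c / (4 ^+ j * 4 ^+ j) = 4 * (M ^+ 2 / (4 ^+ j * 4 ^+ j) * I4)); last by rewrite /c; field; lra.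
rewrite ler_pM2l // -(RintegralZl _ measurableT im); have [_ isf] := sf.
apply: le_Rintegral => //; first exact: rintegrableZ.
move=> u _; rewrite sqr_normc_weighted mulrCA [leRHS]mulrC ler_wpM2r ?normc_ge0 //.
rewrite Normc.normcM normc_cis mul1r normc_conj.
have := psiM (u / 2 ^+ j) => h.
apply: (@le_trans _ _ ((M * (u / 2 ^+ j) ^+ 2) ^+ 2)).
  by rewrite ler_pXn2r ?nnegrE ?normc_ge0 // (le_trans (normc_ge0 _) h).
have -> : `|u| ^+ 4 = u ^+ 2 ^+ 2 by rewrite -[4%N]/(2 * 2)%N exprM real_normK ?num_real.
by rewrite E4 le_eqVlt; apply/orP; left; apply/eqP; field.
Qed.

End wavelet_coefficient_bounds.

Theorem theorem3 (R : realType) (d : measure_display)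
  (Omega : measurableType d) (P : probability Omega R)
  (X : R -> Omega -> R[i]) (Rcov : R -> R[i]) (phi psi : R -> R[i])
  (X_gaussian : gaussian_process P X)
  (X_centered : centered_process P X)
  (X_separable : separable_process P X)
  (X_stationary : forall t s, covariance_fun P X t s = Rcov (t - s))
  (Rcov_continuous : ccontinuous Rcov)
  (phi_wavelet : f_wavelet phi)
  (psi_wavelet : m_wavelet phi psi)
  (phi_continuous : ccontinuous phi)
  (psi_continuous : ccontinuous psi)
  (phi_S : assumption_S phi)
  (psi_S : assumption_S psi)
  (* 1 *)
  (phi_hat_derivable : cderivable (fourier phi))
  (psi_hat_derivable : cderivable (fourier psi))
  (psi_hat_derivable2 : cderivable (cderive (fourier psi)))
  (psi_hat0 : fourier psi 0 = 0)
  (psi_hat'0 : cderive (fourier psi) 0 = 0)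
  (* 2 *)
  (phi_hat_bounded : exists M : R, forall u, normc (fourier phi u) <= M)
  (phi_hat'_bounded :
    exists M : R, forall u, normc (cderive (fourier phi) u) <= M)
  (psi_hat''_bounded :
    exists M : R, forall u, normc (cderive (cderive (fourier psi)) u) <= M)
  (* 3 *)
  (phi_hat_pinfty : normc (fourier phi u) @[u --> +oo] --> (0 : R))
  (phi_hat_ninfty : normc (fourier phi u) @[u --> -oo] --> (0 : R))
  (psi_hat_pinfty : normc (fourier psi u) @[u --> +oo] --> (0 : R))
  (psi_hat_ninfty : normc (fourier psi u) @[u --> -oo] --> (0 : R))
  (* 4 *)
  (log_moments : exists gamma alpha : R,
    [/\ 0 < gamma < 1 / 2, 1 / 2 < alpha,
      (\int[lebesgue_measure]_u ((ln (1 + `|u|)) `^ alpha *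
         (normc (fourier psi u)) `^ gamma)%:E < +oo)%E &
      (\int[lebesgue_measure]_u ((ln (1 + `|u|)) `^ alpha *
         (normc (fourier phi u)) `^ gamma)%:E < +oo)%E])
  (* 5 *)
  (Rcov_integrable : cintegrable lebesgue_measure Rcov)
  (Rhat_bounded : exists M : R, forall z, normc (fourier Rcov z) <= M)
  (* 6 *)
  (Rhat_derivable : cderivable (fourier Rcov))
  (Rhat'_integrable :
    (\int[lebesgue_measure]_z (normc (cderive (fourier Rcov) z))%:E < +oo)%E)
  (Rhat_moment :
    (\int[lebesgue_measure]_z
       (normc (fourier Rcov z) * `|z| ^+ 4)%:E < +oo)%E)
  (Rhat'_moment :
    (\int[lebesgue_measure]_z
       (normc (cderive (fourier Rcov) z) * `|z| ^+ 4)%:E < +oo)%E)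
  (* the wavelet coefficients, up to versions *)
  (xi : int -> Omega -> R[i]) (eta : nat -> int -> Omega -> R[i])
  (xi_def : forall l : int,
    is_ms_integral P (fun t w => X t w * conjc (dilate phi 0 l t)) (xi l))
  (eta_def : forall (j : nat) (l : int),
    is_ms_integral P (fun t w => X t w * conjc (dilate psi j l t)) (eta j l))
  (* an arbitrary sequence of pairs (n, k_n) with n and all k_j tending to
     infinity *)
  (n : nat -> nat) (k : forall m, (n m).-tuple nat)
  (n_gt0 : forall m, (0 < n m)%N)
  (n_infty : n m @[m --> \oo] --> \oo)
  (k_infty : forall j : nat, nth 0%N (k m) j @[m --> \oo] --> \oo)
  (T eps : R) (T_gt0 : 0 < T) (eps_gt0 : 0 < eps) :
  (* mu_ext P is the outer measure of P, which agrees with P on measurable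
     sets and with its completion on the completed sigma-algebra *)
  mu_ext P [set w | (eps%:E < ereal_sup
      [set (normc (X t w - wavelet_sum phi psi xi eta (k m) t w))%:E
         | t in `[0%R, T]%classic])%E] @[m --> \oo] --> (0 : \bar R).

Proof.
have [gamma [alpha [gam al _ logm]]] := log_moments.
have [M2 psiM2] := psi_hat''_bounded.
have [MR RM] := Rhat_bounded.
have sX t : sqint P (X t) by exact: gaussian_process_sqint.
have mRhat := cmeasurable_continuous (fourier_ccontinuous Rcov_integrable).
have iRhat := bounded_moment_cintegrable mRhat RM Rhat_moment.
have im := moment_rintegrable mRhat Rhat_moment.
have psiq u := quadratic_bound u psi_hat_derivable psi_hat_derivable2 psi_hat0 psi_hat'0 psiM2.
have [s1 [tau1 e1]] := assumption_S_envelope phi_continuous phi_S.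
have [s2 [tau2 e2]] := assumption_S_envelope psi_continuous psi_S.
have [c0 c00 hc0] := expectation_scaling_coef sX X_stationary Rcov_continuous Rcov_integrable
  iRhat phi_continuous phi_S xi_def.
have [c1 c10 hc1] := expectation_wavelet_coef sX X_stationary Rcov_continuous Rcov_integrable
  iRhat psi_continuous psi_S eta_def psiq im.
have approx := wavelet_approximation phi_wavelet psi_wavelet phi_continuous psi_continuous phi_S psi_S
  phi_hat_derivable phi_hat_bounded phi_hat'_bounded phi_hat_pinfty phi_hat_ninfty.
have [B TB] := normr_le_nat (T + 1).
pose Z := level_coef xi eta; pose theta := level_fun phi psi.
(* For [|t| <= B] the argument [2^j t] is at most [2^j B] in absolute value, which is the shift to
   be discounted in the envelope. *)
pose a i l := if i is j.+1 then s2 (l - 2 ^ j * B)%N else s1 (l - B)%N.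
rewrite (_ : (fun m => _) = (fun m => mu_ext P [set w | (eps%:E < ereal_sup
    [set (normc (X t w - level_sum Z theta (n m).+1 (level_size (k m)) t w))%:E
       | t in `[0%R, T]%classic])%E])); last first.
  apply/funext => m; congr (mu_ext P _); apply/funext => w /=.
  have -> // : (fun t => (normc (X t w - wavelet_sum phi psi xi eta (k m) t w))%:E) =
      (fun t => (normc (X t w - level_sum Z theta (n m).+1 (level_size (k m)) t w))%:E).
  by apply/funext => t; rewrite wavelet_sumE.
(* The constants [c0] and [c1] are doubled because the indices [l] and [- l] are estimated
   together. *)
apply: (@uniform_convergence_in_probability _ _ _ P X Z theta a B
  (2 * c0 * (B%:R * s1 0%N + tau1 0%N) + 2 * c1 * (B%:R * s2 0%N + tau2 0%N) * 2)
  _ _ _ _ _ _ _ (fun m => (n m).+1) (fun m => level_size (k m)) T eps) => //.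
- by move=> i l; exact: (sqint_level_coef sX iRhat phi_continuous psi_continuous phi_S psi_S xi_def eta_def).
- move=> [|j] l; rewrite /theta /=.
    by apply: (ccontinuous_comp _ phi_continuous) => x; apply: cvgB; [exact: cvg_id|exact: cvg_cst].
  by apply: (ccontinuous_comp _ psi_continuous); exact: continuous_affine.
- move=> [|j] l t tB; rewrite /theta /a /=; first exact: (envelope_shift e1).
  apply: (envelope_shift e2); rewrite normrM ger0_norm ?exprn_ge0 // natrM natrX.
  by rewrite ler_wpM2l // exprn_ge0.
- move=> q; apply: (@level_weights_le _ (fun i l => (Rintegral P setT (fun w => normc (Z i l%:Z w)) +
    Rintegral P setT (fun w => normc (Z i (- l%:Z) w))) * a i l) _ _ _ _ _ _ B q _ _ e1 e2);
    rewrite ?mulr_ge0 //.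
  + move=> l; rewrite /a /= ler_wpM2r //; first by case: e1.
    by have := hc0 l%:Z; have := hc0 (- l%:Z); lra.
  + move=> j l; rewrite /a /= ler_wpM2r //; first by case: e2.
    by have := hc1 j l%:Z; have := hc1 j (- l%:Z); lra.
(* The quarter compensates for the constant in [represents_bound]. *)
- move=> t e e0; have e4 : 0 < e / 4 by lra.
  have [|N hN] := approx _ (fun u => normc (fourier Rcov u)) t (e / 4) (cintegrable_normc iRhat)
      (fun u => normc_ge0 _) e4.
    by exists gamma, alpha; split => //; lra.
  (* The level count includes the scaling functions, so [n'.+1] levels correspond to [n'] scales of
     wavelets. *)
  exists N.+1 => -[//|n'] /hN[K0 hK0]; exists K0 => K /hK0 h.
  have rX := represents_process sX iRhat t.
  have rW := represents_level_sum sX iRhat phi_continuous psi_continuous phi_S psi_S xi_def eta_def n' K t.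
  have := representsD sX iRhat rX (representsZ sX iRhat (-1) rW).
  move=> /(represents_bound sX X_stationary Rcov_continuous Rcov_integrable iRhat).
  rewrite (eq_nrm2 P (W := fun w => X t w - level_sum Z theta n'.+1 (fun=> K) t w)); last first.
    by move=> w; rewrite mulN1r.
  move=> h4; apply: (le_lt_trans h4); rewrite /nrm2.
  rewrite (_ : Rintegral _ _ _ = Rintegral lebesgue_measure setT (fun u =>
    normc (cis (u * t) - wavelet_spectrum phi psi n' K t u) ^+ 2 * normc (fourier Rcov u))); first lra.
  by congr (Rintegral _ _ _); apply/funext => u; rewrite sqr_normc_weighted mulN1r.
- move=> N; move/cvgnyPge : n_infty => /(_ N)[m0 _ h].
  by exists m0 => m /h; exact: leqW.
- move=> N i; move/cvgnyPge : (k_infty i.-1) => /(_ N)[m0 _ h].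
  by exists m0 => m /h; exact: leqW.
- exact: le_trans (ler_norm _) TB.
Qed.
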